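(* Let $1\le p<+\infty$ and consider the controlled flow in a network (with $n$ vertices, $m$ edges and control vertex $v$) with dynamic boundary conditions, given by the boundary control system on $X=L^p([0,1],\mathbb C^m)\times\mathbb C^n$ described in the context. If $t\ge\min\{m,n\}=:l$, then the exact reachability space satisfies $$\bigl[e\mathcal R^{\mathrm{BC}}_t\bigr]_1\subseteq\Bigl\{\Psi\sum_{k=0}^{l}(u_k\otimes\mathbb A^kv):u_k\in W^{k,p}[0,1]\text{ for }0\le k\le l\Bigr\}=\Bigl\{\sum_{k=0}^{l}(u_k\otimes\mathbb B^k\Psi v):u_k\in W^{k,p}[0,1]\text{ for }0\le k\le l\Bigr\},$$ where $W^{0,p}[0,1]:=L^p[0,1]$.
   Context: Network. A finite directed network has vertices $v_1,\dots,v_n$ and edges $e_1,\dots,e_m$. $\Psi\in \mathrm M_{m\times n}(\mathbb C)$: $\Psi_{ij}:=w_{ij}\in[0,1]$ if $e_i$ starts at $v_j$, and $0$ otherwise; $\Psi$ is assumed column stochastic (columns sum to $1$). $\Phi^-\in \mathrm M_{n\times m}(\mathbb C)$: $(\Phi^-)_{ij}:=1$ if $e_j$ starts at $v_i$, and $0$ otherwise; thus $\Phi^-\Psi=I$. $\Phi_w^+\in \mathrm M_{n\times m}(\mathbb C)$: $(\Phi_w^+)_{ij}:=w_{ij}^+\in[0,1]$ if $e_j$ ends at $v_i$, and $0$ otherwise. $\mathbb A:=\Phi_w^+\Psi\in \mathrm M_n(\mathbb C)$, $\mathbb B:=\Psi\Phi_w^+\in \mathrm M_m(\mathbb C)$.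 $v=v_i$ denotes the $i$-th canonical basis vector of $\mathbb C^n$ (the control acts in the $i$-th vertex). Control system $\dot x=A_mx$, $Qx=Bu$, $x(0)=0$: $X:=L^p([0,1],\mathbb C^m)\times\mathbb C^n$; $\partial X:=\mathbb C^n$; $U:=\mathbb C$; $B:=v\in\mathbb C^n\simeq\mathcal L(\mathbb C,\mathbb C^n)$; $A_m\binom fd:=\binom{f'}{\Phi_w^+f(0)}$ with $D(A_m):=\{\binom fd\in W^{1,p}([0,1],\mathbb C^m)\times\mathbb C^n:f(1)\in\operatorname{rg}\Psi\}$; $Q:D(A_m)\to\mathbb C^n$, $Q\binom fd:=\Phi^-f(1)-d$; $A\subset A_m$ with $D(A)=\ker Q$. $A$ generates a strongly continuous semigroup $(T(t))_{t\ge0}$ on $X$, and $Q$ is surjective. For $\lambda\in\rho(A)$, $Q_\lambda:=(Q|_{\ker(\lambda-A_m)})^{-1}:\partial X\to\ker(\lambda-A_m)\subseteq X$ exists and is bounded, and $B_\lambda:=Q_\lambda B$. $B$ is $p$-boundary admissible, i.e. $\int_0^tT(t-s)B_\lambda u(s)\,ds\in D(A)$ for all $u\in L^p([0,t],U)$, and the controllability map is $\mathcal B_t^{\mathrm{BC}}u:=(\lambda-A)\int_0^tT(t-s)B_\lambda u(s)\,ds$ (independent of $\lambda\in\rho(A)$). $e\mathcal R^{\mathrm{BC}}_t:=\operatorname{rg}(\mathcal B^{\mathrm{BC}}_t)\subseteq X$. For $\binom fd\in X$, $[\binom fd]_1:=f$; for a set $S\subseteq X$, $[S]_1:=\{[x]_1:x\in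 S\}$. $(f\otimes d)(s):=f(s)d$. *)

(* Defs.v *)
From HB Require Import structures.
From mathcomp Require Import all_boot all_order all_algebra.
From mathcomp Require Import generic_quotient ring_quotient.
From mathcomp Require Import all_classical all_reals all_analysis.
From mathcomp Require Import measurable_realfun lebesgue_measure complex.

Set Implicit Arguments.
Unset Strict Implicit.
Unset Printing Implicit Defensive.

Import Order.TTheory GRing.Theory Num.Theory.
Import numFieldNormedType.Exports.

Local Open Scope classical_set_scope.
Local Open Scope ring_scope.


Section Lp_functions.
Context (R : realType).
Local Notation C := R[i].
Local Notation mu := (@lebesgue_measure R).
Local Notation I01 := (`[0%R, 1%R]%classic : set R).

(* Values outside of [D] are irrelevant: they are overwritten by 0. *)
Definition in_Lp (p : R) (D : set R) (u : R -> C) : bool :=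
  ((@complex.Re R \o u) \_ D \in Lfun mu p%:E) &&
  ((@complex.Im R \o u) \_ D \in Lfun mu p%:E).

Definition Lp_vec (p : R) (p1 : 1 <= p) (m : nat) : {pred R -> 'cV[C]_m} :=
  fun f => [forall i, in_Lp p I01 (fun s => f s i 0)].

(* The (l^1-)norm of C^m; all norms on C^m give the same space. *)
Definition vnorm m (z : 'cV[C]_m) : R := \sum_i Normc.normc (z i 0).

Definition Lp_vec_norm (p : R) m (f : R -> 'cV[C]_m) : R :=
  fine 'N[mu]_p%:E[EFin \o (@vnorm m \o f) \_ I01]%E.

End Lp_functions.

Arguments Lp_vec {R p} p1 m.
Arguments vnorm {R m} z.
Arguments Lp_vec_norm {R} p {m} f.

Section Lp_theory.
Context (R : realType) (p : R) (p1 : 1 <= p).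
Local Notation C := R[i].
Local Notation mu := (@lebesgue_measure R).
Local Notation I01 := (`[0%R, 1%R]%classic : set R).
Let p1e : (1 <= p%:E)%E. Proof. by rewrite lee_fin. Qed.

Lemma cReD (a b : C) : complex.Re (a + b) = complex.Re a + complex.Re b.
Proof. by case: a b => [? ?] [? ?]. Qed.
Lemma cImD (a b : C) : complex.Im (a + b) = complex.Im a + complex.Im b.
Proof. by case: a b => [? ?] [? ?]. Qed.
Lemma cReM (a b : C) : complex.Re (a * b) =
  complex.Re a * complex.Re b - complex.Im a * complex.Im b.
Proof. by case: a b => [? ?] [? ?]. Qed.
Lemma cImM (a b : C) : complex.Im (a * b) =
  complex.Re a * complex.Im b + complex.Im a * complex.Re b.
Proof. by case: a b => [? ?] [? ?]. Qed.

Let pointE : (point : R) = 0. Proof. by []. Qed.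

Lemma in_Lp0 D : in_Lp p D (fun=> 0 : C).
Proof.
rewrite /in_Lp.
have h (g : C -> R) : g 0 = 0 -> (g \o (fun=> 0)) \_ D = 0 :> (R -> R).
  by move=> g0; apply/funext => x; rewrite /patch/= g0; case: ifP.
by rewrite !h// (Lfun_submod_closed mu p1e).1.
Qed.

Lemma in_LpZD D a (u v : R -> C) : in_Lp p D u -> in_Lp p D v ->
  in_Lp p D (fun s => a * u s + v s).
Proof.
have cl := (Lfun_submod_closed mu p1e).2.
move=> /andP[ur ui] /andP[vr vi]; rewrite /in_Lp.
have -> : (@complex.Re R \o (fun s => a * u s + v s)) \_ D =
   complex.Re a *: ((@complex.Re R \o u) \_ D) +
   ((- complex.Im a) *: ((@complex.Im R \o u) \_ D) + (@complex.Re R \o v) \_ D).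
  apply/funext => x; rewrite /patch/= !fctE /patch/=; case: ifP => _.
    by rewrite cReD cReM /GRing.scale/= addrA mulNr.
  by rewrite pointE !scaler0 !addr0.
have -> : (@complex.Im R \o (fun s => a * u s + v s)) \_ D =
   complex.Re a *: ((@complex.Im R \o u) \_ D) +
   (complex.Im a *: ((@complex.Re R \o u) \_ D) + (@complex.Im R \o v) \_ D).
  apply/funext => x; rewrite /patch/= !fctE /patch/=; case: ifP => _.
    by rewrite cImD cImM /GRing.scale/= addrA.
  by rewrite pointE !scaler0 !addr0.
by apply/andP; split; do 2![apply: (cl) => //].
Qed.

Context (m : nat).

Lemma Lp_vec_submod_closed : submod_closed (Lp_vec p1 m).
Proof.
split.
  apply/forallP => i.
  by rewrite (_ : (fun _ => _) = fun=> 0 : C) ?in_Lp0//; apply/funext => s; rewrite mxE.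
move=> a f g /forallP fL /forallP gL; apply/forallP => i.
rewrite (_ : (fun _ => _) = fun s => a * f s i 0 + g s i 0) ?in_LpZD//.
by apply/funext => s; rewrite !fctE !mxE.
Qed.

HB.instance Definition _ := GRing.isSubmodClosed.Build C (R -> 'cV[C]_m)
  (Lp_vec p1 m) Lp_vec_submod_closed.

Definition LpFun := {f : R -> 'cV[C]_m | f \in Lp_vec p1 m}.
HB.instance Definition _ := SubChoice.on LpFun.
HB.instance Definition _ := [SubChoice_isSubLmodule of LpFun by <:].

Definition Lp_null : {pred LpFun} :=
  fun f => `[< ae_eq mu I01 (val f) (cst 0) >].

Lemma Lp_null_zmod_closed : zmod_closed Lp_null.
Proof.
split; first by apply/asboolP; apply: aeW.
move=> f g /asboolP f0 /asboolP g0; apply/asboolP.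
apply: filterS2 f0 g0 => x hf hg Dx.
have -> : val (f - g) x = val f x - val g x by [].
by rewrite hf// hg// subrr.
Qed.

HB.instance Definition _ := GRing.isZmodClosed.Build LpFun Lp_null
  Lp_null_zmod_closed.

Let mD : measurable I01. Proof. exact: measurable_itv. Qed.

Let Lfun_dom (g h : R -> R) : measurable_fun setT g ->
  (forall x, `|g x| <= h x) -> h \in Lfun mu p%:E -> g \in Lfun mu p%:E.
Proof.
move=> mg gh /andP[/[!inE] mh hfin].
rewrite /Lfun; apply/andP; split; rewrite inE//=; move: hfin; rewrite /finite_norm.
apply: le_lt_trans; rewrite unlock /Lnorm.
have p0 : 0 < p by rewrite (lt_le_trans ltr01).
have pm (k : R -> R) : measurable_fun setT k ->
  measurable_fun setT (fun x : R => (`|k x| `^ p)%:E).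
  move=> mk; apply/measurable_EFinP => /=.
  apply: (@measurableT_comp _ _ _ _ _ _ (@powR R ^~ p)) => //.
  exact: measurableT_comp.
have p1i : 0 <= p^-1 by rewrite invr_ge0 ltW.
apply: gt0_ler_poweR => //.
- by rewrite in_itv/= leey andbT integral_ge0// => x _; rewrite poweR_ge0.
- by rewrite in_itv/= leey andbT integral_ge0// => x _; rewrite poweR_ge0.
apply: ge0_le_integral => //.
- by move=> x _; rewrite poweR_ge0.
- exact: (pm g).
- exact: (pm h).
move=> x _ /=; rewrite lee_fin ge0_ler_powR ?nnegrE// ?(ltW p0)//.
by rewrite (le_trans (gh x))// ler_norm.
Qed.

Let Lfun_abs (h : R -> R) : h \in Lfun mu p%:E ->
  (fun x => `|h x|) \in Lfun mu p%:E.
Proof.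
move=> /andP[/[!inE] mh hfin]; apply/andP; split; rewrite inE/=.
  exact: measurableT_comp.
rewrite /finite_norm (_ : EFin \o _ = abse \o (EFin \o h))%E//.
by rewrite Lnorm_abse.
Qed.

Lemma normcE (z : C) :
  Normc.normc z = Num.sqrt (complex.Re z ^+ 2 + complex.Im z ^+ 2).
Proof. by case: z. Qed.

Lemma vnorm_ge0 (z : 'cV[C]_m) : 0 <= vnorm z.
Proof. by apply: sumr_ge0 => i _; rewrite normcE sqrtr_ge0. Qed.

Lemma vnormD (z w : 'cV[C]_m) : vnorm (z + w) <= vnorm z + vnorm w.
Proof.
rewrite /vnorm -big_split/=; apply: ler_sum => i _.
by rewrite mxE; exact: le_normcD.
Qed.

Lemma vnormZ (a : C) (z : 'cV[C]_m) : vnorm (a *: z) = Normc.normc a * vnorm z.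
Proof.
by rewrite /vnorm mulr_sumr; apply: eq_bigr => i _; rewrite mxE Normc.normcM.
Qed.

Lemma vnorm_eq0 (z : 'cV[C]_m) : vnorm z = 0 -> z = 0.
Proof.
move=> /eqP; rewrite psumr_eq0 => [|i _]; last by rewrite normcE sqrtr_ge0.
move=> /allP z0; apply/colP => i; rewrite mxE.
by apply: Normc.eq0_normc; apply/eqP/z0; rewrite mem_index_enum.
Qed.



Let normc_le (z : C) : Normc.normc z <= `|complex.Re z| + `|complex.Im z|.
Proof.
rewrite normcE -(@ler_sqr R) ?nnegrE ?sqrtr_ge0 ?addr_ge0//.
rewrite sqr_sqrtr ?addr_ge0 ?sqr_ge0// sqrrD !real_normK ?num_real//.
by rewrite lerD2r lerDl mulrn_wge0// mulr_ge0.
Qed.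

Lemma vnorm_Lfun (f : R -> 'cV[C]_m) : f \in Lp_vec p1 m ->
  (vnorm \o f) \_ I01 \in Lfun mu p%:E.
Proof.
move=> /forallP fL.
have [cl0 cl] := Lfun_submod_closed mu p1e.
pose re i := (@complex.Re R \o (fun s => f s i 0)) \_ I01.
pose im i := (@complex.Im R \o (fun s => f s i 0)) \_ I01.
have mre i : measurable_fun setT (re i).
  by have /andP[/andP[/[!inE]]] := fL i.
have mim i : measurable_fun setT (im i).
  by have /andP[_ /andP[/[!inE]]] := fL i.
have -> : (vnorm \o f) \_ I01 =
    fun s => \sum_i Num.sqrt (re i s ^+ 2 + im i s ^+ 2).
  apply/funext => s; rewrite /patch/re/im /patch; case: ifP => _.
    by apply: eq_bigr => i _; rewrite normcE.
  by rewrite big1// => i _; rewrite pointE expr0n/= addr0 sqrtr0.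
apply: (Lfun_dom (h := fun s => \sum_i (`|re i s| + `|im i s|))).
- apply: measurable_sum => i.
  apply: (@measurableT_comp _ _ _ _ _ _ (@Num.sqrt R)).
    by apply: continuous_measurable_fun; exact: sqrt_continuous.
  by apply: measurable_funD; exact: measurable_funX.
- move=> s; rewrite ger0_norm ?sumr_ge0//.
  by apply: ler_sum => i _; rewrite -(normcE (Complex _ _)) normc_le.
- pose P := fun g : R -> R => g \in Lfun mu p%:E.
  have PD g h : P g -> P h -> P (fun s => g s + h s).
    by move=> Pg Ph; have := cl 1 _ _ Pg Ph; rewrite scale1r.
  rewrite (_ : (fun _ => _) = \sum_i (fun s => `|re i s| + `|im i s|)); last first.
    by apply/funext => s; rewrite fct_sumE.
  apply: (@big_ind _ P) => // i _.
  by apply: PD; apply: Lfun_abs; have /andP[] := fL i.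
Qed.


Let finnorm (f : LpFun) :
  (Lp_vec_norm p (val f))%:E = 'N[mu]_p%:E[EFin \o (vnorm \o val f) \_ I01]%E.
Proof.
have /andP[_ /[!inE] h] := vnorm_Lfun (valP f).
by rewrite /Lp_vec_norm fineK// ge0_fin_numE ?Lnorm_ge0.
Qed.

Let mvnorm (f : LpFun) :
  measurable_fun setT ((vnorm \o val f) \_ I01).
Proof. by have /andP[/[!inE]] := vnorm_Lfun (valP f). Qed.

Lemma Lp_vec_normD (f g : LpFun) :
  Lp_vec_norm p (val (f + g)) <= Lp_vec_norm p (val f) + Lp_vec_norm p (val g).
Proof.
rewrite -lee_fin EFinD !finnorm.
apply: le_trans (eminkowski mu (mvnorm f) (mvnorm g) p1e).
rewrite unlock /Lnorm.
have p0 : 0 < p by rewrite (lt_le_trans ltr01).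
apply: gt0_ler_poweR => //.
- by rewrite invr_ge0 ltW.
- by rewrite in_itv/= leey andbT integral_ge0// => x _; rewrite poweR_ge0.
- by rewrite in_itv/= leey andbT integral_ge0// => x _; rewrite poweR_ge0.
have pm (k : R -> R) : measurable_fun setT k ->
  measurable_fun setT (fun x : R => (`|k x| `^ p)%:E).
  move=> mk; apply/measurable_EFinP => /=.
  apply: (@measurableT_comp _ _ _ _ _ _ (@powR R ^~ p)) => //.
  exact: measurableT_comp.
apply: ge0_le_integral => //.
- by move=> x _; rewrite poweR_ge0.
- exact: (pm _ (mvnorm (f + g))).
- apply: (pm (_ \+ _)); apply: measurable_funD; exact: mvnorm.
move=> x _ /=; rewrite lee_fin ge0_ler_powR ?nnegrE// ?(ltW p0)//.
rewrite /patch; case: ifP => _ /=; last by rewrite pointE addr0.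
rewrite !ger0_norm ?addr_ge0 ?vnorm_ge0//.
exact: vnormD.
Qed.

Lemma Lp_vec_normZ (a : C) (f : LpFun) :
  Lp_vec_norm p (val (a *: f)) = Normc.normc a * Lp_vec_norm p (val f).
Proof.
apply: EFin_inj; rewrite EFinM !finnorm.
have := vnorm_Lfun (valP f) => hL.
have -> : (vnorm \o val (a *: f)) \_ I01 =
    Normc.normc a \*: ((vnorm \o val f) \_ I01) :> (R -> R).
  apply/funext => x; rewrite /patch/=; case: ifP => _.
    exact: vnormZ.
  by rewrite pointE scaler0.
have -> := LnormZ (@Lfun_Sub _ _ _ _ _ p1e _ hL) (Normc.normc a).
by rewrite ger0_norm// normcE sqrtr_ge0.
Qed.

Lemma Lp_vec_norm_eq0 (f : LpFun) :
  (f \in Lp_null) = (Lp_vec_norm p (val f) == 0).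
Proof.
have p0 : 0 < p by rewrite (lt_le_trans ltr01).
apply/asboolP/eqP => [f0|n0].
  apply: EFin_inj; rewrite finnorm unlock /Lnorm.
  rewrite (ae_eq_integral (cst 0%E))//.
  - by rewrite integral0 poweR0r// invr_neq0// gt_eqF.
  - apply/measurable_EFinP.
    apply: (@measurableT_comp _ _ _ _ _ _ (@powR R ^~ p)) => //.
    by apply: measurableT_comp => //; exact: mvnorm.
  apply: filterS f0 => x fx _ /=.
  rewrite /patch; case: ifPn => [/[!inE] xD|_]; last first.
    by rewrite pointE normr0 powR0// gt_eqF.
  rewrite /= fx// /vnorm big1 ?normr0 ?powR0 ?gt_eqF// => i _.
  by rewrite mxE Normc.normc0.
have mf : measurable_fun setT (EFin \o (vnorm \o val f) \_ I01).
  by apply/measurable_EFinP; exact: mvnorm.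
have nf : 'N[mu]_p%:E[EFin \o (vnorm \o val f) \_ I01]%E = 0%E.
  by rewrite -finnorm n0.
have p0e : (0 < p%:E)%E by rewrite lte_fin.
have f0 := @Lnorm_eq0_eq0 _ (measurableTypeR R) R mu _ _ mf p0e nf.
apply: filterS f0 => x fx xD.
have := fx Logic.I; rewrite /= /patch mem_set// => h.
exact/vnorm_eq0/EFin_inj.
Qed.

(* L^p([0,1], C^m): classes of p-integrable functions modulo equality almost
   everywhere on [0,1], with the norm (int_0^1 |f(s)|^p ds)^(1/p). *)
Definition Lp : Type := Quotient.quot Lp_null.

HB.instance Definition _ := Choice.on Lp.
HB.instance Definition _ := GRing.Zmodule.on Lp.
HB.instance Definition _ := EqQuotient.on Lp.

Let Lp_pi (f : LpFun) : Lp := \pi_Lp%qT f.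

Let Lp_piP (f g : LpFun) : Lp_pi f = Lp_pi g <-> f - g \in Lp_null.
Proof. by split=> [/eqmodP|h]; [|apply/eqmodP]. Qed.

Let Lp_piD (f g : LpFun) : Lp_pi (f + g) = Lp_pi f + Lp_pi g.
Proof. by rewrite /Lp_pi Quotient.pi_add. Qed.

Let Lp_piK (x : Lp) : Lp_pi (repr x) = x. Proof. exact: reprK. Qed.

Let Lp_nullZ (a : C) (f : LpFun) : f \in Lp_null -> a *: f \in Lp_null.
Proof. by rewrite !Lp_vec_norm_eq0 Lp_vec_normZ => /eqP ->; rewrite mulr0. Qed.

Definition Lp_scale (a : C) (x : Lp) : Lp := Lp_pi (a *: repr x).

Let Lp_scale_pi a (f : LpFun) : Lp_scale a (Lp_pi f) = Lp_pi (a *: f).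
Proof.
apply/Lp_piP; rewrite -scalerBr; apply: Lp_nullZ.
by apply/Lp_piP; rewrite Lp_piK.
Qed.

Let Lp_scalerA a b x : Lp_scale a (Lp_scale b x) = Lp_scale (a * b) x.
Proof. by rewrite -[x]Lp_piK !Lp_scale_pi scalerA. Qed.

Let Lp_scale1r : left_id 1 Lp_scale.
Proof. by move=> x; rewrite -[x]Lp_piK !Lp_scale_pi scale1r. Qed.

Let Lp_scalerDr : right_distributive Lp_scale +%R.
Proof.
move=> a x y; rewrite -[x]Lp_piK -[y]Lp_piK -Lp_piD !Lp_scale_pi -Lp_piD.
by rewrite scalerDr.
Qed.

Let Lp_scalerDl x : {morph Lp_scale^~ x : a b / a + b}.
Proof.
by move=> a b; rewrite /= -[x]Lp_piK !Lp_scale_pi -Lp_piD scalerDl.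
Qed.

HB.instance Definition _ := GRing.Zmodule_isLmodule.Build C Lp
  Lp_scalerA Lp_scale1r Lp_scalerDr Lp_scalerDl.

(* The norm of a normed module over C takes its values in C. *)
Definition Lp_norm (x : Lp) : C := (Lp_vec_norm p (val (repr x)))%:C%C.

Let Lp_norm_pi (f : LpFun) : Lp_norm (Lp_pi f) = (Lp_vec_norm p (val f))%:C%C.
Proof.
have le f1 g1 : f1 - g1 \in Lp_null ->
    Lp_vec_norm p (val f1) <= Lp_vec_norm p (val g1).
  rewrite Lp_vec_norm_eq0 => /eqP fg; have := Lp_vec_normD (f1 - g1) g1.
  by rewrite fg add0r subrK.
rewrite /Lp_norm; congr (_%:C%C); apply: le_anti; rewrite !le//.
  by apply/Lp_piP; rewrite Lp_piK.
by apply/Lp_piP; rewrite Lp_piK.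
Qed.

Let Lp_ler_normD x y : Lp_norm (x + y) <= Lp_norm x + Lp_norm y.
Proof.
rewrite -[x]Lp_piK -[y]Lp_piK -Lp_piD !Lp_norm_pi -rmorphD lecR.
exact: Lp_vec_normD.
Qed.

Let Lp_normrZ a x : Lp_norm (a *: x) = `|a| * Lp_norm x.
Proof.
rewrite -[x]Lp_piK [_ *: _]Lp_scale_pi !Lp_norm_pi Lp_vec_normZ rmorphM.
by case: a.
Qed.

Let Lp_normr0_eq0 x : Lp_norm x = 0 -> x = 0.
Proof.
rewrite -[x]Lp_piK Lp_norm_pi => /eqP; rewrite fmorph_eq0 -Lp_vec_norm_eq0.
have -> : (0 : Lp) = Lp_pi 0 by apply: (@addrI _ (Lp_pi 0)); rewrite -Lp_piD !addr0.
by move=> h; apply/Lp_piP; rewrite subr0.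
Qed.

HB.instance Definition _ := Lmodule_isNormed.Build C Lp
  Lp_ler_normD Lp_normrZ Lp_normr0_eq0.

End Lp_theory.

Arguments Lp {R p} p1 m.
Definition Lp_fun (R : realType) (p : R) (p1 : 1 <= p) (m : nat)
  (f : Lp p1 m) : R -> 'cV[R[i]]_m := val (repr f).

Section sobolev.
Context (R : realType).
Local Notation C := R[i].
Local Notation mu := (@lebesgue_measure R).
Local Notation I01 := (`[0%R, 1%R]%classic : set R).

(* C^1 functions with compact support in ]0,1[ *)
Definition test_function (phi : R -> R) : Prop :=
  [/\ forall s, derivable phi s 1,
      continuous (derive1 phi) &
      exists a b, [/\ 0 < a, b < 1 & forall s, s \notin `[a, b] -> phi s = 0]].

Definition is_weak_derivative (u v : R -> R) : Prop :=
  forall phi, test_function phi ->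
    \int[mu]_(s in I01) (u s * derive1 phi s) =
      - \int[mu]_(s in I01) (v s * phi s).

Definition is_weak_cderivative (u v : R -> C) : Prop :=
  is_weak_derivative (@complex.Re R \o u) (@complex.Re R \o v) /\
  is_weak_derivative (@complex.Im R \o u) (@complex.Im R \o v).

(* W^{k,p}[0,1], with W^{0,p} = L^p *)
Fixpoint sobolev (p : R) (k : nat) (u : R -> C) : Prop :=
  match k with
  | 0 => in_Lp p I01 u
  | k'.+1 => in_Lp p I01 u /\
             exists2 v, is_weak_cderivative u v & sobolev p k' v
  end.

Context (p : R) (p1 : 1 <= p) (m : nat).
Implicit Types f g : Lp p1 m.

Definition represents (phi : R -> 'cV[C]_m) f : Prop :=
  ae_eq mu I01 (Lp_fun f) phi.

Definition is_Lp_derivative f g : Prop :=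
  forall i, is_weak_cderivative (fun s => Lp_fun f s i 0)
                                (fun s => Lp_fun g s i 0).

Definition W1p : set (Lp p1 m) := [set f | exists g, is_Lp_derivative f g].

Definition Lp_derivative f : Lp p1 m := xget 0 (is_Lp_derivative f).

Definition continuous01 (phi : R -> 'cV[C]_m) : Prop :=
  forall j, {within I01, continuous (fun s => complex.Re (phi s j 0))} /\
            {within I01, continuous (fun s => complex.Im (phi s j 0))}.

(* The continuous representative of f in W^{1,p}, which gives a meaning to
   f(0) and f(1). Its values outside of [0,1] are arbitrary. *)
Definition continuous_repr f : R -> 'cV[C]_m :=
  xget (fun=> 0) [set phi | continuous01 phi /\ represents phi f].

End sobolev.

Section operators.
Context (R : realType) (X : normedModType R[i]).
Local Notation C := R[i].
Local Notation mu := (@lebesgue_measure R).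

Record operator := Operator {
  domain : set X;
  (* only meaningful on the domain *)
  op :> X -> X }.

Definition resolvent_set (A : operator) : set C :=
  [set lam | set_bij (domain A) setT (fun x => lam *: x - A x) /\
             exists M : R, forall x, domain A x ->
               `|x| <= M%:C%C * `|lam *: x - A x| ].

(* Only the values T t with 0 <= t are relevant. *)
Record C0_semigroup (T : R -> X -> X) : Prop := {
  C0_linear : forall t, 0 <= t -> linear (T t);
  C0_bounded : forall t, 0 <= t ->
    exists M : R, forall x, `|T t x| <= M%:C%C * `|x|;
  C0_0 : forall x, T 0 x = x;
  C0_D : forall s t x, 0 <= s -> 0 <= t -> T (s + t) x = T s (T t x);
  C0_continuous : forall x, {within `[0, +oo[, continuous (fun t => T t x)} }.

Definition generates (A : operator) (T : R -> X -> X) : Prop :=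
  C0_semigroup T /\
  forall x y, (domain A x /\ A x = y) <->
    (h^-1)%:C%C *: (T h x - x) @[h --> (0 : R)^'+] --> y.

Record simple := Simple {
  simple_size : nat;
  simple_set : 'I_simple_size -> set R;
  simple_measurable : forall j, measurable (simple_set j);
  simple_value : 'I_simple_size -> X }.

Definition simple_eval (S : simple) (r : R) : X :=
  \sum_(j < simple_size S) (\1_(simple_set j) r : C) *: simple_value j.

Definition simple_integral (D : set R) (S : simple) : X :=
  \sum_(j < simple_size S) (fine (mu (simple_set j `&` D)))%:C%C *: simple_value j.

(* F is Bochner integrable on D, with integral z. The set D is supposed to be
   measurable and of finite measure. *)
Definition is_bochner_integral (D : set R) (F : R -> X) (z : X) : Prop :=
  exists S : nat -> simple,
    [/\ {ae mu, forall r, D r -> simple_eval (S k) r @[k --> \oo] --> F r},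
        (\int[mu]_(r in D) (complex.Re `|F r - simple_eval (S k) r|)%:E)%E
          @[k --> \oo] --> 0%E &
        simple_integral D (S k) @[k --> \oo] --> z].

End operators.

Record network (R : realType) (n m : nat) := Network {
  edge_start : 'I_m -> 'I_n;
  edge_end : 'I_m -> 'I_n;
  weight : 'I_m -> 'I_n -> R;
  in_weight : 'I_n -> 'I_m -> R;
  weight_itv : forall i j, edge_start i = j -> 0 <= weight i j <= 1;
  in_weight_itv : forall i j, edge_end j = i -> 0 <= in_weight i j <= 1 }.

Section network_control.
Context (R : realType) (n m : nat) (N : network R n m).
Local Notation C := R[i].

Definition Psi : 'M[C]_(m, n) :=
  \matrix_(i, j) if edge_start N i == j then (weight N i j)%:C%C else 0.

Definition Phi_minus : 'M[C]_(n, m) :=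
  \matrix_(i, j) if edge_start N j == i then 1 else 0.

Definition Phi_plus : 'M[C]_(n, m) :=
  \matrix_(i, j) if edge_end N j == i then (in_weight N i j)%:C%C else 0.

Definition column_stochastic : Prop := forall j, \sum_i Psi i j = 1.

Definition adjA : 'M[C]_n := Phi_plus *m Psi.
Definition adjB : 'M[C]_m := Psi *m Phi_plus.

Definition vertex (i : 'I_n) : 'cV[C]_n := delta_mx i 0.

Context (p : R) (p1 : 1 <= p).

Definition state : normedModType C := (Lp p1 m * 'cV[C]_n)%type.
Implicit Types x y z : state.

Definition Am : operator state := {|
  domain := [set x | W1p x.1 /\
                     exists c, continuous_repr x.1 1 = Psi *m c];
  op := fun x => (Lp_derivative x.1, Phi_plus *m continuous_repr x.1 0) |}.

Definition Q x : 'cV[C]_n := Phi_minus *m continuous_repr x.1 1 - x.2.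

Definition A0 : operator state := {|
  domain := [set x | domain Am x /\ Q x = 0];
  op := Am |}.

(* the inverse of the restriction of Q to ker(lam - Am) *)
Definition Q_inv (lam : C) (b : 'cV[C]_n) : state :=
  xget 0 [set x | [/\ domain Am x, lam *: x - Am x = 0 & Q x = b]].

Context (i : 'I_n).

Definition B_ctrl (c : C) : 'cV[C]_n := c *: vertex i.

Definition B_lam (lam : C) (c : C) : state := Q_inv lam (B_ctrl c).

(* graph of the controllability map at time t; membership of the integral z in
   D(A) is the p-boundary admissibility of the control operator *)
Definition controllability_map (T : R -> state -> state) (lam : C) (t : R)
    (u : R -> C) (y : state) : Prop :=
  exists z, [/\ is_bochner_integral `[0, t]
                  (fun s => T (t - s) (B_lam lam (u s))) z,
                domain A0 z &
                y = lam *: z - A0 z].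

Definition exact_reachability (T : R -> state -> state) (lam : C) (t : R) :
    set state :=
  [set y | exists2 u, in_Lp p `[0, t] u & controllability_map T lam t u y].

End network_control.

(* Main.v *)
Require Import Defs.
From mathcomp Require Import all_boot all_order all_algebra.
From mathcomp Require Import all_classical all_reals all_analysis.
From mathcomp Require Import measurable_realfun complex.
From mathcomp Require Import ring lra.

Set Implicit Arguments.
Unset Strict Implicit.
Unset Printing Implicit Defensive.

Import Order.TTheory GRing.Theory Num.Theory.
Import numFieldNormedType.Exports.

Local Open Scope classical_set_scope.
Local Open Scope ring_scope.

(** Transport along the edges takes one unit of time, and crossing a vertex
    integrates, because the boundary condition acts through the vertex state [d]
    with [d' = Phi_w^+ f(0)]. So a control [u] acting up to time [t] in the vertex [v]
    produces, on the edges, the function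
    [y_1(s) = sum_(j < J) u_j(s) B^j Psi v], where [u_j] is the [j]-fold primitive
    of [u] (extended by 0 to negative times) delayed to [s + t - 1 - j], and
    [J >= t + 1]. This is [reachable_representation]. As [u_j] is in
    [W^{j,p}], and the powers [B^j] with [j > l] are combinations of
    lower ones by the Cayley-Hamilton theorem applied to [A] or [B], whichever
    is smaller ([adjB_power_coefficients]), the inclusion follows. The equality of
    the two sets is [Psi A^k = B^k Psi] ([Psi_adjA]).

    The formula for [y_1] is obtained by duality, with no explicit description of
    the semigroup or of the resolvent. Fix a test function [xi] and let
    [h_0 = xi], [h_(j+1)' = - h_j(. + 1)], each [h_j] vanishing far to the right
    ([test_family]). The functionals
    [E_r(x; h) = sum_j B^j (x_1, h_j(. - r)) + sum_j h_(j+1)(- r) B^j Psi x_2]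
    ([adjoint_orbit]) satisfy Green's identity [adjoint_orbit_Am]: the sum
    [E_r(A_m x; h) + E_r(x; h')] is a boundary term, which is 0 for [x] in [ker Q].
    Hence [s |-> E_(r-s)(T(s) x; h)] is constant for [x] in [D(A)], and
    [(T(r) x, xi) = E_r(x; h)] ([orbit_adjoint]). For a vector [b] in
    [ker (lam - A_m)] with [Q b = c v], the same identity leaves exactly the boundary
    term, and [lam (T(r) b, xi) + (T(r) b, xi')] equals
    [sum_j h_j(1 - r) c B^j Psi v] ([orbit_kernel_pairing]).

    The state reached by [u] is [y = (lam - A) z] with [z] the Bochner integral of
    [T(t - s) B_lam u(s)], and bounded functionals commute with Bochner integrals
    ([functional_bochner]). So the pairing of [y_1] with [xi] is
    [sum_j (int_0^t h_j(1 - t + s) u(s) ds) B^j Psi v]. Integrating by parts [j] times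
    moves the primitives from [h_j] to [u] ([iterated_parts], [iterated_shift]) and
    gives the pairing of [xi] with the announced sum; enough test functions
    separate functions up to null sets ([represents_of_tests]). *)

(** * Integration by parts on the line *)

Section RealAnalysis.
Context (R : realType).
Local Notation mu := (@lebesgue_measure R).
Implicit Types (f g h : R -> R) (a b : R).

Definition C1_deriv h h' := (forall x : R, is_derive x (1 : R) h (h' x)) /\ continuous h'.

Lemma is_derive_continuous h h' : (forall x : R, is_derive x (1 : R) h (h' x)) -> continuous h.
Proof.
move=> dh x; apply: differentiable_continuous.
by apply/derivable1_diffP; have [] := dh x.
Qed.

Lemma C1_continuous h h' : C1_deriv h h' -> continuous h.
Proof. by move=> [dh _]; exact: is_derive_continuous dh. Qed.

Lemma continuous_bounded_itv a b h : continuous h ->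
  exists2 M : R, 0 < M & forall x, a <= x <= b -> `|h x| <= M.
Proof.
move=> ch.
have : compact (h @` `[a, b]).
  by apply: continuous_compact; [exact: continuous_subspaceT|exact: segment_compact].
move=> /compact_bounded[M [_ hM]].
exists (`|M| + 1); first by rewrite ltr_wpDl.
move=> x xab; apply: hM; last by exists x; rewrite //= in_itv.
by rewrite (le_lt_trans (ler_norm _))// ltrDl.
Qed.

Lemma integrable_mulc a b f h : mu.-integrable `[a, b] (EFin \o f) ->
  continuous h -> mu.-integrable `[a, b] (EFin \o (fun x => f x * h x)).
Proof.
move=> fi ch.
have -> : EFin \o (fun x => f x * h x) = ((EFin \o f) \* (EFin \o h))%E.
  by apply/funext => x /=; rewrite EFinM.
apply: integrableMl => //.
  by apply: measurable_funTS; exact: continuous_measurable_fun.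
have [M M0 hM] := continuous_bounded_itv a b ch.
exists M; split; first exact: gtr0_real.
by move=> y My x /=; rewrite in_itv/= => xab; rewrite (le_trans (hM _ xab))// ltW.
Qed.

Lemma continuous_integrable_itv a b h : continuous h ->
  mu.-integrable `[a, b] (EFin \o h).
Proof.
move=> ch; apply: continuous_compact_integrable; first exact: segment_compact.
exact: continuous_subspaceT.
Qed.

Lemma FTC2_C1 h h' a b : C1_deriv h h' -> a <= b ->
  \int[mu]_(x in `[a, b]) h' x = h b - h a.
Proof.
move=> C1h; rewrite le_eqVlt => /predU1P[<-|ab].
  by rewrite set_itv1 Rintegral_set1 subrr.
rewrite /Rintegral (@continuous_FTC2 _ h' h a b)//.
- by apply: continuous_subspaceT; exact: C1h.2.
- have ch := C1_continuous C1h; split.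
  + by move=> x _; have [] := C1h.1 x.
  + by apply: cvg_at_right_filter; exact: ch.
  + by apply: cvg_at_left_filter; exact: ch.
- by move=> x _; rewrite derive1E; exact: (@derive_val _ _ _ _ _ _ _ (C1h.1 x)).
Qed.

Lemma integrable_addr (D : set R) f g : measurable D ->
  mu.-integrable D (EFin \o f) -> mu.-integrable D (EFin \o g) ->
  mu.-integrable D (EFin \o (fun x => f x + g x)).
Proof.
move=> mD fi gi; have -> : EFin \o (fun x => f x + g x) = ((EFin \o f) \+ (EFin \o g))%E by [].
exact: integrableD.
Qed.

Lemma integrable_subr (D : set R) f g : measurable D ->
  mu.-integrable D (EFin \o f) -> mu.-integrable D (EFin \o g) ->
  mu.-integrable D (EFin \o (fun x => f x - g x)).
Proof.
move=> mD fi gi; have -> : EFin \o (fun x => f x - g x) = ((EFin \o f) \- (EFin \o g))%E by [].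
exact: integrableB.
Qed.

Lemma integrable_scaler (D : set R) (c : R) f : measurable D ->
  mu.-integrable D (EFin \o f) -> mu.-integrable D (EFin \o (fun x => c * f x)).
Proof.
move=> mD fi; have -> : EFin \o (fun x => c * f x) = (fun x => c%:E * (EFin \o f) x)%E by [].
exact: integrableZl.
Qed.

Lemma EFin_Rintegral (D : set R) f : measurable D -> mu.-integrable D (EFin \o f) ->
  (\int[mu]_(x in D) (f x)%:E)%E = (\int[mu]_(x in D) f x)%:E.
Proof. by move=> mD fi; rewrite /Rintegral fineK//; exact: integrable_fin_num. Qed.

Lemma integrableS_itv a b c d f : a <= c -> d <= b ->
  mu.-integrable `[a, b] (EFin \o f) -> mu.-integrable `[c, d] (EFin \o f).
Proof.
by move=> ac db; apply: integrableS => //; apply: subset_itvScc; rewrite ?bnd_simp.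
Qed.

Lemma mem_itvcc a b x : (x \in `[a, b]%classic) = (a <= x <= b).
Proof. by apply/idP/idP; rewrite inE/= in_itv. Qed.

Lemma integrable_patch (D : set R) f : measurable D ->
  mu.-integrable D (EFin \o f) -> mu.-integrable setT (EFin \o f \_ D).
Proof. by move=> mD; rewrite integrable_mkcond//= restrict_EFin. Qed.

(** [f] is only integrable, so its primitive need not be differentiable and
    the product rule does not apply; the identity is Fubini's theorem on the
    triangle [a <= x <= y <= b]. *)
Lemma Rintegral_parts f h h' a b : a <= b ->
  mu.-integrable `[a, b] (EFin \o f) -> C1_deriv h h' ->
  \int[mu]_(x in `[a, b]) (f x * h x) =
  h b * \int[mu]_(x in `[a, b]) f x -
  \int[mu]_(y in `[a, b]) (h' y * \int[mu]_(x in `[a, y]) f x).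
Proof.
move=> ab fi C1h; have [dh ch'] := C1h; have ch := C1_continuous C1h.
pose F := f \_ `[a, b]; pose H := h' \_ `[a, b].
pose G (z : R * R) := if z.1 <= z.2 then F z.1 * H z.2 else 0.
have hi : mu.-integrable `[a, b] (EFin \o h') by exact: continuous_integrable_itv.
have Fi : mu.-integrable setT (EFin \o F).
  exact: integrable_patch.
have Hi : mu.-integrable setT (EFin \o H).
  exact: integrable_patch.
have mF : measurable_fun setT F by case/integrableP : Fi => /measurable_EFinP.
have mH : measurable_fun setT H by case/integrableP : Hi => /measurable_EFinP.
have mG : measurable_fun setT G.
  apply: measurable_fun_ifT => //; first exact: measurable_fun_ler.
  by apply: measurable_funM; apply: measurableT_comp.
(* [|G|] is dominated by the product of [|F|] and [|H|]. *)
have Gi : (mu \x mu)%E.-integrable setT (EFin \o G).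
  apply/integrable12ltyP; first exact/measurable_EFinP.
  have Hfin : (\int[mu]_y `|(H y)%:E| < +oo)%E by case/integrableP : Hi.
  have Ffin : (\int[mu]_x `|(F x)%:E| < +oo)%E by case/integrableP : Fi.
  apply: (@le_lt_trans _ _ (\int[mu]_x (`|(F x)%:E| * \int[mu]_y `|(H y)%:E|))%E).
    apply: ge0_le_integral => //.
    - by move=> x _; exact: integral_ge0.
    - apply: (@measurable_fun_fubini_tonelli_F _ _ _ _ _ mu (fun z => `|(EFin \o G) z|%E)).
        by apply: measurableT_comp => //; exact/measurable_EFinP.
      by move=> x; exact: abse_ge0.
    - by apply: emeasurable_funM => //; apply: measurableT_comp => //; exact/measurable_EFinP.
    - move=> x _; rewrite -ge0_integralZl//; last first.
        by apply: measurableT_comp => //; exact/measurable_EFinP.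
      apply: ge0_le_integral => //.
      + apply: measurableT_comp => //; apply/measurable_EFinP.
        by apply: (@measurableT_comp _ _ _ _ _ _ G) => //; exact: measurable_pair1.
      + apply: emeasurable_funM => //; apply: measurableT_comp => //; exact/measurable_EFinP.
      + move=> y _; rewrite /G /=; case: ifP => _; first by rewrite normrM EFinM.
        by rewrite normr0 mule_ge0.
  rewrite ge0_integralZr//; last 2 first.
    by apply: measurableT_comp => //; exact/measurable_EFinP.
    exact: integral_ge0.
  rewrite lte_mul_pinfty//.
    exact: integral_ge0.
  by rewrite ge0_fin_numE//; exact: integral_ge0.
have := Fubini Gi.
have -> : (\int[mu]_x \int[mu]_y (EFin \o G) (x, y))%E =
    (\int[mu]_(x in `[a, b]) (f x * (h b - h x))%:E)%E.
  rewrite [RHS]integral_mkcond; apply: eq_integral => x _.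
  rewrite patchE; case: ifPn => [|xab]; last first.
    by apply: integral0_eq => y _; rewrite /G /F/= patchE (negbTE xab) mul0r if_same.
  rewrite mem_itvcc => /andP[ax xb].
  transitivity (\int[mu]_(y in `[x, b]) (f x * h' y)%:E)%E.
    rewrite [RHS]integral_mkcond; apply: eq_integral => y _.
    rewrite patchE /G /F /H/= !patchE !mem_itvcc ax xb/=.
    have [xy|//] := leP x y; rewrite (le_trans ax xy)/=.
    by case: ifP; rewrite ?mulr0.
  rewrite EFin_Rintegral//; last first.
    have -> : EFin \o (fun y => f x * h' y) = (fun y => (f x)%:E * (EFin \o h') y)%E.
      by apply/funext => y /=; rewrite EFinM.
    by apply: integrableZl => //; exact: continuous_integrable_itv.
  rewrite RintegralZl//; last exact: continuous_integrable_itv.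
  by rewrite (FTC2_C1 C1h).
have -> : (\int[mu]_y \int[mu]_x (EFin \o G) (x, y))%E =
    (\int[mu]_(y in `[a, b]) (h' y * \int[mu]_(x in `[a, y]) f x)%:E)%E.
  rewrite [RHS]integral_mkcond; apply: eq_integral => y _.
  rewrite patchE; case: ifPn => [|yab]; last first.
    by apply: integral0_eq => x _; rewrite /G /H/= patchE (negbTE yab) mulr0 if_same.
  rewrite mem_itvcc => /andP[ay yb].
  have fiy : mu.-integrable `[a, y] (EFin \o f) by exact: integrableS_itv fi.
  transitivity (\int[mu]_(x in `[a, y]) (h' y * f x)%:E)%E.
    rewrite [RHS]integral_mkcond; apply: eq_integral => x _.
    rewrite patchE /G /F /H/= !patchE !mem_itvcc ay yb/=.
    have [xy|yx] := leP x y; last by rewrite andbF.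
    by rewrite (le_trans xy yb) andbT; case: ifP; rewrite ?mul0r// mulrC.
  rewrite EFin_Rintegral//; last first.
    have -> : EFin \o (fun x => h' y * f x) = (fun x => (h' y)%:E * (EFin \o f) x)%E.
      by apply/funext => x /=; rewrite EFinM.
    exact: integrableZl.
  by rewrite RintegralZl.
move=> /(congr1 fine); rewrite -/(Rintegral _ _ _) -/(Rintegral _ _ _) => <-.
under [X in _ - X]eq_Rintegral do rewrite mulrBr.
rewrite RintegralB//; last 2 first.
  exact: (integrable_mulc (h := cst (h b))) (@cst_continuous _ _ _).
  exact: integrable_mulc.
by rewrite RintegralZr// [X in X - _]mulrC opprB addrC subrK.
Qed.
End RealAnalysis.

(** * Smooth cutoff functions *)

Section Smooth.
Context (R : realType).
Implicit Types (f g h : R -> R) (n : nat).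

(** The derivatives are carried along existentially, so that closure
    properties are plain inductions on [n]. *)
Fixpoint Cn n f : Prop :=
  match n with
  | 0 => continuous f
  | n'.+1 => exists2 f', (forall x : R, is_derive x (1 : R) f (f' x)) & Cn n' f'
  end.

Lemma Cn_continuous n f : Cn n f -> continuous f.
Proof. by case: n => [//|n [f' /is_derive_continuous]]. Qed.

Lemma CnW n f : Cn n.+1 f -> Cn n f.
Proof.
elim: n f => [f /Cn_continuous//|n IH f [f' df /IH]].
by exists f'.
Qed.

Lemma Cn_cst n (c : R) : Cn n (fun=> c).
Proof.
elim: n c => [c|n IH c]; first exact: cst_continuous.
by exists (fun=> 0); [move=> x; exact: is_derive_cst|].
Qed.

Lemma Cn_id n : Cn n (@id R).
Proof.
case: n => [|n]; first by move=> x; exact: cvg_id.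
by exists (fun=> 1); [move=> x; exact: is_derive_id|exact: Cn_cst].
Qed.

Lemma CnD n f g : Cn n f -> Cn n g -> Cn n (fun x => f x + g x).
Proof.
elim: n f g => [f g cf cg x|n IH f g [f' df Cf] [g' dg Cg]].
  by apply: cvgD; [exact: cf|exact: cg].
exists (fun x => f' x + g' x); last exact: IH.
by move=> x; exact: is_deriveD.
Qed.

Lemma CnM n f g : Cn n f -> Cn n g -> Cn n (fun x => f x * g x).
Proof.
elim: n f g => [f g cf cg x|n IH f g Cf Cg].
  by apply: cvgM; [exact: cf|exact: cg].
have [Cf0 Cg0] := (CnW Cf, CnW Cg).
case: Cf Cg => [f' df Cf] [g' dg Cg].
exists (fun x => f x * g' x + g x * f' x); first by move=> x; exact: is_deriveM.
by apply: CnD; exact: IH.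
Qed.

Lemma CnX n k f : Cn n f -> Cn n (fun x => f x ^+ k).
Proof.
move=> Cf; elim: k => [|k IH]; first by under eq_fun do rewrite expr0; exact: Cn_cst.
by under eq_fun do rewrite exprS; exact: CnM.
Qed.

Lemma Cn_comp n f g : Cn n f -> Cn n g -> Cn n (fun x => f (g x)).
Proof.
elim: n f g => [f g cf cg x|n IH f g [f' df Cf] Cg].
  by apply: continuous_comp; [exact: cg|exact: cf].
have Cg0 := CnW Cg; case: Cg => g' dg Cg.
exists (fun x => f' (g x) * g' x); first by move=> x; exact: is_derive1_comp.
by apply: CnM => //; exact: IH.
Qed.

(** Covers the kink of [y * |y|] at 0, where no algebraic rule for derivatives
    applies. *)
Lemma is_derive_quadratic f (x d : R) :
  (forall h : R, `|f (h + x) - f x - h * d| <= h ^+ 2) -> is_derive x (1 : R) f d.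
Proof.
move=> fq.
have cv : h^-1 *: (f (h + x) - f x) @[h --> (0 : R)^'] --> d.
  apply/cvgrPdist_le => e e0; near=> h.
  have h0 : h != 0 by near: h; exact: nbhs_dnbhs_neq.
  rewrite distrC -[X in _ - X](mulKf h0) -mulrBr normrM normfV.
  rewrite ler_pdivrMl ?normr_gt0// (le_trans (fq h))// -real_normK ?num_real//.
  rewrite expr2 ler_wpM2l//.
  by near: h; apply: dnbhs0_le.
have cv' : h^-1 *: ((f \o shift x) (h *: 1) - f x) @[h --> (0 : R)^'] --> d.
  have -> : (fun h : R => h^-1 *: ((f \o shift x) (h *: 1) - f x)) =
      (fun h : R => h^-1 *: (f (h + x) - f x)).
    by apply/funext => h; rewrite /= [h *: 1]mulr1.
  exact: cv.
by apply: DeriveDef; [apply/cvg_ex; exists d|exact/cvg_lim].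
Unshelve. all: by end_near. Qed.

Lemma is_derive_mulnorm (x : R) : is_derive x (1 : R) (fun y : R => y * `|y|) (2 * `|x|).
Proof.
apply: is_derive_quadratic => h; rewrite ler_norml.
case: (ler0P (h + x)) => hx; case: (ler0P x) => x0; apply/andP; split; nra.
Qed.

Lemma Cn_mulnorm n : Cn n (fun y : R => y ^+ n * `|y|).
Proof.
elim: n => [|n IH].
  by under eq_fun do rewrite expr0 mul1r; exact: norm_continuous.
exists (fun y => n.+2%:R * (y ^+ n * `|y|)); last by apply: CnM => //; exact: Cn_cst.
move=> x; have dX : is_derive x (1 : R) (fun y : R => y ^+ n) (n%:R * x ^+ n.-1).
  have := @is_deriveX _ _ id n x 1 1 (is_derive_id _ _).
  have -> : (id ^+ n : R -> R) = (fun y => y ^+ n) by apply/funext => y; rewrite exprfctE.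
  by move=> D; apply: (is_derive_eq D); rewrite /GRing.scale/= mulr1.
have := is_deriveM dX (is_derive_mulnorm x).
have -> : (fun y : R => y ^+ n.+1 * `|y|) = (fun y : R => y ^+ n) * (fun y : R => y * `|y|).
  by apply/funext => y; rewrite [RHS]mulrA exprSr.
move=> D; apply: (is_derive_eq D); rewrite /GRing.scale/=.
case: n {IH dX D} => [|n] /=; first by rewrite !expr0 mul0r mulr0 !mul1r addr0.
rewrite exprS; ring.
Qed.

(** With [y = (x - a) * (b - x)], this is [y ^ (n + 1)] where [y] is positive
    and 0 elsewhere: it vanishes to order [n + 1] at both ends of [[a, b]],
    hence is of class C^n, and it is at most 1 when [[a, b]] lies in [[0, 1]]. *)
Definition poly_bump n (a b x : R) : R :=
  let y := (x - a) * (b - x) in y ^+ n * (y + `|y|) / 2.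

Lemma Cn_poly_bump n a b : Cn n (poly_bump n a b).
Proof.
have Cy : Cn n (fun x => (x - a) * (b - x)).
  apply: CnM; first by apply: CnD; [exact: Cn_id|exact: Cn_cst].
  apply: CnD; first exact: Cn_cst.
  have -> : -%R = (fun x : R => -1 * x) by apply/funext => x; rewrite mulN1r.
  by apply: CnM; [exact: Cn_cst|exact: Cn_id].
apply: CnM; last exact: Cn_cst.
have -> : (fun x => ((x - a) * (b - x)) ^+ n * ((x - a) * (b - x) + `|(x - a) * (b - x)|)) =
  (fun x => ((x - a) * (b - x)) ^+ n * ((x - a) * (b - x)) + ((x - a) * (b - x)) ^+ n * `|(x - a) * (b - x)|).
  by apply/funext => x; rewrite mulrDr.
apply: CnD; first by apply: CnM => //; exact: CnX.
exact: (Cn_comp (Cn_mulnorm n)).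
Qed.

Lemma poly_bump_out n a b x : a <= b -> ~~ (a < x < b) -> poly_bump n a b x = 0.
Proof.
move=> ab; rewrite negb_and -!leNgt => xab; rewrite /poly_bump ler0_norm; last first.
  by case/orP: xab => ?; nra.
by rewrite subrr mulr0 mul0r.
Qed.

Lemma poly_bump_in n a b x : 0 <= a -> b <= 1 -> a < x < b -> 0 < poly_bump n a b x <= 1.
Proof.
move=> a0 b1 /andP[ax xb]; rewrite /poly_bump.
set y := (x - a) * (b - x).
have y0 : 0 < y by rewrite mulr_gt0// subr_gt0.
have y1 : y <= 1 by rewrite /y; nra.
rewrite gtr0_norm// -mulr2n -[y *+ 2]mulr_natr mulrA mulfK ?pnatr_eq0//.
rewrite -exprSr exprn_gt0//=; apply: exprn_ile1 => //; exact: ltW.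
Qed.

(** For [[a, b]] inside [[0, 1]] the bump is in [`]0, 1]] on [`]a, b[], so [(1 - bump) ^ k] tends
    to 0 as [k] grows: these C^n functions converge to the indicator function of
    the open interval. This avoids convolutions with mollifiers. *)
Definition cutoff n a b k x : R := 1 - (1 - poly_bump n a b x) ^+ k.

Lemma Cn_cutoff n a b k : Cn n (cutoff n a b k).
Proof.
have CB f : Cn n f -> Cn n (fun x => 1 - f x).
  move=> Cf; apply: CnD; first exact: Cn_cst.
  have -> : (fun x => - f x) = (fun x : R => -1 * f x) by apply/funext => x; rewrite mulN1r.
  by apply: CnM => //; exact: Cn_cst.
by apply: (CB); apply: CnX; apply: (CB); exact: Cn_poly_bump.
Qed.

Lemma cutoff_out n a b k x : a <= b -> ~~ (a < x < b) -> cutoff n a b k x = 0.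
Proof. by move=> ab xab; rewrite /cutoff poly_bump_out// subr0 expr1n subrr. Qed.

Lemma cutoff_le1 n a b k x : 0 <= a -> a <= b -> b <= 1 -> `|cutoff n a b k x| <= 1.
Proof.
move=> a0 ab b1; have [xab|xab] := boolP (a < x < b); last first.
  by rewrite cutoff_out// normr0.
have /andP[B0 B1] := poly_bump_in n a0 b1 xab.
have C0 : 0 <= (1 - poly_bump n a b x) ^+ k by rewrite exprn_ge0// subr_ge0.
have C1 : (1 - poly_bump n a b x) ^+ k <= 1.
  by apply: exprn_ile1; rewrite ?subr_ge0// gerBl ltW.
by rewrite ger0_norm /cutoff ?subr_ge0// gerBl.
Qed.

Lemma cvg_cutoff n a b x : 0 <= a -> b <= 1 -> a < x < b ->
  cutoff n a b k x @[k --> \oo] --> (1 : R).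
Proof.
move=> a0 b1 xab; have /andP[B0 B1] := poly_bump_in n a0 b1 xab.
rewrite -[X in _ --> X]subr0; apply: cvgB; first exact: cvg_cst.
by apply: cvg_expr; rewrite ger0_norm ?subr_ge0// gtrBl.
Qed.

End Smooth.

(** * The fundamental lemma of the calculus of variations *)

Section Fundamental.
Context (R : realType).
Local Notation mu := (@lebesgue_measure R).
Local Notation I01 := (`[0%R, 1%R]%classic : set R).
Implicit Types (f g h : R -> R) (a b : R).

(** The primitive of [f] is constant on [`]0, 1[], and by Lebesgue's
    differentiation theorem its derivative is [f] almost everywhere. *)
Lemma ae_eq0_of_integrals f : mu.-integrable I01 (EFin \o f) ->
  (forall a b, 0 < a -> a < b -> b < 1 -> \int[mu]_(x in `[a, b]) f x = 0) ->
  ae_eq mu I01 f (cst 0).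
Proof.
move=> fi f0; pose g := f \_ I01.
have gi : mu.-integrable setT (EFin \o g) by exact: integrable_patch.
have giS (D : set R) : measurable D -> mu.-integrable D (EFin \o g).
  by move=> mD; apply: integrableS gi.
have gl : locally_integrable setT g by exact: integrable_locally.
have := FTC1Ny (fun y => giS _ (measurable_itv `]-oo, y])) gl.
set F := (fun x => _) => Fae.
have Fcst x y : 0 < x -> x <= y -> y < 1 -> F y = F x.
  move=> x0; rewrite le_eqVlt => /predU1P[-> //|xy] y1; apply/eqP; rewrite -subr_eq0; apply/eqP.
  rewrite /F Rintegral_itvB; [|exact: giS|by []|by rewrite bnd_simp ltW].
  rewrite Rintegral_itv_obnd_cbnd; last exact: giS.
  rewrite -[RHS](f0 _ _ x0 xy y1); apply: eq_Rintegral => z.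
  rewrite mem_itvcc => /andP[xz zy]; rewrite /g patchE mem_itvcc.
  by rewrite (le_trans (ltW x0))//= (le_trans zy)// ltW.
have neq (c : R) : {ae mu, forall x, x != c}.
  exists [set c]; split => //; first exact: lebesgue_measure_set1.
  by move=> x /= /negP; rewrite negbK => /eqP.
have dF (x : R) : 0 < x -> x < 1 -> is_derive x (1 : R) F 0.
  move=> x0 x1.
  apply: (@near_eq_is_derive _ _ _ (cst (F x))).
  near=> y => /=.
  have y0 : 0 < y by near: y; exact: lt_nbhsr.
  have y1 : y < 1 by near: y; exact: lt_nbhsl.
  by have [xy|yx] := leP x y; [rewrite (Fcst x y)|rewrite (Fcst y x)// ltW].
apply: (@filterS3 _ _ (ae_filter_ringOfSetsType mu) _ _ _ _ _ Fae (neq 0) (neq 1)) => x [_ F'x] x0 x1 /=.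
rewrite in_itv/= => /andP[]; rewrite le_eqVlt eq_sym (negbTE x0)/= => x0'.
rewrite le_eqVlt (negbTE x1)/= => x1'.
have <- : g x = f x by rewrite /g patchE mem_itvcc !ltW.
by rewrite -F'x derive1E (@derive_val _ _ _ _ _ _ _ (dF x x0' x1')).
Unshelve. all: by end_near. Qed.

(** Dominated convergence along the cutoffs of [`]a, b[]. *)
Lemma integral_itv_of_cutoffs n f a b : 0 < a -> a < b -> b < 1 ->
  mu.-integrable I01 (EFin \o f) ->
  (forall k, \int[mu]_(x in I01) (f x * cutoff n a b k x) = 0) ->
  \int[mu]_(x in `[a, b]) f x = 0.
Proof.
move=> a0 ab b1 fi fk0.
have mf : measurable_fun I01 f by case/integrableP : fi => /measurable_EFinP.
have ci k : mu.-integrable I01 (EFin \o (fun x => f x * cutoff n a b k x)).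
  by apply: integrable_mulc => //; exact: Cn_continuous (Cn_cutoff n a b k).
have := @dominated_cvg _ _ _ mu I01 (measurable_itv _)
  (fun k x => (f x * cutoff n a b k x)%:E)
  (fun x => ((f \_ `]a, b[) x)%:E) (fun x => `|f x|%:E).
move=> /(_ _ _ _ _ _)/wrap[].
- by move=> k; case/integrableP : (ci k).
- move=> x _; apply: cvg_EFin; first exact: nearW.
  rewrite patchE; case: ifPn => [|xab].
    rewrite inE/= in_itv/= => xab.
    rewrite -[X in _ --> X]mulr1; apply: cvgM; first exact: cvg_cst.
    by apply: cvg_cutoff => //; exact: ltW.
  rewrite (_ : fine \o _ = cst (0 : R)); first exact: cvg_cst.
  apply/funext => k /=; rewrite cutoff_out ?mulr0//; first exact: ltW.
  by move: xab; rewrite notin_setE/= in_itv/= => /negP.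
- by [].
- by move/integrable_norm : fi.
- move=> k x _; rewrite abse_EFin lee_fin normrM ler_piMr//.
  by apply: cutoff_le1; exact: ltW.
move=> cv.
rewrite (_ : (fun k => _) = cst 0%E) in cv; last first.
  by apply/funext => k; rewrite EFin_Rintegral//= fk0.
have e := cvg_lim (@ereal_hausdorff R) cv; rewrite lim_cst// in e.
have e0 : 0 = \int[mu]_(x in I01) (f \_ `]a, b[) x :=
  congr1 fine (e eventually_filter).
rewrite [RHS]e0 -Rintegral_mkcondr.
have abI : `]a, b[ `<=` I01.
  by apply: subset_itvScc; rewrite bnd_simp ltW.
rewrite setIidr//.
rewrite -Rintegral_itv_obnd_cbnd -?Rintegral_itv_bndo_bndc//.
  exact: integrableS fi.
apply: integrableS fi => //; apply: subset_itvScc; rewrite bnd_simp ?ltW//.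
Qed.

(** Integrating from [-oo] instead of from [c] yields a primitive on the whole
    line with no case distinction at [c]. *)
Lemma C1_primitive g c : continuous g -> (forall x, x <= c -> g x = 0) ->
  exists2 G, C1_deriv G g & forall x, x <= c -> G x = 0.
Proof.
move=> cg g0.
have gi u : mu.-integrable `]-oo, u] (EFin \o g).
  have -> : (EFin \o g) = ((EFin \o g) \_ `]c, +oo[).
    apply/funext => x; rewrite patchE; case: ifPn => //.
    by rewrite notin_setE/= in_itv/= andbT => /negP; rewrite -leNgt => /g0 ->.
  apply/(integrable_restrict _ _ _ _).1 => //.
  have := continuous_integrable_itv c u cg; apply: integrableS => //.
    exact: measurableI.
  by move=> x /=; rewrite !in_itv/= andbT => -[-> /ltW ->].
exists (fun x => \int[mu]_(t in `]-oo, x]) g t).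
  split=> // x.
  have xx1 : x < x + 1 by rewrite ltrDl.
  have [D E] := continuous_FTC1 xx1 (gi _) (ltNyr _) (cg x).
  by rewrite -E derive1E; apply: DeriveDef.
move=> x xc; rewrite -[RHS](Rintegral_set0 mu g) /Rintegral integral_set0.
congr fine; apply: integral0_eq => y /=; rewrite in_itv/= => yx.
by rewrite g0// (le_trans yx).
Qed.

(** The lemma of du Bois-Reymond. A function orthogonal to all derivatives of
    test functions is orthogonal to every [chi - J * theta] of integral 0, since
    the primitive of the latter is again a test function; so [f - c] is
    orthogonal to every cutoff [chi] for one constant [c]. *)
Lemma constant_of_weak_derivative0 f : mu.-integrable I01 (EFin \o f) ->
  (forall phi, test_function phi -> \int[mu]_(s in I01) (f s * derive1 phi s) = 0) ->
  exists c, ae_eq mu I01 f (cst c).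
Proof.
move=> fi fw.
pose psi := cutoff 0 (4^-1 : R) (2^-1 : R).
have cpsi k : continuous (psi k) by exact: Cn_continuous (Cn_cutoff 0 _ _ _).
(* Some cutoff of a fixed interval has nonzero integral, since these integrals
   tend to the length of the interval. *)
have [k0 ck0] : exists k, \int[mu]_(s in I01) psi k s != 0.
  apply: contrapT => /forallNP nk.
  have : \int[mu]_(x in `[4^-1 : R, 2^-1]) (cst 1 x : R) = 0.
    apply: (@integral_itv_of_cutoffs 0) => //.
    - by rewrite ltf_pV2 ?posrE// ltr_nat.
    - by rewrite invf_lt1// ltr1n.
    - by apply: continuous_integrable_itv; exact: cst_continuous.
    - move=> k; have /negP/negPn/eqP nk0 := nk k.
      by rewrite -[RHS]nk0; apply: eq_Rintegral => x _; rewrite mul1r.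
  rewrite Rintegral_cst//= mul1r lebesgue_measure_itv/= lte_fin.
  rewrite ltf_pV2 ?posrE// ltr_nat/= => /eqP.
  by move=> /eqP; lra.
have i4 : 0 < (4^-1 : R) by rewrite invr_gt0.
have i24 : (4^-1 : R) < 2^-1 by rewrite ltf_pV2 ?posrE// ltr_nat.
have i21 : (2^-1 : R) < 1 by rewrite invf_lt1// ltr1n.
pose I0 := \int[mu]_(s in I01) psi k0 s; pose theta := psi k0.
pose c := (\int[mu]_(s in I01) (f s * theta s)) / I0.
exists c.
have fci : mu.-integrable I01 (EFin \o (fun x => f x - c)).
  by apply: integrable_subr => //; apply: continuous_integrable_itv; exact: cst_continuous.
suff : ae_eq mu I01 (fun x => f x - c) (cst 0).
  by apply: filterS => x + Dx => /(_ Dx) /eqP; rewrite subr_eq0 => /eqP.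
apply: ae_eq0_of_integrals => // a b a0 ab b1.
apply: (@integral_itv_of_cutoffs 0) => // k.
pose chi := cutoff 0 a b k; pose J := (\int[mu]_(s in I01) chi s) / I0.
have cchi : continuous chi by exact: Cn_continuous (Cn_cutoff 0 _ _ _).
pose g s := chi s - J * theta s.
have cJt : continuous (fun s => J * theta s).
  by move=> x; apply: cvgM; [exact: cvg_cst|exact: cpsi].
have cg : continuous g by move=> x; apply: cvgB; [exact: cchi|exact: cJt].
have g0 x : ~~ (Num.min a 4^-1 < x < Num.max b 2^-1) -> g x = 0.
  rewrite gt_min lt_max => xab; rewrite /g /theta /chi /psi.
  have xab1 : ~~ (a < x < b) by apply: contra xab => /andP[-> ->].
  have xab2 : ~~ (4^-1 < x < 2^-1).
    by apply: contra xab => /andP[-> ->]; rewrite !orbT.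
  by rewrite !cutoff_out ?mulr0 ?subr0 ?ltW.
have ltC (x y : R) : x <= y -> ~~ (y < x) by rewrite leNgt.
have [G [dG _] G0] : exists2 G, C1_deriv G g & forall x, x <= Num.min a 4^-1 -> G x = 0.
  by apply: C1_primitive => // x xa; apply: g0; rewrite negb_and ltC.
have ct : continuous theta by exact: cpsi.
have ti : mu.-integrable I01 (EFin \o theta) by exact: continuous_integrable_itv.
have chii : mu.-integrable I01 (EFin \o chi) by exact: continuous_integrable_itv.
have Jti : mu.-integrable I01 (EFin \o (fun s => J * theta s)).
  exact: continuous_integrable_itv.
have a01 : 0 <= Num.min a 4^-1 by rewrite le_min !ltW.
have b01 : Num.max b 2^-1 <= 1 by rewrite ge_max !ltW.
have G1 : G 1 = 0.
  have := @FTC2_C1 _ G g 0 1 (conj dG cg) ler01.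
  rewrite (G0 0)// subr0 => <-; rewrite RintegralB// RintegralZl//.
  by rewrite /J -/I0 mulfVK// subrr.
have Gb x : Num.max b 2^-1 <= x -> G x = 0.
  have Gd y : Num.max b 2^-1 <= y -> G y = G (Num.max b 2^-1).
    move=> by'; apply/eqP; rewrite -subr_eq0; apply/eqP.
    rewrite -(@FTC2_C1 _ G g _ _ (conj dG cg) by') -[RHS](Rintegral_set0 mu g) /Rintegral integral_set0.
    congr fine; apply: integral0_eq => z /=; rewrite in_itv/= => /andP[bz _].
    by rewrite g0// negb_and orbC ltC.
  by move=> bx; rewrite (Gd x)// -(Gd 1).
have dG1 : derive1 G = g.
  by apply/funext => x; rewrite derive1E (@derive_val _ _ _ _ _ _ _ (dG x)).
have := fw G _.
rewrite dG1 => /(_ _)/wrap[].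
  split; [by move=> s; have [] := dG s|by rewrite dG1|].
  exists (Num.min a 4^-1), (Num.max b 2^-1); split.
  - by rewrite lt_min a0.
  - by rewrite gt_max b1.
  - move=> s; rewrite in_itv/= negb_and -!ltNge => /orP[|] /ltW; [exact: G0|exact: Gb].
rewrite /g.
under eq_Rintegral do rewrite mulrBr mulrCA.
rewrite RintegralB//; last 2 first.
  exact: integrable_mulc.
  by apply: integrable_scaler => //; exact: integrable_mulc.
rewrite RintegralZl//; last exact: integrable_mulc.
move=> fJ; under eq_Rintegral do rewrite mulrBl.
rewrite RintegralB//; last 2 first.
  exact: integrable_mulc.
  exact: integrable_scaler.
rewrite RintegralZl// -[RHS]fJ /J /c; congr (_ - _).
by rewrite -/chi; ring.
Qed.

(** Subtracting the primitive of [g], which also has weak derivative [g],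
    reduces this to the lemma of du Bois-Reymond. *)
Lemma weak_derivative_primitive f g : mu.-integrable I01 (EFin \o f) ->
  mu.-integrable I01 (EFin \o g) -> is_weak_derivative f g ->
  exists c, ae_eq mu I01 f (fun x => c + \int[mu]_(s in `[0, x]) g s).
Proof.
move=> fi gi fg; pose F x := \int[mu]_(s in `[0, x]) g s.
have cF : {within I01, continuous F}.
  exact: (parameterized_integral_continuous ler01 gi).
have Fi : mu.-integrable I01 (EFin \o F).
  by apply: continuous_compact_integrable => //; exact: segment_compact.
have FiM h : continuous h -> mu.-integrable I01 (EFin \o (fun x => F x * h x)).
  exact: integrable_mulc.
have fFi : mu.-integrable I01 (EFin \o (fun x => f x - F x)) by exact: integrable_subr.
have [phi tphi|c fFc] := constant_of_weak_derivative0 fFi; last first.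
  exists c; apply: filterS fFc => x + Dx => /(_ Dx) /= /eqP.
  by rewrite subr_eq => /eqP.
have [dphi cphi [a [b [a0 b1 ab0]]]] := tphi.
have C1phi : C1_deriv phi (derive1 phi).
  by split => // x; rewrite derive1E; exact: derivableP.
under eq_Rintegral do rewrite mulrBl.
rewrite RintegralB//; [|exact: integrable_mulc|exact: FiM].
rewrite fg// (Rintegral_parts ler01 gi C1phi) ab0 ?mul0r ?sub0r ?opprK; last first.
  by rewrite in_itv/= negb_and -!ltNge b1 orbT.
by under [X in X - _]eq_Rintegral do rewrite mulrC; rewrite subrr.
Qed.

End Fundamental.

(** * Translations and L^p spaces of the line *)

Section Translation.
Context (R : realType).
Local Notation mu := (@lebesgue_measure R).
Local Notation Rm := (measurableTypeR R).
Let shiftm (c : R) : Rm -> Rm := fun x => (x : R) + c.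
Let mshift c : measurable_fun setT (shiftm c).
Proof.
apply: (@continuous_measurable_fun R) => x.
by apply: cvgD; [exact: cvg_id|exact: cvg_cst].
Qed.
Lemma lebesgue_measure_shift (c : R) (A : set R) : measurable A ->
  pushforward mu (shiftm c) A = mu A.
Proof.
move=> mA; apply/esym/lebesgue_measure_unique.
  2: exact: mA.
move=> _ [[a b]] _ <- /=.
rewrite /pushforward.
have -> : shiftm c @^-1` (`]a, b]%classic : set R) = (`]a - c, b - c]%classic : set R).
  by apply/seteqP; split => x /=; rewrite !in_itv/= ltrBlDr lerBrDr.
rewrite !lebesgue_measure_itv/= !lte_fin ltrD2r; case: ifP => // _.
by rewrite -!EFinD; congr EFin; ring.
Qed.
Lemma ge0_integral_shift (c : R) (f : Rm -> \bar R) : measurable_fun setT f ->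
  (forall x, 0 <= f x)%E -> (\int[mu]_x f ((x : R) + c)%R = \int[mu]_x f x)%E.
Proof.
move=> mf f0.
have := @ge0_integral_pushforward _ _ _ _ _ _ (mshift c) mu setT f measurableT mf (fun y _ => f0 y).
rewrite preimage_setT => <-.
by apply: eq_measure_integral => A mA _; exact: lebesgue_measure_shift.
Qed.
Lemma integral_shift (c : R) (f : Rm -> R) : measurable_fun setT f ->
   mu.-integrable setT (EFin \o (fun x => f ((x : R) + c))) ->
   \int[mu]_x f ((x : R) + c) = \int[mu]_x f x.
Proof.
move=> mf fi.
have := @integral_pushforward _ _ _ _ _ _ (mshift c) mu setT (EFin \o f) _ _ measurableT.
rewrite preimage_setT => /(_ _ _)/wrap[] //; first exact/measurable_EFinP.
rewrite /Rintegral => /(congr1 fine) => <-.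
by congr fine; apply: eq_measure_integral => A mA _; exact: lebesgue_measure_shift.
Qed.
Lemma integrable_shift (c : R) (f : Rm -> R) : mu.-integrable setT (EFin \o f) ->
   mu.-integrable setT (EFin \o (fun x => f ((x : R) + c))).
Proof.
move=> /integrableP[/measurable_EFinP mf fi]; apply/integrableP; split.
  by apply/measurable_EFinP; apply: (measurableT_comp mf); exact: mshift.
rewrite (@ge0_integral_shift c (fun x => `|(f x)%:E|%E))//.
by apply: measurableT_comp => //; exact/measurable_EFinP.
Qed.
End Translation.

Section RealLp.
Context (R : realType) (p : R) (p1 : 1 <= p).
Local Notation mu := (@lebesgue_measure R).
Local Notation I01 := (`[0%R, 1%R]%classic : set R).
Implicit Types (f g h : R -> R) (D : set R).

Let p0 : 0 < p. Proof. exact: lt_le_trans p1. Qed.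
Let p1e : (1 <= p%:E)%E. Proof. by rewrite lee_fin. Qed.

Lemma integrable_cst D (c : R) : measurable D -> (mu D < +oo)%E ->
  mu.-integrable D (EFin \o cst c).
Proof.
move=> mD Dfin; apply/integrableP; split; first exact/measurable_EFinP.
by under eq_integral do rewrite /=; rewrite integral_cst//= lte_mul_pinfty.
Qed.

Lemma measurable_absX f : measurable_fun setT f ->
  measurable_fun setT (fun x => (`|f x| `^ p)%:E).
Proof.
move=> mf; apply/measurable_EFinP => /=.
apply: (@measurableT_comp _ _ _ _ _ _ (@powR R ^~ p)) => //.
exact: measurableT_comp.
Qed.

Lemma in_LfunP f : f \in Lfun mu p%:E <->
  measurable_fun setT f /\ (\int[mu]_x (`|f x| `^ p)%:E < +oo)%E.
Proof.
split=> [fL|[mf fi]].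
  split; first by move: fL => /andP[/[!inE]].
  have /integrableP[_] := Lfun_integrable p1 fL.
  by apply: le_lt_trans; under [leRHS]eq_integral do rewrite gee0_abs ?lee_fin ?powR_ge0//.
apply/andP; split; rewrite inE//= /finite_norm.
apply: (@lty_poweRy _ _ p); first by rewrite gt_eqF.
by rewrite powR_Lnorm ?gt_eqF.
Qed.

(** On a set of finite measure this bounds the L^1 norm by the L^p norm,
    without an interpolation inequality. *)
Lemma le_1_powR (x : R) : `|x| <= 1 + `|x| `^ p.
Proof.
have [x1|x1] := leP `|x| 1; first by rewrite ler_wpDr// powR_ge0.
rewrite ler_wpDl// -[leLHS]powRr1// ler_powR//; exact: ltW.
Qed.

Lemma Lfun_integrable_finite D f : measurable D -> (mu D < +oo)%E ->
  f \_ D \in Lfun mu p%:E -> mu.-integrable D (EFin \o f).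
Proof.
move=> mD Dfin fL; have [mf _] := (in_LfunP _).1 fL.
apply: (@le_integrable _ (measurableTypeR R) R mu D mD _ (EFin \o (fun x => 1 + `|(f \_ D) x| `^ p))).
- exact/measurable_EFinP/measurable_restrictT.
- move=> x Dx /=; rewrite patchE mem_set// lee_fin [leRHS]ger0_norm ?addr_ge0 ?powR_ge0//.
  exact: le_1_powR.
- apply: integrable_addr => //; first exact: integrable_cst.
  by apply: integrableS (Lfun_integrable p1 fL); [exact: measurableT|exact: mD|exact: subsetT].
Qed.

Lemma Lfun_dominated f g : measurable_fun setT f -> (forall x, `|f x| <= `|g x|) ->
  g \in Lfun mu p%:E -> f \in Lfun mu p%:E.
Proof.
move=> mf fg /in_LfunP[mg gi]; apply/in_LfunP; split; first by [].
apply: le_lt_trans gi.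
apply: ge0_le_integral.
- exact: measurableT.
- by move=> x _; rewrite lee_fin powR_ge0.
- exact: measurable_absX.
- exact: measurable_absX.
by move=> x _; rewrite lee_fin ge0_ler_powR ?nnegrE// ltW.
Qed.

Lemma Lfun_bounded D f (M : R) : measurable D -> (mu D < +oo)%E ->
  measurable_fun D f -> (forall x, D x -> `|f x| <= M) -> f \_ D \in Lfun mu p%:E.
Proof.
move=> mD Dfin mf fM; have restrT g := (measurable_restrictT (g : measurableTypeR R -> R) mD).1.
apply: (@Lfun_dominated _ (cst M \_ D)).
- exact: restrT.
- move=> x; rewrite !patchE; case: ifPn => [/set_mem Dx|]//=.
  by rewrite (le_trans (fM x Dx))// ler_norm.
apply/in_LfunP; split; first exact: restrT.
rewrite (_ : (fun x => _) = (cst (`|M| `^ p)%:E) \_ D); last first.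
  by apply/funext => x; rewrite !patchE; case: ifP => //= _; rewrite normr0 powR0// gt_eqF.
by rewrite -integral_mkcond integral_cst// lte_mul_pinfty.
Qed.

Lemma Lfun_shift f (c : R) : f \in Lfun mu p%:E ->
  (fun x : R => f (x + c)) \in Lfun mu p%:E.
Proof.
move=> /in_LfunP[mf fi]; apply/in_LfunP; split.
  apply: (measurableT_comp mf); apply: continuous_measurable_fun => x.
  by apply: cvgD; [exact: cvg_id|exact: cvg_cst].
rewrite (@ge0_integral_shift R c (fun x => (`|f x| `^ p)%:E))//.
exact: measurable_absX.
Qed.

Lemma Lfun_continuous01 f : {within I01, continuous f} -> f \_ I01 \in Lfun mu p%:E.
Proof.
move=> cf.
have : compact (f @` I01) by apply: continuous_compact => //; exact: segment_compact.
move=> /compact_bounded[M [_ hM]].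
apply: (@Lfun_bounded _ _ (`|M| + 1)) => //.
- by rewrite lebesgue_measure_itv/= lte_fin ltr01 oppr0 adde0 ltry.
- exact: subspace_continuous_measurable_fun.
- move=> x Dx; apply: hM; last by exists x.
  by rewrite (le_lt_trans (ler_norm _))// ltrDl.
Qed.

(** After normalising the L^p norm to 1, the constant 2 comes from
    [|x| <= 1 + |x| ^ p] integrated over an interval of length 1. *)
Lemma integral_le_Lnorm f : f \_ I01 \in Lfun mu p%:E ->
  \int[mu]_(x in I01) `|f x| <= 2 * fine 'N[mu]_p%:E[EFin \o f \_ I01]%E.
Proof.
move=> fL; have [mf fi] := (in_LfunP _).1 fL.
have muI : mu I01 = 1%E by rewrite lebesgue_measure_itv/= lte_fin ltr01 oppr0 adde0.
have fint : mu.-integrable I01 (EFin \o f).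
  by apply: Lfun_integrable_finite => //; rewrite muI ltry.
have Nfin : 'N[mu]_p%:E[EFin \o f \_ I01]%E \is a fin_num.
  by rewrite ge0_fin_numE ?Lnorm_ge0//; move: fL => /andP[_ /[!inE]].
set N := fine _; have N0 : 0 <= N by rewrite fine_ge0// Lnorm_ge0.
have NE : 'N[mu]_p%:E[EFin \o f \_ I01]%E = N%:E by rewrite fineK.
move: N0; rewrite le_eqVlt => /predU1P[N0|N0].
  have /Lnorm_eq0_eq0 : 'N[mu]_p%:E[EFin \o f \_ I01]%E = 0%E by rewrite NE -N0.
  move=> /(_ _ _)/wrap[]; first exact/measurable_EFinP.
    by rewrite lte_fin.
  move=> f0; rewrite -N0 mulr0 /Rintegral (ae_eq_integral (cst 0%E))//.
  - by rewrite integral0.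
  - by apply/measurable_EFinP; apply: measurableT_comp => //; case/integrableP : fint => /measurable_EFinP.
  - apply: filterS f0 => x + Dx => /(_ Logic.I) /=; rewrite patchE mem_set// => -[->].
    by rewrite normr0.
have pint := Lfun_integrable p1 fL.
have pE : \int[mu]_x (`|(f \_ I01) x| `^ p) = N `^ p.
  have := @powR_Lnorm _ _ _ mu (EFin \o f \_ I01) p (lt0r_neq0 p0).
  by rewrite NE poweR_EFin => /(congr1 fine) /= ->.
pose G x : R := (cst N \_ I01) x + N `^ (1 - p) * (`|(f \_ I01) x| `^ p).
have Gi1 : mu.-integrable setT (EFin \o (cst N \_ I01)).
  by apply: integrable_patch => //; apply: integrable_cst; rewrite ?muI ?ltry.
have Gi2 : mu.-integrable setT (EFin \o (fun x => N `^ (1 - p) * (`|(f \_ I01) x| `^ p))).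
  exact: integrable_scaler.
apply: (@le_trans _ _ (\int[mu]_x G x)).
  rewrite Rintegral_mkcond; apply: le_Rintegral => //.
  - by apply: integrable_patch => //; exact: integrable_norm.
  - exact: integrable_addr.
  move=> x _; rewrite /G !patchE; case: ifPn => xD /=; last first.
    by rewrite add0r mulr_ge0 ?powR_ge0.
  have := le_1_powR (f x / N).
  rewrite normrM normfV (gtr0_norm N0) -(ler_pM2l N0) mulrDr mulr1.
  rewrite mulrCA divff ?gt_eqF// mulr1 => /le_trans; apply.
  rewrite lerD2l powRM ?invr_ge0 ?(ltW N0)// mulrCA [leRHS]mulrC.
  rewrite ler_wpM2l ?powR_ge0// powRB; last by apply/implyP => _; rewrite gt_eqF.
  have -> : N^-1 `^ p = (N `^ p)^-1.
    by rewrite -(powR_inv1 (ltW N0)) -powRrM mulN1r powRN.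
  by rewrite powRr1// ltW.
rewrite RintegralD// RintegralZl// pE -powRD ?subrK; last by apply/implyP => _; rewrite gt_eqF.
rewrite powRr1 ?(ltW N0)// -Rintegral_mkcond Rintegral_cst//= muI/= mulr1 mulr2n.
by rewrite mulrDl mul1r.
Qed.

End RealLp.

(** * Weak derivatives on the unit interval *)

Section WeakDerivative.
Context (R : realType).
Local Notation mu := (@lebesgue_measure R).
Local Notation I01 := (`[0%R, 1%R]%classic : set R).
Implicit Types (f g h : R -> R).

Lemma continuous01_ae_eq f g : {within I01, continuous f} -> {within I01, continuous g} ->
  ae_eq mu I01 f g -> forall x, 0 <= x <= 1 -> f x = g x.
Proof.
move=> cf cg fg x x01; apply/eqP; rewrite -subr_eq0; apply: contrapT => /negP dx.
have cd : {within I01, continuous (fun y => f y - g y)}.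
  by move=> y; apply: continuousB; [exact: cf|exact: cg].
have /subspace_continuousP/(_ x) := cd; rewrite /= in_itv/= => /(_ x01) dcv.
have : \forall y \near within I01 (nbhs x), f y - g y != 0.
  by have := @dcv [set z | z != 0] (open_nbhs_nbhs (conj (@open_neq _ 0) dx)).
rewrite /within/= => /nbhs_ballP[e /= e0 eball].
have [N [mN N0 Nsub]] := fg.
have [a [b [ab ab01 abe]]] : exists a b, [/\ a < b, `[a, b] `<=` I01 & `[a, b] `<=` ball x e].
  have /andP[x0 x1] := x01.
  have [xlt|xge] := ltP x 1.
    exists x, (Num.min 1 (x + e / 2)); split.
    - by rewrite lt_min xlt ltrDl divr_gt0.
    - by apply: subset_itvScc; rewrite bnd_simp// ge_min lexx.
    - move=> y /=; rewrite in_itv/= le_min => /and3P[xy _ ye].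
      by rewrite ball_itv/= in_itv/=; apply/andP; split; lra.
  exists (Num.max 0 (x - e / 2)), x; split.
  - by rewrite gt_max; apply/andP; split; lra.
  - by apply: subset_itvScc; rewrite bnd_simp// le_max lexx.
  - move=> y /=; rewrite in_itv/= ge_max => /andP[/andP[_ ye] yx].
    by rewrite ball_itv/= in_itv/=; apply/andP; split; lra.
have abN : `[a, b] `<=` N.
  move=> y yab; apply: Nsub => /= /(_ (ab01 _ yab)) fgy.
  have := eball y (abe y yab) (ab01 _ yab).
  by rewrite fgy subrr eqxx.
have le0 : (mu (`[a, b]%classic : set R) <= 0)%E.
  apply: (le_trans (le_measure mu (mem_set (measurable_itv `[a, b])) (mem_set mN) abN)).
  by rewrite le_eqVlt; apply/orP; left; apply/eqP; exact: N0.
by move: le0; rewrite lebesgue_measure_itv/= lte_fin ab -EFinD lee_fin leNgt subr_gt0 ab.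
Qed.

Lemma within_continuous_addc c f : {within I01, continuous f} ->
  {within I01, continuous (fun x => c + f x)}.
Proof.
move=> /subspace_continuousP cf; apply/subspace_continuousP => x Ax.
by apply: cvgD; [exact: cvg_cst|exact: cf].
Qed.

(** Integration by parts against functions that do not vanish at the ends:
    the boundary values are those of the continuous representative. *)
Lemma weak_derivative_parts f g phi h h' :
  mu.-integrable I01 (EFin \o f) -> mu.-integrable I01 (EFin \o g) ->
  is_weak_derivative f g -> {within I01, continuous phi} -> ae_eq mu I01 f phi ->
  C1_deriv h h' ->
  \int[mu]_(s in I01) (g s * h s) =
    h 1 * phi 1 - h 0 * phi 0 - \int[mu]_(s in I01) (f s * h' s).
Proof.
move=> fi gi fg cphi fphi C1h; have [c fF] := weak_derivative_primitive fi gi fg.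
pose F x := \int[mu]_(s in `[0, x]) g s.
have cF : {within I01, continuous F}.
  exact: (parameterized_integral_continuous ler01 gi).
have Fi : mu.-integrable I01 (EFin \o F).
  by apply: continuous_compact_integrable => //; exact: segment_compact.
have phiE x : 0 <= x <= 1 -> phi x = c + F x.
  move=> x01; apply: (@continuous01_ae_eq phi (fun x => c + F x) cphi _ _ x x01).
    exact: within_continuous_addc.
  by apply: ae_eq_trans fF; exact: ae_eq_sym.
have ch := C1_continuous C1h; have [_ ch'] := C1h.
rewrite !phiE ?lexx ?ler01// (Rintegral_parts ler01 gi C1h).
have -> : F 0 = 0 by rewrite /F set_itv1 Rintegral_set1.
have -> : \int[mu]_(s in I01) (f s * h' s) = \int[mu]_(s in I01) (c * h' s + F s * h' s).
  rewrite /Rintegral; congr fine; apply: ae_eq_integral => //.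
  - by case/integrableP: (integrable_mulc fi ch').
  - have : mu.-integrable I01 (EFin \o (fun s => c * h' s + F s * h' s)).
      apply: integrable_addr => //; last exact: integrable_mulc.
      by apply: integrable_scaler => //; exact: continuous_integrable_itv.
    by case/integrableP.
  - by apply: filterS fF => x + Dx => /(_ Dx) /= ->; rewrite mulrDl.
rewrite RintegralD//; last 2 first.
  by apply: integrable_scaler => //; exact: continuous_integrable_itv.
  exact: integrable_mulc.
rewrite RintegralZl//; last exact: continuous_integrable_itv.
rewrite (FTC2_C1 C1h ler01) /F.
under [X in _ - X = _]eq_Rintegral do rewrite mulrC.
by ring.
Qed.

Lemma weak_derivative_continuous f g :
  mu.-integrable I01 (EFin \o f) -> mu.-integrable I01 (EFin \o g) ->
  is_weak_derivative f g ->
  exists2 phi, {within I01, continuous phi} & ae_eq mu I01 f phi.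
Proof.
move=> fi gi fg; have [c fF] := weak_derivative_primitive fi gi fg.
exists (fun x => c + \int[mu]_(s in `[0, x]) g s) => //.
apply: within_continuous_addc.
exact: (parameterized_integral_continuous ler01 gi).
Qed.

Lemma Rintegral_ae_eq f g : mu.-integrable I01 (EFin \o f) ->
  mu.-integrable I01 (EFin \o g) -> ae_eq mu I01 f g ->
  \int[mu]_(s in I01) f s = \int[mu]_(s in I01) g s.
Proof.
move=> /integrableP[mf _] /integrableP[mg _] fg; congr fine.
by apply: ae_eq_integral => //; apply: filterS fg => x + Dx => /(_ Dx) /= ->.
Qed.

(** The fundamental lemma of the calculus of variations, with the cutoffs of a
    prescribed order of smoothness as the only test functions. *)
Lemma ae_eq_of_tests n f g : mu.-integrable I01 (EFin \o f) ->
  mu.-integrable I01 (EFin \o g) ->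
  (forall a b k, 0 < a -> a < b -> b < 1 ->
    \int[mu]_(s in I01) (f s * cutoff n a b k s) = \int[mu]_(s in I01) (g s * cutoff n a b k s)) ->
  ae_eq mu I01 f g.
Proof.
move=> fi gi fg.
have cc a b k : continuous (cutoff n a b k : R -> R) by exact: Cn_continuous (Cn_cutoff n a b k).
have : ae_eq mu I01 (fun s => f s - g s) (cst 0).
  have fgi : mu.-integrable I01 (EFin \o (fun s => f s - g s)) by exact: integrable_subr.
  apply: ae_eq0_of_integrals => // a b a0 ab b1.
  apply: (@integral_itv_of_cutoffs _ n) => // k.
  under eq_Rintegral do rewrite mulrBl.
  rewrite RintegralB//; [|exact: integrable_mulc|exact: integrable_mulc].
  by rewrite fg// subrr.
by apply: filterS => x + Dx => /(_ Dx) /eqP; rewrite subr_eq0 => /eqP.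
Qed.

End WeakDerivative.

(** * Pairing vector-valued L^p functions with test functions *)

Section LpPairing.
Context (R : realType) (p : R) (p1 : 1 <= p) (m : nat).
Local Notation C := R[i].
Local Notation mu := (@lebesgue_measure R).
Local Notation I01 := (`[0%R, 1%R]%classic : set R).
Implicit Types (F G : R -> 'cV[C]_m) (f g : Lp p1 m) (h : R -> R) (k : 'I_m).

Definition reE F k : R -> R := fun s => complex.Re (F s k 0).
Definition imE F k : R -> R := fun s => complex.Im (F s k 0).

Definition integrable01 F := forall k,
  mu.-integrable I01 (EFin \o reE F k) /\ mu.-integrable I01 (EFin \o imE F k).

(** Test functions are real while [F] takes complex vector values, so the
    integral is taken separately in each real and imaginary part. *)
Definition pairing F h : 'cV[C]_m :=
  \col_k ((\int[mu]_(s in I01) (reE F k s * h s)) +i*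
          (\int[mu]_(s in I01) (imE F k s * h s)))%C.

Definition in_Lp_vec F := forall k, in_Lp p I01 (fun s => F s k 0).

Lemma muI01 : mu I01 = 1%E.
Proof. by rewrite lebesgue_measure_itv/= lte_fin ltr01 oppr0 adde0. Qed.

Lemma in_Lp_integrable01 F : in_Lp_vec F -> integrable01 F.
Proof.
move=> FL k; have /andP[FR FI] := FL k.
by split; apply: (@Lfun_integrable_finite _ p p1) => //; rewrite muI01 ltry.
Qed.

Lemma Lp_fun_in f : in_Lp_vec (Lp_fun f).
Proof. by move=> k; have /forallP := valP (repr f). Qed.

Lemma Lp_fun_integrable f : integrable01 (Lp_fun f).
Proof. exact/in_Lp_integrable01/Lp_fun_in. Qed.

Lemma pi_LpP (u v : LpFun p1 m) :
  (\pi_(Lp p1 m)%qT u = \pi_(Lp p1 m)%qT v) <-> u - v \in @Lp_null R p p1 m.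
Proof. by split=> [/eqmodP|h]; [|apply/eqmodP]. Qed.

Lemma Lp_of_fun F : in_Lp_vec F -> exists f, represents F f.
Proof.
move=> FL; have FL' : F \in Lp_vec p1 m by apply/forallP.
pose F' : LpFun p1 m := exist _ F FL'.
exists (\pi_(Lp p1 m)%qT F').
have : repr (\pi_(Lp p1 m)%qT F') - F' \in @Lp_null R p p1 m.
  by apply/pi_LpP; rewrite reprK.
move=> /asboolP; apply: filterS => x + Dx => /(_ Dx) H.
by apply/eqP; rewrite -subr_eq0; apply/eqP; exact: H.
Qed.

Lemma represents_linear (a : C) f g :
  represents (fun s => a *: Lp_fun f s + Lp_fun g s) (a *: f + g).
Proof.
have : repr (a *: f + g) - (a *: repr f + repr g) \in @Lp_null R p p1 m.
  apply/pi_LpP; rewrite reprK.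
  have -> : \pi_(Lp p1 m)%qT (a *: repr f + repr g) =
    \pi_(Lp p1 m)%qT (a *: repr f) + \pi_(Lp p1 m)%qT (repr g) by rewrite Quotient.pi_add.
  by rewrite reprK.
move=> /asboolP; apply: filterS => x + Dx => /(_ Dx) /= H.
by apply/eqP; rewrite -subr_eq0; apply/eqP; exact: H.
Qed.

Lemma represents_eq F f g : represents F f -> represents F g -> f = g.
Proof.
move=> Ff Fg; rewrite -(reprK f) -(reprK g); apply/pi_LpP/asboolP.
apply: filterS2 Ff Fg => x + + Dx => /(_ Dx) fF /(_ Dx) gF.
by have : Lp_fun f x - Lp_fun g x = 0 by rewrite fF gF subrr.
Qed.

(** Makes the pairing well defined on classes of functions. *)
Lemma pairing_ae_eq F G h : integrable01 F -> integrable01 G -> continuous h ->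
  ae_eq mu I01 F G -> pairing F h = pairing G h.
Proof.
move=> Fi Gi ch FG; apply/colP => k; rewrite !mxE.
have [FR FI] := Fi k; have [GR GI] := Gi k.
congr (_ +i* _)%C; apply: Rintegral_ae_eq; try exact: integrable_mulc.
  by apply: filterS FG => x + Dx => /(_ Dx) FGx; rewrite /reE FGx.
by apply: filterS FG => x + Dx => /(_ Dx) FGx; rewrite /imE FGx.
Qed.

Lemma in_Lp_vecZD (a : C) F G : in_Lp_vec F -> in_Lp_vec G ->
  in_Lp_vec (fun s => a *: F s + G s).
Proof.
move=> FL GL k.
rewrite (_ : (fun _ => _) = fun s => a * F s k 0 + G s k 0); last first.
  by apply/funext => s; rewrite !mxE.
exact: in_LpZD.
Qed.

Lemma pairingZD (a : C) F G h : integrable01 F -> integrable01 G -> continuous h ->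
  pairing (fun s => a *: F s + G s) h = a *: pairing F h + pairing G h.
Proof.
move=> Fi Gi ch; apply/colP => k; rewrite !mxE.
have [FR FI] := Fi k; have [GR GI] := Gi k.
have iFR := integrable_mulc FR ch; have iFI := integrable_mulc FI ch.
have iGR := integrable_mulc GR ch; have iGI := integrable_mulc GI ch.
case: a => ar ai; apply/eqP; rewrite eq_complex /=; apply/andP; split; apply/eqP.
  transitivity (\int[mu]_(s in I01) ((ar * (reE F k s * h s) - ai * (imE F k s * h s)) + reE G k s * h s)).
    apply: eq_Rintegral => s _; rewrite /reE /imE !mxE cReD cReM /=; ring.
  rewrite RintegralD//; last by apply: integrable_subr => //; exact: integrable_scaler.
  rewrite RintegralB//; do ?exact: integrable_scaler.
  by rewrite !RintegralZl.
transitivity (\int[mu]_(s in I01) ((ar * (imE F k s * h s) + ai * (reE F k s * h s)) + imE G k s * h s)).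
  apply: eq_Rintegral => s _; rewrite /reE /imE !mxE cImD cImM /=; ring.
rewrite RintegralD//; last by apply: integrable_addr => //; exact: integrable_scaler.
rewrite RintegralD//; do ?exact: integrable_scaler.
by rewrite !RintegralZl.
Qed.

Definition pair f h := pairing (Lp_fun f) h.

Lemma pairZD (a : C) f g h : continuous h ->
  pair (a *: f + g) h = a *: pair f h + pair g h.
Proof.
move=> ch; rewrite /pair -pairingZD//; do ?exact: Lp_fun_integrable.
apply: pairing_ae_eq => //; first exact: Lp_fun_integrable.
  by apply/in_Lp_integrable01/in_Lp_vecZD; exact: Lp_fun_in.
exact: represents_linear.
Qed.

Lemma pairB (f g : Lp p1 m) (h : R -> R) : continuous h -> pair (f - g) h = pair f h - pair g h.
Proof. by move=> ch; rewrite addrC -scaleN1r pairZD// scaleN1r addrC. Qed.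

Lemma pairZ (a : C) (f : Lp p1 m) (h : R -> R) : continuous h -> pair (a *: f) h = a *: pair f h.
Proof.
move=> ch; have -> : a *: f = (a - 1) *: f + f by rewrite scalerBl scale1r subrK.
by rewrite pairZD// scalerBl scale1r subrK.
Qed.

Lemma pairingDr (c : R) F h h1 : integrable01 F -> continuous h -> continuous h1 ->
  pairing F (fun s => c * h s + h1 s) = c%:C%C *: pairing F h + pairing F h1.
Proof.
move=> Fi ch ch1; apply/colP => k; rewrite !mxE.
have [FR FI] := Fi k.
have iFR := integrable_mulc FR ch; have iFI := integrable_mulc FI ch.
have iFR1 := integrable_mulc FR ch1; have iFI1 := integrable_mulc FI ch1.
apply/eqP; rewrite eq_complex /= !mul0r subr0 addr0; apply/andP; split; apply/eqP.
  under eq_Rintegral do rewrite mulrDr mulrCA.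
  by rewrite RintegralD ?RintegralZl//; exact: integrable_scaler.
under eq_Rintegral do rewrite mulrDr mulrCA.
by rewrite RintegralD ?RintegralZl//; exact: integrable_scaler.
Qed.

Lemma vnorm_pairing_le F h (M : R) : integrable01 F -> continuous h ->
  (forall s, 0 <= s <= 1 -> `|h s| <= M) ->
  vnorm (pairing F h) <= M * \sum_k (\int[mu]_(s in I01) `|reE F k s| + \int[mu]_(s in I01) `|imE F k s|).
Proof.
move=> Fi ch hM.
have bound (u : R -> R) : mu.-integrable I01 (EFin \o u) ->
    `|\int[mu]_(s in I01) (u s * h s)| <= M * \int[mu]_(s in I01) `|u s|.
  move=> ui; have ui' : mu.-integrable I01 (EFin \o (fun s => `|u s|)) by exact: integrable_norm.
  apply: (le_trans (le_normr_Rintegral _ _)) => //; first exact: integrable_mulc.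
  rewrite -RintegralZl//; apply: le_Rintegral => //.
  - by apply: (@integrable_norm _ _ _ mu); exact: integrable_mulc.
  - exact: integrable_scaler.
  - move=> s /=; rewrite in_itv/= => /hM hs.
    by rewrite normrM mulrC ler_wpM2r.
rewrite /vnorm mulr_sumr; apply: ler_sum => k _; have [FR FI] := Fi k.
rewrite mxE Defs.normcE /= mulrDr.
apply: (le_trans _ (lerD (bound _ FR) (bound _ FI))).
set x := Rintegral _ _ _; set y := Rintegral _ _ _.
rewrite -(@ler_sqr R) ?nnegrE ?sqrtr_ge0 ?addr_ge0//.
rewrite sqr_sqrtr ?addr_ge0 ?sqr_ge0// sqrrD !real_normK ?num_real//.
by rewrite lerD2r lerDl mulrn_wge0// mulr_ge0.
Qed.

Lemma vnorm_pair_le f h (M : R) : continuous h ->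
  (forall s, 0 <= s <= 1 -> `|h s| <= M) ->
  vnorm (pair f h) <= 4 * m%:R * M * Lp_vec_norm p (Lp_fun f).
Proof.
move=> ch hM; apply: (le_trans (vnorm_pairing_le (Lp_fun_integrable f) ch hM)).
have M0 : 0 <= M by rewrite (le_trans _ (hM 0 _))// lexx ler01.
have FL : (vnorm \o Lp_fun f) \_ I01 \in Lfun mu p%:E by exact: vnorm_Lfun (valP (repr f)).
have vi : mu.-integrable I01 (EFin \o (vnorm \o Lp_fun f)).
  by apply: (@Lfun_integrable_finite _ p p1) => //; rewrite muI01 ltry.
have := integral_le_Lnorm p1 FL; rewrite -[X in 2 * X]/(Lp_vec_norm p (Lp_fun f)) => Nle.
have re_le z : `|complex.Re z| <= Normc.normc z :> R.
  rewrite Defs.normcE -sqrtr_sqr ler_wsqrtr// lerDl sqr_ge0//.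
have im_le z : `|complex.Im z| <= Normc.normc z :> R.
  by rewrite Defs.normcE -sqrtr_sqr ler_wsqrtr// lerDr sqr_ge0.
have nc_le s k : Normc.normc (Lp_fun f s k 0) <= vnorm (Lp_fun f s).
  by rewrite /vnorm (bigD1 k)//= lerDl sumr_ge0// => j _; rewrite Defs.normcE sqrtr_ge0.
have le1 (u : R -> R) : mu.-integrable I01 (EFin \o u) ->
    (forall s, `|u s| <= vnorm (Lp_fun f s)) ->
    \int[mu]_(s in I01) `|u s| <= 2 * Lp_vec_norm p (Lp_fun f).
  move=> ui uv; apply: le_trans Nle; apply: le_Rintegral => //.
  - exact: integrable_norm.
  - exact: integrable_norm.
  - by move=> s _ /=; rewrite (le_trans (uv s))// ler_norm.
rewrite [X in _ <= X](_ : _ = M * \sum_(k < m) (4 * Lp_vec_norm p (Lp_fun f))); last first.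
  by rewrite sumr_const card_ord -mulr_natr; ring.
rewrite ler_wpM2l//; apply: ler_sum => k _; have [FR FI] := Lp_fun_integrable f k.
have -> : 4 * Lp_vec_norm p (Lp_fun f) = 2 * Lp_vec_norm p (Lp_fun f) + 2 * Lp_vec_norm p (Lp_fun f) by ring.
apply: lerD; apply: le1 => // s.
  exact: le_trans (re_le _) (nc_le _ _).
exact: le_trans (im_le _) (nc_le _ _).
Qed.

Lemma ae_eq_cV F G : (forall k, ae_eq mu I01 (reE F k) (reE G k)) ->
  (forall k, ae_eq mu I01 (imE F k) (imE G k)) -> ae_eq mu I01 F G.
Proof.
move=> re im.
have reA : {ae mu, forall x, forall k, I01 x -> reE F k x = reE G k x}.
  by apply: filter_forall => k; exact: re.
have imA : {ae mu, forall x, forall k, I01 x -> imE F k x = imE G k x}.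
  by apply: filter_forall => k; exact: im.
apply: (@filterS2 _ _ (ae_filter_ringOfSetsType mu) _ _ _ _ reA imA) => x Hr Hi Dx; apply/colP => k.
apply/eqP; rewrite eq_complex; apply/andP; split; apply/eqP.
  exact: Hr.
exact: Hi.
Qed.

Lemma represents_of_tests n F f : in_Lp_vec F ->
  (forall a b (j : nat), 0 < a -> a < b -> b < 1 ->
    pair f (cutoff n a b j) = pairing F (cutoff n a b j)) ->
  represents F f.
Proof.
move=> FL fF; have Fi := in_Lp_integrable01 FL; have fi := Lp_fun_integrable f.
apply: ae_eq_cV => k; apply: (@ae_eq_of_tests _ n); try exact: (fi k).1; try exact: (fi k).2;
  try exact: (Fi k).1; try exact: (Fi k).2.
  move=> a b j a0 ab b1; have /colP/(_ k) := fF a b j a0 ab b1.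
  by rewrite !mxE => /eqP; rewrite eq_complex/= => /andP[/eqP].
move=> a b j a0 ab b1; have /colP/(_ k) := fF a b j a0 ab b1.
by rewrite !mxE => /eqP; rewrite eq_complex/= => /andP[_ /eqP].
Qed.

End LpPairing.

(** * Traces of Sobolev functions *)

Section Trace.
Context (R : realType) (p : R) (p1 : 1 <= p) (m : nat).
Local Notation C := R[i].
Local Notation mu := (@lebesgue_measure R).
Local Notation I01 := (`[0%R, 1%R]%classic : set R).
Implicit Types (f g : Lp p1 m) (h : R -> R) (k : 'I_m).

Lemma test_function_C1 (phi : R -> R) : test_function phi -> C1_deriv phi (derive1 phi).
Proof.
move=> [dphi cphi _]; split => // x; rewrite derive1E; exact: derivableP.
Qed.

Lemma test_function_ends (phi : R -> R) : test_function phi -> phi 0 = 0 /\ phi 1 = 0.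
Proof.
move=> [_ _ [a [b [a0 b1 ab]]]]; split; apply: ab; rewrite in_itv/= negb_and -!ltNge.
  by rewrite a0.
by rewrite b1 orbT.
Qed.

Lemma Cn_C1 n h : Cn n.+1 h -> exists2 h', C1_deriv h h' & Cn n h'.
Proof.
by move=> [h' dh Ch]; exists h' => //; split=> //; exact: Cn_continuous Ch.
Qed.

Lemma C1_derive1 h h' : C1_deriv h h' -> derive1 h = h'.
Proof.
move=> [dh _]; apply/funext => x.
by rewrite derive1E (@derive_val _ _ _ _ _ _ _ (dh x)).
Qed.

Lemma cutoff_test n (a b : R) (k : nat) : 0 < a -> a < b -> b < 1 -> test_function (cutoff n.+1 a b k).
Proof.
move=> a0 ab b1; have [h' [dh ch] _] := Cn_C1 (Cn_cutoff n.+1 a b k).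
split; first by move=> s; have [] := dh s.
  by rewrite (C1_derive1 (conj dh ch)).
exists a, b; split => // s; rewrite in_itv/= => sab.
by apply: cutoff_out; [exact: ltW|apply: contra sab => /andP[/ltW -> /ltW ->]].
Qed.

Lemma is_Lp_derivativeP f g : is_Lp_derivative f g <->
  forall phi, test_function phi -> pair f (derive1 phi) = - pair g phi.
Proof.
split=> [fg phi tphi|fg k].
  apply/colP => k; rewrite !mxE; have [fgR fgI] := fg k.
  by apply/eqP; rewrite eq_complex/=; apply/andP; split; apply/eqP;
    [exact: fgR|exact: fgI].
split=> phi tphi; have /colP/(_ k) := fg phi tphi; rewrite !mxE => /eqP;
  by rewrite eq_complex/= => /andP[/eqP ? /eqP ?].
Qed.

Lemma continuous_reprP f : W1p f ->
  continuous01 (continuous_repr f) /\ represents (continuous_repr f) f.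
Proof.
move=> [g fg]; suff : exists phi, continuous01 phi /\ represents phi f by move=> /(xgetPex (fun=> 0)).
have fi := Lp_fun_integrable f; have gi := Lp_fun_integrable g.
have exR k : exists phi, {within I01, continuous phi} /\ ae_eq mu I01 (reE (Lp_fun f) k) phi.
  by have [phi c fphi] := weak_derivative_continuous (fi k).1 (gi k).1 (fg k).1; exists phi.
have exI k : exists phi, {within I01, continuous phi} /\ ae_eq mu I01 (imE (Lp_fun f) k) phi.
  by have [phi c fphi] := weak_derivative_continuous (fi k).2 (gi k).2 (fg k).2; exists phi.
have [phiR phiRP] := choice exR; have [phiI phiIP] := choice exI.
exists (fun s => \col_k (phiR k s +i* phiI k s)%C); split.
  move=> k; split.
    rewrite (_ : (fun _ => _) = phiR k); first exact: (phiRP k).1.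
    by apply/funext => s; rewrite mxE.
  rewrite (_ : (fun _ => _) = phiI k); first exact: (phiIP k).1.
  by apply/funext => s; rewrite mxE.
apply: ae_eq_cV => k.
  by apply: filterS (phiRP k).2 => x + Dx => /(_ Dx) ->; rewrite /reE mxE.
by apply: filterS (phiIP k).2 => x + Dx => /(_ Dx) ->; rewrite /imE mxE.
Qed.

Lemma represents_entries (phi : R -> 'cV[C]_m) f : represents phi f -> forall k,
  ae_eq mu I01 (reE (Lp_fun f) k) (reE phi k) /\ ae_eq mu I01 (imE (Lp_fun f) k) (imE phi k).
Proof.
by move=> fphi k; split; apply: filterS fphi => x + Dx => /(_ Dx) H; rewrite /reE /imE H.
Qed.

Lemma continuous_repr_unique f (phi : R -> 'cV[C]_m) : continuous01 phi -> represents phi f ->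
  forall s, 0 <= s <= 1 -> continuous_repr f s = phi s.
Proof.
move=> cphi fphi s s01.
have [ccr fcr] : continuous01 (continuous_repr f) /\ represents (continuous_repr f) f.
  have : exists phi, continuous01 phi /\ represents phi f by exists phi.
  by move=> /(xgetPex (fun=> 0)).
apply/colP => k; apply/eqP; rewrite eq_complex; apply/andP; split; apply/eqP.
  apply: (@continuous01_ae_eq _ (reE (continuous_repr f) k) (reE phi k)) => //.
  - exact: (ccr k).1.
  - exact: (cphi k).1.
  - by apply: ae_eq_trans (represents_entries fphi k).1; apply/ae_eq_sym/(represents_entries fcr k).1.
apply: (@continuous01_ae_eq _ (imE (continuous_repr f) k) (imE phi k)) => //.
- exact: (ccr k).2.
- exact: (cphi k).2.
- by apply: ae_eq_trans (represents_entries fphi k).2; apply/ae_eq_sym/(represents_entries fcr k).2.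
Qed.

Lemma Lp_derivativeP f : W1p f -> is_Lp_derivative f (Lp_derivative f).
Proof. exact: xgetPex. Qed.

(** Integration by parts in [W^{1,p}]; this is where the traces at 0 and 1, and
    thus the boundary conditions of the network, enter. *)
Lemma pair_parts f h h' : W1p f -> C1_deriv h h' ->
  pair (Lp_derivative f) h =
  (h 1)%:C%C *: continuous_repr f 1 - (h 0)%:C%C *: continuous_repr f 0 - pair f h'.
Proof.
move=> fW C1h; have [cc fc] := continuous_reprP fW.
have fg := Lp_derivativeP fW.
have fi := Lp_fun_integrable f; have gi := Lp_fun_integrable (Lp_derivative f).
apply/colP => k; rewrite !mxE.
apply/eqP; rewrite eq_complex; apply/andP; split; apply/eqP => /=.
  rewrite (weak_derivative_parts (fi k).1 (gi k).1 (fg k).1 (cc k).1 (represents_entries fc k).1 C1h).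
  rewrite !raddfB /= !cReM/= !mul0r !subr0.
  by [].
rewrite (weak_derivative_parts (fi k).2 (gi k).2 (fg k).2 (cc k).2 (represents_entries fc k).2 C1h).
by rewrite !raddfB /= !cImM/= !mul0r !addr0.
Qed.

Lemma Lp_derivative_unique f g : is_Lp_derivative f g -> Lp_derivative f = g.
Proof.
move=> fg; have /is_Lp_derivativeP fg' : is_Lp_derivative f (Lp_derivative f).
  by apply: Lp_derivativeP; exists g.
move/is_Lp_derivativeP : fg => fg.
apply: (@represents_eq _ _ _ _ (Lp_fun g)); last exact: ae_eq_refl.
apply: (@represents_of_tests _ _ _ _ 1); first exact: Lp_fun_in.
move=> a b j a0 ab b1; have tc := @cutoff_test 0 a b j a0 ab b1.
by rewrite -[LHS]opprK -fg'// fg// opprK.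
Qed.

Lemma is_Lp_derivativeZD (a : C) f1 f2 g1 g2 : is_Lp_derivative f1 g1 ->
  is_Lp_derivative f2 g2 -> is_Lp_derivative (a *: f1 + f2) (a *: g1 + g2).
Proof.
move=> /is_Lp_derivativeP fg1 /is_Lp_derivativeP fg2; apply/is_Lp_derivativeP => phi tphi.
have C1 := test_function_C1 tphi.
rewrite !pairZD; [|exact: C1_continuous C1|exact: C1.2].
by rewrite fg1// fg2// scalerN opprD.
Qed.

(** Derivative and traces are defined by choice; uniqueness of both makes them
    linear. *)
Lemma W1pZD (a : C) f1 f2 : W1p f1 -> W1p f2 ->
  [/\ W1p (a *: f1 + f2),
      Lp_derivative (a *: f1 + f2) = a *: Lp_derivative f1 + Lp_derivative f2 &
      forall s, 0 <= s <= 1 ->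
        continuous_repr (a *: f1 + f2) s = a *: continuous_repr f1 s + continuous_repr f2 s].
Proof.
move=> W1 W2; have D := is_Lp_derivativeZD a (Lp_derivativeP W1) (Lp_derivativeP W2).
split; [by exists (a *: Lp_derivative f1 + Lp_derivative f2)|exact: Lp_derivative_unique|].
have [c1 r1] := continuous_reprP W1; have [c2 r2] := continuous_reprP W2.
apply: continuous_repr_unique.
  have lin (b c : R) (u v w : R -> R) : {within I01, continuous u} ->
      {within I01, continuous v} -> {within I01, continuous w} ->
      {within I01, continuous (fun s => b * u s + c * v s + w s)}.
    move=> /subspace_continuousP cu /subspace_continuousP cv /subspace_continuousP cw.
    apply/subspace_continuousP => x Ax; apply: cvgD; last exact: cw.
    by apply: cvgD; apply: cvgM; do ?exact: cvg_cst; [exact: cu|exact: cv].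
  move=> k; have [c1R c1I] := c1 k; have [c2R c2I] := c2 k; split.
    rewrite (_ : (fun _ => _) = fun s => complex.Re a * complex.Re (continuous_repr f1 s k 0) +
      (- complex.Im a) * complex.Im (continuous_repr f1 s k 0) + complex.Re (continuous_repr f2 s k 0)).
      exact: lin.
    by apply/funext => s; rewrite !mxE cReD cReM mulNr.
  rewrite (_ : (fun _ => _) = fun s => complex.Re a * complex.Im (continuous_repr f1 s k 0) +
    complex.Im a * complex.Re (continuous_repr f1 s k 0) + complex.Im (continuous_repr f2 s k 0)).
    exact: lin.
  by apply/funext => s; rewrite !mxE cImD cImM.
have := represents_linear a f1 f2; move: r1 r2.
apply: (@filterS3 _ _ (ae_filter_ringOfSetsType mu)) => x H1 H2 H3 Dx.
by rewrite H3// H1// H2.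
Qed.

End Trace.

(** * Families of test functions *)

Section TestFamilies.
Context (R : realType).
Implicit Types (xi f g : R -> R) (h : nat -> R -> R).

Definition compact_in01 xi :=
  exists a b : R, [/\ 0 < a, b < 1 & forall s, s \notin `[a, b] -> xi s = 0].

(** The adjoint of transport through the network, seen from one test function
    [h 0]: [h j] is the weight given to what has crossed [j] vertices. Crossing a
    vertex means integrating (the vertex state [d] obeys [d' = Phi f(0)]), whence
    [h (j + 1)] is an antiderivative of [- h j (. + 1)]; the shift by 1 is the
    time spent on an edge. *)
Record test_family h h' : Prop := TestFamily {
  tf_deriv : forall j, C1_deriv (h j) (h' j);
  tf_step : forall j x, h' j.+1 x = - h j (x + 1);
  tf_supp : compact_in01 (h 0%N);
  tf_out : forall j (x : R), 1 - j%:R <= x -> h j x = 0 }.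

Lemma C1_shift f f' (c : R) : C1_deriv f f' ->
  C1_deriv (fun s => f (s + c)) (fun s => f' (s + c)).
Proof.
move=> [df cf]; split=> x; last first.
  apply: (@continuous_comp _ _ _ (fun s => s + c) f'); last exact: cf.
  by apply: cvgD; [exact: cvg_id|exact: cvg_cst].
rewrite -[f' _]mulr1; apply: (@is_derive1_comp _ f (fun s => s + c)) => //.
rewrite -[X in is_derive _ _ _ X]addr0; apply: is_deriveD.
Qed.

Lemma C1_opp f f' : C1_deriv f f' -> C1_deriv (fun s => - f s) (fun s => - f' s).
Proof.
move=> [df cf]; split=> x; first exact: is_deriveN.
by apply: cvgN; exact: cf.
Qed.

Lemma C1_reflect f f' : C1_deriv f f' -> C1_deriv (fun s => f (- s)) (fun s => - f' (- s)).
Proof.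
move=> [df cf]; split=> x; last first.
  apply: cvgN; apply: (@continuous_comp _ _ _ (fun s => - s) f'); last exact: cf.
  exact: opp_continuous.
rewrite -mulrN1; apply: (@is_derive1_comp _ f (fun s => - s)) => //.
Qed.

Lemma compact_in01_deriv f f' : C1_deriv f f' -> compact_in01 f -> compact_in01 f'.
Proof.
move=> [df _] [a [b [a0 b1 ab]]]; exists a, b; split=> // s sab.
have near0 : \forall y \near s, f y = 0.
  move: sab; rewrite in_itv/= negb_and -!ltNge => /orP[sa|bs].
    near=> y; apply: ab; rewrite in_itv/= negb_and -!ltNge; apply/orP; left.
    by near: y; exact: lt_nbhsl.
  near=> y; apply: ab; rewrite in_itv/= negb_and -!ltNge; apply/orP; right.
  by near: y; exact: lt_nbhsr.
have D0 : is_derive s (1 : R) f 0.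
  apply: (@near_eq_is_derive _ _ _ (cst (0 : R))).
  by near=> y; rewrite (near near0 y).
by rewrite -(@derive_val _ _ _ _ _ _ _ (df s)) (@derive_val _ _ _ _ _ _ _ D0).
Unshelve. all: by end_near. Qed.

Lemma compact_in01_out f : compact_in01 f -> forall x, (x <= 0) || (1 <= x) -> f x = 0.
Proof.
move=> [a [b [a0 b1 ab]]] x x01; apply: ab; rewrite in_itv/= negb_and -!ltNge.
by case/orP: x01 => [x0|x1]; rewrite ?(le_lt_trans x0 a0)// (lt_le_trans b1 x1) orbT.
Qed.

(** Choosing each antiderivative to vanish far to the right: [h j] vanishes on
    [[1 - j, +oo[], so the successive integrals move left by one unit. *)
Lemma iterated_primitive xi : continuous xi -> compact_in01 xi ->
  exists h, [/\ h 0%N = xi, forall j, C1_deriv (h j.+1) (fun x => - h j (x + 1)) &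
    forall j (x : R), 1 - j%:R <= x -> h j x = 0].
Proof.
move=> cxi sxi.
pose P (j : nat) f := continuous f /\ forall x : R, 1 - j%:R <= x -> f x = 0.
have /choice[step stepP] : forall jf : nat * (R -> R), exists f',
    P jf.1 jf.2 -> C1_deriv f' (fun x => - jf.2 (x + 1)) /\ P jf.1.+1 f'.
  move=> [j f] /=; have [[cf f0]|nP] := pselect (P j f); last by exists (fun=> 0).
  have cg : continuous (fun y : R => f (1 - y)).
    move=> y; apply: (@continuous_comp _ _ _ (fun y : R => 1 - y) f); last exact: cf.
    by apply: cvgB; [exact: cvg_cst|exact: cvg_id].
  have [y yj|G C1G G0] := @C1_primitive _ _ j%:R cg; first by apply: f0; lra.
  exists (fun x => G (- x)) => _.
  have D : C1_deriv (fun x => G (- x)) (fun x => - f (x + 1)).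
    have := C1_reflect C1G; congr C1_deriv; apply/funext => x.
    by rewrite opprK addrC.
  split=> //; split; first exact: C1_continuous D.
  by move=> x xj; apply: G0; rewrite -natr1 in xj; lra.
pose h := fix h j := if j is j'.+1 then step (j', h j') else xi.
have hP j : P j (h j).
  elim: j => [|j IH] /=; last exact: (stepP (j, h j) IH).2.
  split=> // x; rewrite subr0 => x1; apply: compact_in01_out => //.
  by rewrite x1 orbT.
exists h; split => // j; first exact: (stepP (j, h j) (hP j)).1.
exact: (hP j).2.
Qed.

(** The derivatives of a family [h] are prescribed by [h] itself beyond index 0;
    only the first one, [xi], is free. *)
Definition next_family xi h : nat -> R -> R :=
  fun j => if j is j'.+1 then fun x => - h j' (x + 1) else xi.

Lemma test_family_next h h' f' : test_family h h' -> C1_deriv (h' 0%N) f' ->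
  test_family h' (next_family f' h').
Proof.
move=> [dh step supp out] C1f'.
have h'S j : h' j.+1 = (fun x => - h j (x + 1)) by apply/funext => x; exact: step.
split=> //.
- by case=> [//|j]; rewrite h'S; apply: C1_opp; exact: C1_shift (dh j).
- exact: compact_in01_deriv (dh 0%N) supp.
- case=> [|j] x xj; last by rewrite step out ?oppr0//; rewrite -natr1 in xj; lra.
  rewrite subr0 in xj; apply: compact_in01_out; last by rewrite xj orbT.
  exact: compact_in01_deriv (dh 0%N) supp.
Qed.

Lemma test_family_exists xi xi1 : C1_deriv xi xi1 -> compact_in01 xi ->
  exists h h', [/\ test_family h h', h 0%N = xi & h' 0%N = xi1].
Proof.
move=> C1xi sxi; have [h [h0 dh hout]] := iterated_primitive (C1_continuous C1xi) sxi.
exists h, (next_family xi1 h); split => //; split=> //; last by rewrite h0.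
by case=> [|j] /=; [rewrite h0|exact: dh].
Qed.

(** Two applications of the mean value theorem; the constant is a bound of the
    second derivative on [[a, b + 1]]. *)
Lemma taylor_bound f f' f'' (a b : R) : C1_deriv f f' -> C1_deriv f' f'' ->
  exists2 M : R, 0 < M & forall x d, a <= x <= b -> 0 <= d <= 1 ->
    `|f (x + d) - f x - d * f' x| <= M * d ^+ 2.
Proof.
move=> [df cf'] [df' cf''].
have [M M0 hM] := continuous_bounded_itv a (b + 1) cf''.
exists M => // x d /andP[ax xb] /andP[]; rewrite le_eqVlt => /predU1P[<- _|d0 d1].
  by rewrite addr0 subrr mul0r subrr normr0 expr0n mulr0.
have mvt g g' y : (forall x : R, is_derive x (1 : R) g (g' x)) -> x < y ->
    exists2 c, x < c < y & g y - g x = g' c * (y - x).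
  move=> dg xy; have cg : {within `[x, y], continuous g}.
    by apply: continuous_subspaceT; exact: is_derive_continuous dg.
  have [c] := MVT xy (fun z _ => dg z) cg.
  by rewrite in_itv/=; exists c.
have xd : x < x + d by rewrite ltrDl.
have [c /andP[xc cd] ->] := mvt f f' _ df xd.
have [e /andP[xe ec]] := mvt f' f'' _ df' xc.
rewrite addrAC subrr add0r [d * _]mulrC -mulrBl => ->.
rewrite !normrM (gtr0_norm d0) expr2 mulrA ler_pM2r// ler_pM//.
  by apply: hM; apply/andP; split; lra.
by rewrite ger0_norm; lra.
Qed.

End TestFamilies.

(** * The adjoint functionals of the network *)

Section RealNorm.
Context (R : realType).
Local Notation C := R[i].

Lemma normc_le_mx n (z : 'cV[C]_n) k : `|z k 0| <= `|z|.
Proof.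
rewrite [`|z|]mx_normE -[leLHS]nngE num_le.
exact: (@le_bigmax _ _ _ _ (fun i : 'I_n * 'I_1 => `|z i.1 i.2|%:nng) (k, 0)).
Qed.

(** The norm of a normed module over [R[i]] is itself an element of [R[i]]. *)
Definition rnorm (X : normedModType C) (x : X) : R := complex.Re `|x|.

Lemma rnormE (X : normedModType C) (x : X) : `|x| = (rnorm x)%:C%C.
Proof.
have : 0 <= `|x| by [].
by rewrite lecE /rnorm /= => /andP[/eqP im _]; apply/eqP; rewrite eq_complex/= eqxx im eqxx.
Qed.

Lemma rnorm_ge0 (X : normedModType C) (x : X) : 0 <= rnorm x.
Proof. by rewrite -lecR -rnormE normr_ge0. Qed.

Lemma rnormD (X : normedModType C) (x y : X) : rnorm (x + y) <= rnorm x + rnorm y.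
Proof. by rewrite -lecR rmorphD/= -!rnormE ler_normD. Qed.

Lemma rnormZ (X : normedModType C) (a : C) (x : X) : rnorm (a *: x) = Normc.normc a * rnorm x.
Proof.
have := normrZ a x; rewrite !rnormE.
have -> : `|a| = (Normc.normc a)%:C%C by case: a.
by rewrite -rmorphM => /(congr1 (@complex.Re R)).
Qed.

Lemma normc_real (r : R) : Normc.normc r%:C%C = `|r|.
Proof. by rewrite /= expr0n addr0 sqrtr_sqr. Qed.

Lemma rnorm_prod1 (X Y : normedModType C) (x : X * Y) : rnorm x.1 <= rnorm x.
Proof.
rewrite -lecR -!rnormE prod_normE comparable_le_max ?lexx//.
by apply: real_comparable; exact: normr_real.
Qed.

Lemma rnorm_prod2 (X Y : normedModType C) (x : X * Y) : rnorm x.2 <= rnorm x.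
Proof.
rewrite -lecR -!rnormE prod_normE comparable_le_max ?lexx ?orbT//.
by apply: real_comparable; exact: normr_real.
Qed.

Lemma normc_le_rnorm n (z : 'cV[C]_n) k : Normc.normc (z k 0) <= rnorm z.
Proof.
by rewrite -lecR -rnormE (le_trans _ (normc_le_mx z k)).
Qed.

Lemma vnorm_le_rnorm n (z : 'cV[C]_n) : vnorm z <= n%:R * rnorm z.
Proof.
rewrite /vnorm -[n in n%:R]card_ord mulr_natl -sumr_const.
by apply: ler_sum => k _; exact: normc_le_rnorm.
Qed.

Lemma vnorm_mulmx n k (A : 'M[C]_(n, k)) : exists2 K : R, 0 <= K &
  forall z : 'cV[C]_k, vnorm (A *m z) <= K * vnorm z.
Proof.
pose K := \sum_i \sum_j Normc.normc (A i j).
have nc0 (z : C) : 0 <= Normc.normc z by rewrite Defs.normcE sqrtr_ge0.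
exists K; first by do 2!apply: sumr_ge0 => ? _.
move=> z; rewrite /vnorm /K mulr_suml; apply: ler_sum => i _.
have ncsum (I : Type) (r : seq I) (F : I -> C) :
    Normc.normc (\sum_(j <- r) F j) <= \sum_(j <- r) Normc.normc (F j).
  elim/big_ind2 : _ => // [|x1 x2 y1 y2 h1 h2]; first by rewrite Normc.normc0.
  by apply: le_trans (lerD h1 h2); exact: le_normcD.
rewrite mxE (le_trans (ncsum _ _ _))// mulr_suml; apply: ler_sum => j _.
rewrite Normc.normcM ler_wpM2l//.
by rewrite (bigD1 j)//= lerDl sumr_ge0.
Qed.

Lemma vnorm0 n : vnorm (0 : 'cV[C]_n) = 0.
Proof. by rewrite /vnorm big1// => k _; rewrite mxE Normc.normc0. Qed.

Lemma vnorm_sum n (I : Type) (r : seq I) (F : I -> 'cV[C]_n) :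
  vnorm (\sum_(j <- r) F j) <= \sum_(j <- r) vnorm (F j).
Proof.
elim/big_ind2 : _ => // [|x1 x2 y1 y2 h1 h2]; first by rewrite vnorm0.
by apply: le_trans (lerD h1 h2); exact: vnormD.
Qed.

Lemma vnormN k (z : 'cV[C]_k) : vnorm (- z) = vnorm z.
Proof. by rewrite -scaleN1r vnormZ -(rmorphN1 (real_complex R)) normc_real normrN1 mul1r. Qed.

Lemma rnormN (Y : normedModType C) (x : Y) : rnorm (- x) = rnorm x.
Proof. by rewrite -scaleN1r rnormZ -(rmorphN1 (real_complex R)) normc_real normrN1 mul1r. Qed.

End RealNorm.

Section AdjointFunctional.
Context (R : realType) (p : R) (p1 : 1 <= p) (n m : nat) (N : network R n m).
Local Notation C := R[i].
Local Notation X := (state n m p1).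
Implicit Types (x y : X) (a : nat -> R -> R) (b : nat -> R) (h : nat -> R -> R).

(** The common shape of all functionals below: an edge part tested against the
    weights [a j] and a vertex part with coefficients [b j], both taken after [j]
    passages through the network. *)
Definition adjoint_form (J : nat) a b x : 'cV[C]_m :=
  \sum_(j < J) (adjB N ^+ j *m pair x.1 (a j)) +
  \sum_(j < J) ((b j)%:C%C *: (adjB N ^+ j *m (Psi N *m x.2))).

Lemma adjoint_formZD J a b (c : C) x y : (forall j, continuous (a j)) ->
  adjoint_form J a b (c *: x + y) = c *: adjoint_form J a b x + adjoint_form J a b y.
Proof.
move=> ca; rewrite /adjoint_form scalerDr [RHS]addrACA !scaler_sumr -!big_split /=.
apply: eq_bigr => j _; congr (_ + _).
  by rewrite pairZD// mulmxDr -scalemxAr.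
by rewrite !mulmxDr -!scalemxAr scalerDr !scalerA mulrC.
Qed.

Lemma adjoint_formB J a b x y : (forall j, continuous (a j)) ->
  adjoint_form J a b (x - y) = adjoint_form J a b x - adjoint_form J a b y.
Proof.
by move=> ca; rewrite addrC -scaleN1r adjoint_formZD// scaleN1r addrC.
Qed.

Lemma adjoint_formZ J a b (c : C) x : (forall j, continuous (a j)) ->
  adjoint_form J a b (c *: x) = c *: adjoint_form J a b x.
Proof.
move=> ca; have -> : c *: x = (c - 1) *: x + x by rewrite scalerBl scale1r subrK.
by rewrite adjoint_formZD// scalerBl scale1r subrK.
Qed.

Lemma adjoint_formDl J a b a' b' (c : R) x : (forall j, continuous (a j)) ->
  (forall j, continuous (a' j)) ->
  adjoint_form J (fun j s => c * a j s + a' j s) (fun j => c * b j + b' j) x =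
  c%:C%C *: adjoint_form J a b x + adjoint_form J a' b' x.
Proof.
move=> ca ca'; rewrite /adjoint_form scalerDr [RHS]addrACA !scaler_sumr -!big_split /=.
apply: eq_bigr => j _; congr (_ + _).
  rewrite /pair pairingDr//; last exact: Lp_fun_integrable.
  by rewrite mulmxDr -scalemxAr.
by rewrite rmorphD rmorphM/= scalerDl scalerA.
Qed.

(** The constant depends on the network and on [J] only, not on the weights:
    Taylor remainders of the weights become small remainders of the form. *)
Lemma adjoint_form_bound J : exists2 K : R, 0 <= K & forall a b x (M : R),
  (forall j, continuous (a j)) ->
  (forall j, (j < J)%N -> forall s, 0 <= s <= 1 -> `|a j s| <= M) ->
  (forall j, (j < J)%N -> `|b j| <= M) ->
  vnorm (adjoint_form J a b x) <= K * M * rnorm x.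
Proof.
have /choice[K1 K1P] : forall j, exists K : R, 0 <= K /\
    forall z : 'cV[C]_m, vnorm (adjB N ^+ j *m z) <= K * vnorm z.
  by move=> j; have [K K0 KP] := vnorm_mulmx (adjB N ^+ j); exists K.
have [K2 K20 K2P] := vnorm_mulmx (Psi N).
exists (\sum_(j < J) K1 j * (4 * m%:R) + \sum_(j < J) K1 j * (K2 * n%:R)).
  by apply: addr_ge0; apply: sumr_ge0 => j _; rewrite !mulr_ge0//; exact: (K1P j).1.
move=> a b x M ca aM bM; rewrite /adjoint_form.
have x1 : Lp_vec_norm p (Lp_fun x.1) <= rnorm x by exact: (rnorm_prod1 x).
have x2 : vnorm x.2 <= n%:R * rnorm x.
  by rewrite (le_trans (vnorm_le_rnorm _))// ler_wpM2l//; exact: (rnorm_prod2 x).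
apply: (le_trans (vnormD _ _)); rewrite 2!mulrDl; apply: lerD.
  apply: (le_trans (vnorm_sum _ _)); rewrite -mulrA mulr_suml; apply: ler_sum => j _.
  have M0 : 0 <= M by rewrite (le_trans _ (bM j (ltn_ord j))).
  apply: (le_trans ((K1P j).2 _)); rewrite -!mulrA ler_wpM2l ?(K1P j).1//.
  apply: (le_trans (vnorm_pair_le _ (ca j) (aM j (ltn_ord j)))).
  by rewrite -!mulrA !ler_wpM2l.
apply: (le_trans (vnorm_sum _ _)); rewrite -mulrA mulr_suml; apply: ler_sum => j _.
have M0 : 0 <= M by rewrite (le_trans _ (bM j (ltn_ord j))).
rewrite vnormZ normc_real.
have -> : K1 j * (K2 * n%:R) * (M * rnorm x) = M * (K1 j * (K2 * (n%:R * rnorm x))) by ring.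
apply: ler_pM => //; [exact: vnorm_ge0|exact: bM|].
apply: (le_trans ((K1P j).2 _)); rewrite ler_wpM2l ?(K1P j).1//.
by apply: (le_trans (K2P _)); rewrite ler_wpM2l.
Qed.

(** What the test function [h 0] sees at time [r] of the solution that starts at
    [x], as long as [J] is at least [r + 1]. *)
Definition adjoint_orbit (J : nat) h (r : R) x : 'cV[C]_m :=
  adjoint_form J (fun j s => h j (s - r)) (fun j => h j.+1 (- r)) x.

(** Green's identity. Integrating by parts on the edges leaves boundary terms at
    0 and 1. Those at 0 of order [j + 1] cancel the vertex terms of [Am x] of order
    [j]: the sum telescopes, and its two ends vanish because [h 0] is supported in
    [`]0, 1[] and [h J] vanishes on [[1 - J, +oo[]. Those at 1 combine with the
    vertex terms of [h'], as [h' (j + 1) = - h j (. + 1)], into the defect of the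
    boundary condition at 1. *)
Lemma adjoint_orbit_Am J h h' r x : test_family h h' -> domain (Am N p1) x ->
  0 <= r -> r + 1 <= J%:R ->
  adjoint_orbit J h r (Am N p1 x) + adjoint_orbit J h' r x =
  \sum_(j < J) ((h j (1 - r))%:C%C *:
    (adjB N ^+ j *m (continuous_repr x.1 1 - Psi N *m x.2))).
Proof.
move=> [dh step supp out] [W _] r0 rJ; rewrite /adjoint_orbit /adjoint_form /=.
set phi := continuous_repr x.1; set B := adjB N.
pose T j : 'cV[C]_m := (h j (- r))%:C%C *: (B ^+ j *m phi 0).
have tele : \sum_(j < J) (T j.+1 - T j) = 0.
  rewrite -(big_mkord xpredT (fun j => T j.+1 - T j)) telescope_sumr// /T.
  rewrite out; last by lra.
  rewrite (compact_in01_out supp); last by rewrite oppr_le0 r0.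
  by rewrite !scale0r subrr.
rewrite -[RHS]addr0 -[X in _ = _ + X]tele -!big_split /=; apply: eq_bigr => j _.
have C1h := C1_shift (- r) (dh j).
have pp := pair_parts W C1h; rewrite add0r in pp.
have -> : pair x.1 (fun s => h' j (s - r)) = (h j (1 - r))%:C%C *: phi 1 -
    (h j (- r))%:C%C *: phi 0 - pair (Lp_derivative x.1) (fun s => h j (s - r)).
  by rewrite pp; rewrite opprB addrC subrK.
rewrite step [- r + 1]addrC.
have BP : B ^+ j *m (Psi N *m (Phi_plus N *m phi 0)) = B ^+ j.+1 *m phi 0.
  by rewrite exprSr -[RHS]mulmxA; congr (_ *m _); rewrite mulmxA.
rewrite BP /T !mulmxBr -!scalemxAr raddfN/= scaleNr scalerBr.
set u := B ^+ j *m pair _ _; set v := _ *: (B ^+ j *m phi 1).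
set w := _ *: (B ^+ j *m phi 0); set z := _ *: (B ^+ j.+1 *m _).
set q := _ *: (B ^+ j *m (_ *m x.2)).
move: u v w z q => u v w z q.
by apply/colP => k; rewrite !mxE; ring.
Qed.

End AdjointFunctional.

(** * Orbits of semigroups *)

Section OneSided.
Context (R : realType).

(** A continuity induction: the set of [s] up to which [v <= e * .] holds is
    closed by the bound from the left and is extended by the bound from the right.
    It replaces the mean value theorem for functions with a right derivative
    only. *)
Lemma one_sided_bound (v : R -> R) (r e : R) : 0 <= r -> v 0 = 0 -> 0 < e ->
  (forall s, 0 <= s < r -> exists2 d0 : R, 0 < d0 &
     forall d, 0 < d < d0 -> v (s + d) <= v s + e * d) ->
  (forall s (eta : R), 0 < s <= r -> 0 < eta -> exists2 d0 : R, 0 < d0 &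
     forall d, 0 < d < d0 -> d <= s -> v s <= v (s - d) + eta) ->
  v r <= e * r.
Proof.
move=> r0 v0 e0 right left.
pose S := [set s | 0 <= s <= r /\ forall s', 0 <= s' <= s -> v s' <= e * s'].
have S0 : S 0.
  split; first by rewrite lexx.
  by move=> s' /le_anti <-; rewrite v0 mulr0.
have hS : has_sup S by split; [exists 0|exists r => s [/andP[]]].
set sg := sup S.
have sg0 : 0 <= sg by apply: ub_le_sup => //; exact: hS.2.
have sgr : sg <= r by apply: ge_sup => // [|s [/andP[]]]; first by exists 0.
have vlt s' : 0 <= s' < sg -> v s' <= e * s'.
  move=> /andP[s'0 s'sg]; have [s [_ Ss] s's] := sup_gt (conj hS.1 hS.2).1 s'sg.
  by apply: Ss; rewrite s'0 ltW.
have vsg : v sg <= e * sg.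
  move: sg0; rewrite le_eqVlt => /predU1P[<-|sg0]; first by rewrite v0 mulr0.
  apply/ler_addgt0Pr => eta eta0.
  have [d0 d00 dP] := left sg eta (introT andP (conj sg0 sgr)) eta0.
  pose d := Num.min (d0 / 2) (sg / 2).
  have dd0 : 0 < d < d0 by rewrite /d lt_min gt_min; apply/andP; split; [apply/andP; split; lra|apply/orP; left; lra].
  have dsg : d <= sg / 2 by rewrite /d ge_min lexx orbT.
  have := dP d dd0; move/andP : dd0 => [d0' _].
  move=> /(_ _)/le_trans -> //; first by lra.
  rewrite lerD2r; apply: (le_trans (vlt _ _)); first by apply/andP; split; lra.
  by rewrite ler_pM2l//; lra.
have Ssg : S sg.
  split; first by rewrite sg0.
  move=> s' /andP[s'0]; rewrite le_eqVlt => /predU1P[->//|s'sg].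
  by apply: vlt; rewrite s'0.
move: sgr; rewrite le_eqVlt => /predU1P[<-//|sgr].
have [d0 d00 dP] := right sg (introT andP (conj sg0 sgr)).
pose d := Num.min (d0 / 2) (r - sg).
have dpos : 0 < d by rewrite /d lt_min; apply/andP; split; lra.
have dd0 : d < d0 by rewrite /d gt_min; apply/orP; left; lra.
have : S (sg + d).
  split.
    rewrite addr_ge0 ?(ltW dpos)//=; have : d <= r - sg by rewrite /d ge_min lexx orbT.
    by lra.
  move=> s' /andP[s'0 s'd]; have [s'sg|sgs'] := leP s' sg.
    by apply: Ssg.2; rewrite s'0.
  have -> : s' = sg + (s' - sg) by rewrite addrC subrK.
  apply: (le_trans (dP _ _)); first by apply/andP; split; lra.
  by rewrite [leRHS]mulrDr lerD2r.
move=> /(ub_le_sup hS.2); rewrite -/sg => h; exfalso; lra.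
Qed.

End OneSided.

Section SemigroupOrbits.
Context (R : realType).
Local Notation C := R[i].
Context (X : normedModType C) (A : operator X) (T : R -> X -> X).
Context (genT : generates A T).
Implicit Types (x y : X).

Lemma gt0_complex_real (e : C) : 0 < e -> 0 < complex.Re e /\ e = (complex.Re e)%:C%C.
Proof.
rewrite ltcE /= => /andP[/eqP im e0]; split=> //.
by apply/eqP; rewrite eq_complex /= eqxx im eqxx.
Qed.

Lemma quotient_rnorm x y (d : R) : 0 < d ->
  rnorm (T d x - x - d%:C%C *: y) = d * rnorm (y - (d^-1)%:C%C *: (T d x - x)).
Proof.
move=> d0.
have -> : T d x - x - d%:C%C *: y = (- d%:C%C) *: (y - (d^-1)%:C%C *: (T d x - x)).
  rewrite [RHS]scalerBr !scaleNr scalerA -rmorphM/= mulfV ?gt_eqF// scale1r.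
  by rewrite opprK addrC.
by rewrite rnormZ -rmorphN normc_real normrN gtr0_norm.
Qed.

(** The limit in [generates] as an estimate in real numbers. *)
Lemma generatorP x y : domain A x /\ A x = y <-> forall eps : R, 0 < eps ->
  exists2 d0 : R, 0 < d0 & forall d, 0 < d < d0 -> rnorm (T d x - x - d%:C%C *: y) <= eps * d.
Proof.
split=> [/(genT.2 x y) + eps eps0|H]; last first.
  apply/(genT.2 x y)/cvgrPdist_le => e e0; have [re0 ->] := gt0_complex_real e0.
  have [d0 d00 dP] := H _ re0.
  rewrite near_withinE; near=> d => d1.
  have dd0 : 0 < d < d0 by rewrite d1/=; near: d; exact: lt_nbhsl.
  have := dP d dd0; rewrite quotient_rnorm// [_ * d]mulrC ler_pM2l//.
  by rewrite rnormE lecR.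
have e0 : 0 < eps%:C%C :> C by rewrite ltcR.
move=> /cvgrPdist_lt/(_ _ e0).
rewrite near_withinE => /nbhs_ballP[d0 /= d00 dP].
exists d0 => // d /andP[d1 d2].
have : `|y - (d^-1)%:C%C *: (T d x - x)| < eps%:C%C.
  by apply: dP => //; rewrite /ball/= sub0r normrN gtr0_norm.
rewrite quotient_rnorm// [_ * d]mulrC ler_pM2l// rnormE ltcR; exact: ltW.
Unshelve. all: by end_near. Qed.

Lemma semigroupB s x y : 0 <= s -> T s (x - y) = T s x - T s y.
Proof.
move=> s0; have lin := C0_linear genT.1 s0.
by rewrite addrC -scaleN1r lin scaleN1r addrC.
Qed.

Lemma semigroupZ s (a : C) x : 0 <= s -> T s (a *: x) = a *: T s x.
Proof.
move=> s0; have lin := C0_linear genT.1 s0.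
have T00 : T s 0 = 0 by have := semigroupB 0 0 s0; rewrite !subrr.
by have := lin a x 0; rewrite T00 !addr0.
Qed.

Lemma semigroup_bound s : 0 <= s -> exists2 M : R, 0 < M & forall x, rnorm (T s x) <= M * rnorm x.
Proof.
move=> s0; have [M MP] := C0_bounded genT.1 s0; exists (`|M| + 1); first by rewrite ltr_wpDl.
move=> x; have := MP x; rewrite !rnormE -rmorphM/= lecR => /le_trans; apply.
by rewrite ler_wpM2r ?rnorm_ge0// (le_trans (ler_norm _))// lerDl.
Qed.

Lemma semigroup_swap s d x : 0 <= s -> 0 <= d -> T d (T s x) = T s (T d x).
Proof.
by move=> s0 d0; rewrite -(C0_D genT.1 _ d0 s0) addrC (C0_D genT.1 _ s0 d0).
Qed.

(** [T s] commutes with difference quotients and is bounded. *)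
Lemma orbit_domain s x : 0 <= s -> domain A x ->
  domain A (T s x) /\ A (T s x) = T s (A x).
Proof.
move=> s0 dx; apply/generatorP => eps eps0.
have [M M0 MP] := semigroup_bound s0.
have [d0 d00 dP] := (generatorP x (A x)).1 (conj dx erefl) _ (divr_gt0 eps0 M0).
exists d0 => // d /[dup] dd /dP; move/andP: dd => [dpos _] H.
rewrite semigroup_swap ?(ltW dpos)// -semigroupZ// -!semigroupB//; apply: (le_trans (MP _)).
have -> : eps * d = M * (eps / M * d) by field; rewrite gt_eqF.
by rewrite ler_pM2l.
Qed.

Lemma orbit_right_deriv s x : 0 <= s -> domain A x ->
  forall eps : R, 0 < eps -> exists2 d0 : R, 0 < d0 & forall d, 0 < d < d0 ->
  rnorm (T (s + d) x - T s x - d%:C%C *: A (T s x)) <= eps * d.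
Proof.
move=> s0 dx eps eps0; have [dT _] := orbit_domain s0 dx.
have [d0 d00 dP] := (generatorP (T s x) (A (T s x))).1 (conj dT erefl) _ eps0.
exists d0 => // d dd; have /andP[dpos _] := dd.
by rewrite [s + d]addrC (C0_D genT.1 _ (ltW dpos) s0); exact: dP.
Qed.

Lemma orbit_continuous x s : 0 <= s -> forall eps : R, 0 < eps ->
  exists2 d0 : R, 0 < d0 & forall s', 0 <= s' -> `|s' - s| < d0 -> rnorm (T s' x - T s x) <= eps.
Proof.
move=> s0 eps eps0; have /subspace_continuousP/(_ s) := C0_continuous genT.1 (x := x).
have e0 : 0 < eps%:C%C :> C by rewrite ltcR.
rewrite /= in_itv/= s0 => /(_ isT)/cvgrPdist_lt/(_ _ e0).
rewrite near_withinE => /nbhs_ballP[d0 /= d00 dP]; exists d0 => // s' s'0 ss'.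
have : `|T s x - T s' x| < eps%:C%C.
  by apply: dP; rewrite /ball/= ?in_itv/= ?s'0// distrC.
by rewrite distrC rnormE ltcR => /ltW.
Qed.

End SemigroupOrbits.

(** * Duality along orbits *)

(** An abstract form of duality between a semigroup and a family of functionals
    [E0 rho] evolving backwards in time: [E1 rho] is the negative of the
    derivative of [E0] in [rho], [rem] is the Taylor remainder, and [E0_A] states
    that [E0] solves the adjoint equation. *)
Section OrbitTransport.
Context (R : realType).
Local Notation C := R[i].

Context (X : normedModType C) (A : operator X) (T : R -> X -> X) (m : nat).
Context (genT : generates A T).
Context (r kap : R) (E0 E1 : R -> X -> 'cV[C]_m) (rem : R -> R -> X -> 'cV[C]_m).
Context (r0 : 0 <= r) (kap0 : 0 < kap).
Context (E0B : forall rho x y, E0 rho (x - y) = E0 rho x - E0 rho y).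
Context (E0Z : forall rho (a : C) x, E0 rho (a *: x) = a *: E0 rho x).
Context (E1B : forall rho x y, E1 rho (x - y) = E1 rho x - E1 rho y).
Context (E0_bound : forall rho y, 0 <= rho <= r -> vnorm (E0 rho y) <= kap * rnorm y).
Context (E1_bound : forall rho y, 0 <= rho <= r -> vnorm (E1 rho y) <= kap * rnorm y).
Context (E0_expand : forall rho d y,
  E0 (rho - d) y = E0 rho y + d%:C%C *: E1 rho y + rem rho d y).
Context (rem_bound : forall rho d y, 0 <= rho <= r -> 0 <= d <= 1 ->
  vnorm (rem rho d y) <= kap * d ^+ 2 * rnorm y).
Context (E0_A : forall q rho, domain A q -> 0 <= rho <= r ->
  E0 rho (A q) + E1 rho q = 0).

(** The function [s |-> E0 (r - s) (T s x)] has right derivative 0 on [[0, r[],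
    because the motion of [T s x] and that of [E0 (r - s)] cancel by [E0_A]. It is
    therefore constant by [one_sided_bound]. *)
Lemma orbit_transport x : domain A x -> E0 0 (T r x) = E0 r x.
Proof.
have r0' := r0; have kap0' := kap0; move=> dx; pose G s := E0 (r - s) (T s x).
suff GE : G r = G 0 by move: GE; rewrite /G subrr subr0 (C0_0 genT.1).
pose v s := vnorm (G s - G 0).
have vnormB (a b : 'cV[C]_m) : vnorm (a - b) <= vnorm a + vnorm b.
  by apply: (le_trans (vnormD _ _)); rewrite vnormN.
suff vle e : 0 < e -> v r <= e * r.
  have v0 : v r <= 0.
    apply/ler_addgt0Pr => e e0; rewrite add0r.
    have r1 : 0 < r + 1 by lra.
    apply: (le_trans (vle (e / (r + 1)) (divr_gt0 e0 r1))).
    by rewrite mulrAC ler_pdivrMr// ler_pM2l//; lra.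
  by apply/eqP; rewrite -subr_eq0; apply/eqP/vnorm_eq0/le_anti; rewrite v0 vnorm_ge0.
move=> e0; apply: one_sided_bound => //.
- by rewrite /v subrr vnorm0.
- move=> s /andP[s0 sr]; pose q := T s x; pose rho := r - s.
  have rhor : 0 <= rho <= r by rewrite /rho; apply/andP; split; lra.
  have q1 : 0 < rnorm q + 1 by rewrite ltr_wpDl// rnorm_ge0.
  pose e1 := Num.min 1 (e / (4 * kap)).
  have ke : 0 < e / (4 * kap) by rewrite divr_gt0// mulr_gt0.
  have e10 : 0 < e1 by rewrite lt_min ltr01.
  have e1e : kap * e1 <= e / 4.
    have -> : e / 4 = kap * (e / (4 * kap)) by field; rewrite gt_eqF.
    by rewrite ler_pM2l// ge_min lexx orbT.
  have e11 : e1 <= 1 by rewrite ge_min lexx.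
  have [d0 d00 d0P] := orbit_right_deriv genT s0 dx e10.
  have [d1 d10 d1P] := orbit_continuous genT x s0 e10.
  pose d2 := e / (4 * kap * (rnorm q + 1)).
  have d20 : 0 < d2 by rewrite divr_gt0// !mulr_gt0.
  exists (Num.min (Num.min d0 d1) (Num.min 1 d2)).
    by rewrite !lt_min d00 d10 ltr01 d20.
  move=> d /andP[dpos]; rewrite !lt_min => /andP[/andP[dd0 dd1] /andP[d11 dd2]].
  set T' := T (s + d) x.
  have H1 : rnorm (T' - q - d%:C%C *: A q) <= e1 * d by apply: d0P; rewrite dpos.
  have H2 : rnorm (T' - q) <= e1.
    by apply: d1P; [lra|rewrite addrAC subrr add0r gtr0_norm].
  have H3 : rnorm T' <= rnorm q + 1.
    have -> : T' = (T' - q) + q by rewrite subrK.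
    by apply: (le_trans (rnormD _ _)); lra.
  have [dq _] := orbit_domain genT s0 dx.
  have adj := @E0_A _ rho dq rhor.
  (* Three errors, each at most [d * e / 4]: the difference quotient of the
     orbit, the change of the orbit seen by [E1], and the Taylor remainder. *)
  have dec : G (s + d) - G s = E0 rho (T' - q - d%:C%C *: A q) +
      d%:C%C *: E1 rho (T' - q) + rem rho d T'.
    rewrite /G opprD addrA -/rho -/q -/T' E0_expand.
    have -> : E0 rho (T' - q - d%:C%C *: A q) =
        E0 rho T' - E0 rho q
        - d%:C%C *: E0 rho (A q).
      by rewrite !E0B E0Z.
    have -> : E1 rho (T' - q) = E1 rho T' - E1 rho q.
      by rewrite E1B.
    have -> : E0 rho (A q) = - E1 rho q.
      by apply/eqP; rewrite -addr_eq0; apply/eqP; exact: adj.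
    move: (E0 rho T') (E0 rho q)
      (E1 rho T') (E1 rho q) (rem rho d T') => u1 u2 u3 u4 u5.
    by apply/colP => k; rewrite !mxE; ring.
  have -> : v (s + d) = vnorm ((G s - G 0) + (G (s + d) - G s)).
    by rewrite /v [X in _ = vnorm X]addrC addrA subrK.
  apply: (le_trans (vnormD _ _)); rewrite -/(v s) lerD2l dec.
  apply: (le_trans (vnormD _ _)).
  have B1 := le_trans (@E0_bound rho (T' - q - d%:C%C *: A q) rhor) (ler_wpM2l (ltW kap0) H1).
  have B2 := le_trans (@E1_bound rho (T' - q) rhor) (ler_wpM2l (ltW kap0) H2).
  have B3 : vnorm (rem rho d T') <= d * (e / 4).
    have d01 : 0 <= d <= 1 by apply/andP; split; lra.
    apply: (le_trans (@rem_bound rho d T' rhor d01)); rewrite expr2 -mulrA mulrCA -!mulrA ler_pM2l//.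
    have -> : e / 4 = kap * (d2 * (rnorm q + 1)).
      rewrite /d2; field.
      by rewrite !gt_eqF.
    rewrite mulrCA ler_pM2l//; apply: ler_pM => //; [exact: ltW|exact: rnorm_ge0|exact: ltW].
  have B4 : vnorm (E0 rho (T' - q - d%:C%C *: A q) +
      d%:C%C *: E1 rho (T' - q)) <= d * (e / 4) + d * (e / 4).
    apply: (le_trans (vnormD _ _)); apply: lerD.
      have -> : d * (e / 4) = e / 4 * d by rewrite mulrC.
      by apply: (le_trans B1); rewrite mulrA ler_pM2r.
    rewrite vnormZ normc_real gtr0_norm// ler_pM2l//.
    exact: le_trans B2 e1e.
  apply: (le_trans (lerD B4 B3)).
  have -> : d * (e / 4) + d * (e / 4) + d * (e / 4) = (3 / 4) * (e * d) by field.
  by have : 0 < e * d by [rewrite mulr_gt0]; lra.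
- move=> s eta /andP[s0 sr] eta0; pose q := T s x; pose rho := r - s.
  have q1 : 0 < rnorm q + 1 by rewrite ltr_wpDl// rnorm_ge0.
  pose e1 := eta / (4 * kap).
  have e10 : 0 < e1 by rewrite divr_gt0// mulr_gt0.
  have e1e : kap * e1 = eta / 4 by rewrite /e1; field; rewrite gt_eqF.
  have [d1 d10 d1P] := orbit_continuous genT x (ltW s0) e10.
  pose d2 := eta / (4 * kap * (rnorm q + 1)).
  have d20 : 0 < d2 by rewrite divr_gt0// !mulr_gt0.
  exists (Num.min d1 (Num.min 1 d2)); first by rewrite !lt_min d10 ltr01 d20.
  move=> d /andP[dpos]; rewrite !lt_min => /andP[dd1 /andP[d11 dd2]] ds.
  pose rho' := rho + d.
  have rhor : 0 <= rho' <= r by rewrite /rho' /rho; apply/andP; split; lra.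
  set T' := T (s - d) x.
  have H2 : rnorm (q - T') <= e1.
    have -> : rnorm (q - T') = rnorm (T' - q).
      by rewrite -[q - T']opprB rnormN.
    by apply: d1P; [lra|rewrite addrAC subrr add0r normrN gtr0_norm].
  have dec : G s - G (s - d) = E0 rho' (q - T') +
      d%:C%C *: E1 rho' q + rem rho' d q.
    have er : rho' = r - (s - d) by rewrite /rho' /rho opprB addrA addrAC.
    have er' : r - s = rho' - d by rewrite /rho' addrK.
    rewrite /G -er er' -/q -/T' (E0_expand rho' d q) (E0B rho' q T').
    move: (E0 rho' q) (E1 rho' q) (rem rho' d q) (E0 rho' T') => w1 w2 w3 w4.
    by apply/colP => k; rewrite !mxE; ring.
  have -> : v s = vnorm ((G (s - d) - G 0) + (G s - G (s - d))).
    by rewrite /v [X in _ = vnorm X]addrC addrA subrK.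
  apply: (le_trans (vnormD _ _)); rewrite -/(v (s - d)) lerD2l dec.
  apply: (le_trans (vnormD _ _)).
  have B1 := le_trans (@E0_bound rho' (q - T') rhor) (ler_wpM2l (ltW kap0) H2).
  have key : d * (kap * rnorm q) <= eta / 4.
    have -> : eta / 4 = d2 * (kap * (rnorm q + 1)) by rewrite /d2; field; rewrite !gt_eqF.
    apply: ler_pM; rewrite ?(ltW dpos)// ?mulr_ge0 ?rnorm_ge0 ?(ltW kap0)//; first exact: ltW.
    by rewrite ler_pM2l// lerDl.
  have B2 : vnorm (d%:C%C *: E1 rho' q) <= eta / 4.
    rewrite vnormZ normc_real gtr0_norm//; apply: le_trans key.
    by rewrite (ler_pM2l dpos); exact: (@E1_bound rho' q rhor).
  have B3 : vnorm (rem rho' d q) <= eta / 4.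
    have d01 : 0 <= d <= 1 by apply/andP; split; lra.
    apply: (le_trans (@rem_bound rho' d q rhor d01)); apply: le_trans key.
    have w0 : 0 <= kap * rnorm q by rewrite mulr_ge0 ?rnorm_ge0// ltW.
    have -> : kap * d ^+ 2 * rnorm q = d * (d * (kap * rnorm q)).
      by move: (rnorm q) => w; ring.
    by rewrite (ler_pM2l dpos) (ler_piMl w0 (ltW d11)).
  have B4 := vnormD (E0 rho' (q - T')) (d%:C%C *: E1 rho' q).
  by rewrite e1e in B1; lra.
Qed.

End OrbitTransport.

Section NetworkOrbits.
Context (R : realType) (p : R) (p1 : 1 <= p) (n m : nat) (N : network R n m).
Local Notation C := R[i].
Local Notation X := (state n m p1).
Implicit Types (x y : X) (h : nat -> R -> R).

Lemma Phi_minus_Psi : column_stochastic N -> Phi_minus N *m Psi N = 1%:M.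
Proof.
move=> stoch; apply/matrixP => i j; rewrite !mxE.
have [<-|ij] := eqVneq i j.
  rewrite -(stoch i); apply: eq_bigr => k _; rewrite !mxE.
  by case: ifP => _; rewrite ?mul1r// mul0r.
apply: big1 => k _; rewrite !mxE; case: eqP => [->|_]; last by rewrite mul0r.
by rewrite (negbTE ij) mulr0.
Qed.

(** A trace in the range of [Psi] is determined by its image under
    [Phi_minus], as [Phi_minus] is a left inverse of [Psi]. *)
Lemma domain_Am_trace x (b : 'cV[C]_n) : column_stochastic N -> domain (Am N p1) x ->
  Q N x = b -> continuous_repr x.1 1 = Psi N *m (x.2 + b).
Proof.
move=> stoch [_ [c cE]] <-; rewrite /Q cE mulmxA Phi_minus_Psi// mul1mx.
by rewrite addrC subrK.
Qed.

Lemma adjoint_orbit_A0 J h h' r x : column_stochastic N -> test_family h h' ->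
  domain (A0 N p1) x -> 0 <= r -> r + 1 <= J%:R ->
  adjoint_orbit N J h r (A0 N p1 x) + adjoint_orbit N J h' r x = 0.
Proof.
move=> stoch tf [dx Qx] r0 rJ; rewrite (adjoint_orbit_Am tf dx r0 rJ).
apply: big1 => j _; rewrite (domain_Am_trace stoch dx Qx) addr0 subrr.
by rewrite mulmx0 scaler0.
Qed.

Lemma family_continuous h h' (r : R) : (forall j, C1_deriv (h j) (h' j)) ->
  forall j, continuous (fun s => h j (s - r)).
Proof. by move=> dh j; exact: C1_continuous (C1_shift (- r) (dh j)). Qed.

Lemma family_continuous2 h h' (r d : R) : (forall j, C1_deriv (h j) (h' j)) ->
  forall j, continuous (fun s => h j (s - r + d)).
Proof.
move=> dh j; have := C1_continuous (C1_shift (- r + d) (dh j)).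
by rewrite (_ : (fun s => h j (s + (- r + d))) = fun s => h j (s - r + d))//;
  apply/funext => s; rewrite addrA.
Qed.

Lemma adjoint_orbit_expand J h h' (r d : R) y : (forall j, C1_deriv (h j) (h' j)) ->
  (forall j, continuous (h' j)) ->
  adjoint_orbit N J h (r - d) y = adjoint_orbit N J h r y + d%:C%C *: adjoint_orbit N J h' r y +
   adjoint_form N J (fun j s => h j (s - r + d) - h j (s - r) - d * h' j (s - r))
     (fun j => h j.+1 (- r + d) - h j.+1 (- r) - d * h' j.+1 (- r)) y.
Proof.
move=> dh ch'; set rem := adjoint_form _ _ _ _ _.
have ch r' j : continuous (fun s => h j (s - r')) .
  exact: (family_continuous dh).
have ch'r j : continuous (fun s => h' j (s - r)).
  move=> s; apply: (@continuous_comp _ _ _ (fun s => s - r) (h' j)); last exact: ch'.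
  by apply: cvgB; [exact: cvg_id|exact: cvg_cst].
have cd j : continuous (fun s => d * h' j (s - r)).
  by move=> s; apply: cvgM; [exact: cvg_cst|exact: ch'r].
have crem j : continuous (fun s => h j (s - r + d) - h j (s - r) - d * h' j (s - r)).
  move=> s; apply: cvgB; last exact: cd.
  by apply: cvgB; [exact: (@family_continuous2 h h' r d dh j)|exact: ch].
have cH j : continuous (fun s => 1 * (h j (s - r + d) - h j (s - r) - d * h' j (s - r)) + h j (s - r)).
  move=> s; apply: cvgD; last exact: ch.
  by apply: cvgM; [exact: cvg_cst|exact: crem].
transitivity (adjoint_form N J
   (fun j s => d * h' j (s - r) + (1 * (h j (s - r + d) - h j (s - r) - d * h' j (s - r)) + h j (s - r)))
   (fun j => d * h' j.+1 (- r) + (1 * (h j.+1 (- r + d) - h j.+1 (- r) - d * h' j.+1 (- r)) + h j.+1 (- r))) y).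
  have E1 : (fun j s => h j (s - (r - d))) = (fun j s => d * h' j (s - r) +
      (1 * (h j (s - r + d) - h j (s - r) - d * h' j (s - r)) + h j (s - r))).
    apply/funext => j; apply/funext => s; rewrite opprB addrCA [d + _]addrC.
    by move: (h j (s - r)) (h j (s - r + d)) (h' j (s - r)) => u1 u2 u3; ring.
  have E2 : (fun j => h j.+1 (- (r - d))) = (fun j => d * h' j.+1 (- r) +
      (1 * (h j.+1 (- r + d) - h j.+1 (- r) - d * h' j.+1 (- r)) + h j.+1 (- r))).
    apply/funext => j; rewrite opprB [d - r]addrC.
    by move: (h j.+1 (- r)) (h j.+1 (- r + d)) (h' j.+1 (- r)) => u1 u2 u3; ring.
  by rewrite /adjoint_orbit E1 E2.
rewrite adjoint_formDl// adjoint_formDl// -/rem scale1r -!/(adjoint_orbit _ _ _ _ _).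
by rewrite addrA addrC addrA.
Qed.

(** One constant for finitely many weights, on the interval reached by the
    arguments [s - r'] with [s] in [[0, 1]] and [r'] in [[0, r]]. *)
Lemma family_bounds h h' h'' J (r : R) : (forall j, C1_deriv (h j) (h' j)) ->
  (forall j, C1_deriv (h' j) (h'' j)) ->
  exists2 M : R, 0 < M & forall j, (j <= J)%N -> forall x : R, - r <= x <= 1 ->
    [/\ `|h j x| <= M, `|h' j x| <= M & forall d, 0 <= d <= 1 ->
       `|h j (x + d) - h j x - d * h' j x| <= M * d ^+ 2].
Proof.
move=> dh dh'.
have one j : exists M : R, 0 < M /\ forall x : R, - r <= x <= 1 ->
    [/\ `|h j x| <= M, `|h' j x| <= M & forall d, 0 <= d <= 1 ->
       `|h j (x + d) - h j x - d * h' j x| <= M * d ^+ 2].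
  have [M1 M10 hM1] := continuous_bounded_itv (- r) 1 (C1_continuous (dh j)).
  have [M2 M20 hM2] := continuous_bounded_itv (- r) 1 (C1_continuous (dh' j)).
  have [M3 M30 hM3] := taylor_bound (- r) 1 (dh j) (dh' j).
  exists (M1 + M2 + M3); split; first by lra.
  move=> x xr; split; [have := hM1 x xr|have := hM2 x xr|move=> d d01; have := hM3 x d xr d01]; try lra.
  move=> /le_trans; apply; rewrite ler_wpM2r ?sqr_ge0//; lra.
have [M MP] := choice one.
exists (\sum_(j < J.+1) M j).
  by rewrite big_ord_recl ltr_wpDr ?(MP _).1// sumr_ge0// => j _; exact: ltW (MP _).1.
move=> j jJ x xr; have le : M j <= \sum_(j < J.+1) M j.
  rewrite (bigD1 (Ordinal (jJ : (j < J.+1)%N)))//= lerDl sumr_ge0// => k _; exact: ltW (MP _).1.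
have [H1 H2 H3] := (MP j).2 x xr; split; [exact: le_trans le|exact: le_trans le|].
move=> d d01; apply: (le_trans (H3 d d01)).
by rewrite ler_wpM2r ?sqr_ge0.
Qed.

Context (T : R -> X -> X).
Context (genT : generates (A0 N p1) T).
Context (stoch : column_stochastic N).

Lemma orbit_adjoint J h h' h'' (r : R) x : test_family h h' -> test_family h' h'' ->
  domain (A0 N p1) x -> 0 <= r -> r + 1 <= J%:R ->
  adjoint_orbit N J h 0 (T r x) = adjoint_orbit N J h r x.
Proof.
move=> tf tf' dx r0 rJ.
have dh := tf_deriv tf; have dh' := tf_deriv tf'.
have ch' j : continuous (h' j) := C1_continuous (dh' j).
have [K K0 KP] := adjoint_form_bound p1 N J.
have [M M0 MP] := family_bounds J r dh dh'.
pose kap := K * M + 1.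
have kap0 : 0 < kap by rewrite ltr_wpDl// mulr_ge0// ltW.
have KMk : K * M <= kap by rewrite lerDl.
have orb_le (g : nat -> R -> R) rho y : (forall j, continuous (fun s => g j (s - rho))) ->
    (forall j, (j <= J)%N -> forall z, - r <= z <= 1 -> `|g j z| <= M) ->
    0 <= rho <= r -> vnorm (adjoint_orbit N J g rho y) <= kap * rnorm y.
  move=> cg gM /andP[rho0 rhor]; apply: (@le_trans _ _ (K * M * rnorm y)); last first.
    by rewrite ler_wpM2r ?rnorm_ge0.
  apply: KP => // j jJ; last by apply: gM => //; apply/andP; split; lra.
  move=> s /andP[s0 s1]; apply: gM; first exact: ltnW.
  by apply/andP; split; lra.
have hle rho y : 0 <= rho <= r -> vnorm (adjoint_orbit N J h rho y) <= kap * rnorm y.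
  move=> rhor; apply: orb_le => //; first exact: family_continuous dh.
  by move=> j jJ z zr; have [] := MP j jJ z zr.
have h'le rho y : 0 <= rho <= r -> vnorm (adjoint_orbit N J h' rho y) <= kap * rnorm y.
  move=> rhor; apply: orb_le => //; first exact: family_continuous dh'.
  by move=> j jJ z zr; have [] := MP j jJ z zr.
pose rem rho d y := adjoint_form N J (fun j s => h j (s - rho + d) - h j (s - rho) - d * h' j (s - rho))
     (fun j => h j.+1 (- rho + d) - h j.+1 (- rho) - d * h' j.+1 (- rho)) y.
have remle rho d y : 0 <= rho <= r -> 0 <= d <= 1 -> vnorm (rem rho d y) <= kap * d ^+ 2 * rnorm y.
  move=> /andP[rho0 rhor] d01; apply: (@le_trans _ _ (K * (M * d ^+ 2) * rnorm y)); last first.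
    by rewrite ler_wpM2r ?rnorm_ge0// mulrA ler_wpM2r// sqr_ge0.
  apply: KP => [j|j jJ s /andP[s0 s1]|j jJ].
  - move=> s; apply: cvgB; last first.
      by apply: cvgM; [exact: cvg_cst|exact: (@family_continuous h' h'' rho dh' j)].
    by apply: cvgB; [exact: (@family_continuous2 h h' rho d dh j)|exact: (@family_continuous h h' rho dh j)].
  - have zr : - r <= s - rho <= 1 by apply/andP; split; lra.
    by have [_ _] := MP j (ltnW jJ) _ zr; exact.
  - have zr : - r <= - rho <= 1 by apply/andP; split; lra.
    by have [_ _] := MP j.+1 jJ _ zr; exact.
have ch rho j : continuous (fun s => h j (s - rho)) := @family_continuous h h' rho dh j.
have ch'r rho j : continuous (fun s => h' j (s - rho)) := @family_continuous h' h'' rho dh' j.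
apply: (@orbit_transport _ _ (A0 N p1) T m genT r kap (adjoint_orbit N J h) (adjoint_orbit N J h') rem r0 kap0) => //.
- by move=> rho y z; rewrite /adjoint_orbit adjoint_formB.
- by move=> rho a y; rewrite /adjoint_orbit adjoint_formZ.
- by move=> rho y z; rewrite /adjoint_orbit adjoint_formB.
- by move=> rho d y; exact: adjoint_orbit_expand.
- move=> q rho dq /andP[rho0 rhor]; apply: adjoint_orbit_A0 => //.
  by apply: le_trans rJ; rewrite lerD2r.
Qed.

(** At time 0 the weights of index [j > 0] vanish on [[0, 1]]. *)
Lemma adjoint_orbit0 J h h' y : test_family h h' -> (0 < J)%N ->
  adjoint_orbit N J h 0 y = pair y.1 (h 0%N).
Proof.
move=> tf; case: J => // J _.
have ch j : continuous (fun s => h j (s - 0)) := @family_continuous h h' 0 (tf_deriv tf) j.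
have far j (s : R) : 0 <= s -> h j.+1 s = 0.
  move=> s0; apply: (tf_out tf); apply: le_trans s0.
  by rewrite subr_le0 ler1n.
rewrite /adjoint_orbit /adjoint_form [X in _ + X]big1 => [|j _]; last first.
  by rewrite far ?oppr0// scale0r.
rewrite big_ord_recl /= big1 => [|j _]; last first.
  have -> : pair y.1 (fun s => h (bump 0 j) (s - 0)) = 0.
    apply/vnorm_eq0/le_anti; rewrite vnorm_ge0 andbT.
    apply: (le_trans (@vnorm_pair_le _ _ _ _ _ _ 0 (ch _) _)).
      by move=> s /andP[s0 _]; rewrite subr0 /bump add1n far// normr0.
    by rewrite mulr0 mul0r.
  by rewrite mulmx0.
rewrite expr0 mul1mx !addr0; congr (pair y.1 _).
by apply/funext => s; rewrite subr0.
Qed.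

Lemma Am_linear (a : C) x y : domain (Am N p1) x -> domain (Am N p1) y ->
  [/\ domain (Am N p1) (a *: x + y),
      Am N p1 (a *: x + y) = a *: Am N p1 x + Am N p1 y &
      Q N (a *: x + y) = a *: Q N x + Q N y].
Proof.
move=> [Wx [cx Ex]] [Wy [cy Ey]].
have [W D tr] := W1pZD a Wx Wy.
have tr0 := tr 0 (introT andP (conj (lexx _) ler01)).
have tr1 := tr 1 (introT andP (conj ler01 (lexx _))).
split.
- split; first exact: W.
  by exists (a *: cx + cy); rewrite tr1 Ex Ey mulmxDr -scalemxAr.
- transitivity ((Lp_derivative (a *: x.1 + y.1),
      Phi_plus N *m continuous_repr (a *: x.1 + y.1) 0) : X); first by [].
  by rewrite D tr0 mulmxDr -scalemxAr.
- rewrite /Q tr1 mulmxDr -scalemxAr /= scalerBr.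
  by rewrite opprD [LHS]addrACA.
Qed.

(** The class of [s |-> s w], which has trace [w] at 1. *)
Lemma linear_lift (w : 'cV[C]_m) : exists f : Lp p1 m, W1p f /\ continuous_repr f 1 = w.
Proof.
have c1 (z : R) : {within `[0%R, 1%R]%classic, continuous (fun s : R => s * z)}.
  apply: continuous_subspaceT => s; apply: cvgM; [exact: cvg_id|exact: cvg_cst].
have c0 (z : R) : {within `[0%R, 1%R]%classic, continuous (fun _ : R => z)}.
  by apply: continuous_subspaceT => s; exact: cvg_cst.
have FL : in_Lp_vec p (fun s : R => s%:C%C *: w).
  move=> k; apply/andP; split.
    rewrite (_ : @complex.Re R \o _ = fun s => s * complex.Re (w k 0)).
      exact: Lfun_continuous01.
    by apply/funext => s /=; rewrite mxE cReM /= mul0r subr0.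
  rewrite (_ : @complex.Im R \o _ = fun s => s * complex.Im (w k 0)).
    exact: Lfun_continuous01.
  by apply/funext => s /=; rewrite mxE cImM /= mul0r addr0.
have GL : in_Lp_vec p (fun _ : R => w).
  by move=> k; apply/andP; split; apply: Lfun_continuous01 => //; exact: c0.
have [f Ff] := @Lp_of_fun _ _ p1 _ _ FL; have [g Gg] := @Lp_of_fun _ _ p1 _ _ GL.
have Fi := in_Lp_integrable01 p1 FL; have Gi := in_Lp_integrable01 p1 GL.
exists f; split.
  exists g; apply/is_Lp_derivativeP => phi tphi; have C1 := test_function_C1 tphi.
  rewrite /pair (pairing_ae_eq (Lp_fun_integrable f) Fi C1.2 Ff).
  rewrite (pairing_ae_eq (Lp_fun_integrable g) Gi (C1_continuous C1) Gg).
  have [_ phi1] := test_function_ends tphi.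
  have parts (z : R) : Rintegral lebesgue_measure `[0%R, 1%R]%classic (fun s : R => s * z * derive1 phi s) =
      - Rintegral lebesgue_measure `[0%R, 1%R]%classic (fun s : R => z * phi s).
    rewrite (@Rintegral_parts _ (fun=> z) phi _ 0 1 ler01 _ C1) ?phi1 ?mul0r ?sub0r ?opprK; last first.
      by apply: continuous_integrable_itv => s; exact: cvg_cst.
    apply: eq_Rintegral => y /=; rewrite inE/= in_itv/= => /andP[y0 _].
    rewrite Rintegral_cst//= lebesgue_measure_itv/= lte_fin.
    case: ltP => [_|y0'] /=; first by rewrite subr0; ring.
    have -> : y = 0 by apply/le_anti; rewrite y0 y0'.
    by rewrite !mul0r !mulr0.
  apply/colP => k; rewrite !mxE; apply/eqP; rewrite eq_complex /=.
  apply/andP; split; apply/eqP; rewrite -parts; apply: eq_Rintegral => s _.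
    by rewrite /reE mxE cReM /= mul0r subr0.
  by rewrite /imE mxE cImM /= mul0r addr0.
rewrite (@continuous_repr_unique _ _ p1 _ f _ _ Ff 1).
- by rewrite scale1r.
- move=> k; split.
    rewrite (_ : (fun _ => _) = fun s => s * complex.Re (w k 0)) ?c1//.
    by apply/funext => s /=; rewrite mxE cReM /= mul0r subr0.
  rewrite (_ : (fun _ => _) = fun s => s * complex.Im (w k 0)) ?c1//.
  by apply/funext => s /=; rewrite mxE cImM /= mul0r addr0.
- by rewrite ler01 lexx.
Qed.

(** [Q] is surjective on [ker (lam - A_m)]: a lift of [b] to the domain of [A_m]
    is corrected by an element of [D(A)] so that it falls into the kernel. *)
Lemma Q_invP (lam : C) (b : 'cV[C]_n) : resolvent_set (A0 N p1) lam ->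
  [/\ domain (Am N p1) (Q_inv N p1 lam b),
      lam *: Q_inv N p1 lam b = Am N p1 (Q_inv N p1 lam b) & Q N (Q_inv N p1 lam b) = b].
Proof.
move=> [[_ _ sur] _].
suff : exists x, [/\ domain (Am N p1) x, lam *: x - Am N p1 x = 0 & Q N x = b].
  move=> /(xgetPex 0)[dx eqx Qx]; split => //.
  by apply/eqP; rewrite -subr_eq0; apply/eqP.
have [f [Wf f1]] := linear_lift (Psi N *m b).
pose x0 : X := (f, 0).
have dx0 : domain (Am N p1) x0 by split=> //; exists b.
have Qx0 : Q N x0 = b by rewrite /Q /= f1 mulmxA Phi_minus_Psi// mul1mx subr0.
have [//|x1 [dx1 Qx1] eq1] := sur (lam *: x0 - Am N p1 x0).
have [dx eqx Qx] := Am_linear (- 1) dx1 dx0.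
exists ((- 1) *: x1 + x0); split; [exact: dx| |by rewrite Qx Qx1 scaler0 add0r].
rewrite eqx scalerDr scalerA mulrN1 scaleNr scaleN1r opprD addrACA.
have eq1' : lam *: x1 - Am N p1 x1 = lam *: x0 - Am N p1 x0 := eq1.
by rewrite -eq1' -opprD addNr.
Qed.

(** A test function turns the operator on the edges into a derivative of the
    test function. *)
Lemma pair_resolvent (lam : C) (x : X) h0 h1 : domain (A0 N p1) x -> test_family h0 h1 ->
  continuous (h1 0%N) ->
  pair (lam *: x - A0 N p1 x).1 (h0 0%N) = lam *: pair x.1 (h0 0%N) + pair x.1 (h1 0%N).
Proof.
move=> [[W _] _] tf c1; have c0 := C1_continuous (tf_deriv tf 0%N).
have e0 := compact_in01_out (tf_supp tf).
rewrite pairB// pairZ// (pair_parts W (tf_deriv tf 0%N)) !e0 ?lexx ?orbT// !scale0r subrr sub0r.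
by rewrite opprK.
Qed.

(** Extends [orbit_adjoint] from [D(A)] to all vectors, written as
    [lam x - A x]: pairing with [h0] trades [A] for one more derivative of the
    test family. *)
Lemma kernel_orbit_adjoint J h0 h1 h2 h3 (r : R) x (lam : C) :
  test_family h0 h1 -> test_family h1 h2 -> test_family h2 h3 ->
  domain (A0 N p1) x -> 0 <= r -> r + 1 <= J%:R ->
  pair (T r (lam *: x - A0 N p1 x)).1 (h0 0%N) = adjoint_orbit N J h0 r (lam *: x - A0 N p1 x).
Proof.
move=> tf tf1 tf2 dx r0 rJ.
have J0 : (0 < J)%N by rewrite lt0n; apply/eqP => JE; move: rJ; rewrite JE; lra.
have c1 := C1_continuous (tf_deriv tf1 0%N).
have [dTx ATx] := orbit_domain genT r0 dx.
have -> : T r (lam *: x - A0 N p1 x) = lam *: T r x - A0 N p1 (T r x).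
  by rewrite (semigroupB genT _ _ r0) (semigroupZ genT _ _ r0) ATx.
rewrite (pair_resolvent lam dTx tf c1).
rewrite -(adjoint_orbit0 (T r x) tf J0) -(adjoint_orbit0 (T r x) tf1 J0).
rewrite (orbit_adjoint tf tf1 dx r0 rJ) (orbit_adjoint tf1 tf2 dx r0 rJ).
have -> : adjoint_orbit N J h1 r x = - adjoint_orbit N J h0 r (A0 N p1 x).
  by apply/eqP; rewrite -addr_eq0 addrC; apply/eqP; exact: adjoint_orbit_A0.
have ch := @family_continuous h0 h1 r (tf_deriv tf).
by rewrite /adjoint_orbit adjoint_formB// adjoint_formZ.
Qed.

(** The response to an impulse: for [b] in [ker (lam - A_m)] with [Q b = c],
    the left-hand side is the image of [b] under [lam - A_m] computed in the
    weak sense along the orbit, and Green's identity reduces it to the boundary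
    defect [Psi c]. The factor [lam] and the vector [b] disappear. *)
Lemma orbit_kernel_pairing J h0 h1 h2 h3 h4 (r : R) (lam : C) (c : 'cV[C]_n) :
  resolvent_set (A0 N p1) lam ->
  test_family h0 h1 -> test_family h1 h2 -> test_family h2 h3 -> test_family h3 h4 ->
  0 <= r -> r + 1 <= J%:R ->
  lam *: pair (T r (Q_inv N p1 lam c)).1 (h0 0%N) + pair (T r (Q_inv N p1 lam c)).1 (h1 0%N) =
  \sum_(j < J) ((h0 j (1 - r))%:C%C *: (adjB N ^+ j *m (Psi N *m c))).
Proof.
move=> rlam tf tf1 tf2 tf3 r0 rJ; have [db lamb Qb] := Q_invP c rlam.
move: (Q_inv N p1 lam c) db lamb Qb => b db lamb Qb.
have [[_ _ sur] _] := rlam; have [//|x dx xb] := sur b.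
have -> : pair (T r b).1 (h0 0%N) = adjoint_orbit N J h0 r b.
  by rewrite -xb; exact: kernel_orbit_adjoint tf tf1 tf2 dx r0 rJ.
have -> : pair (T r b).1 (h1 0%N) = adjoint_orbit N J h1 r b.
  by rewrite -xb; exact: kernel_orbit_adjoint tf1 tf2 tf3 dx r0 rJ.
have ch := @family_continuous h0 h1 r (tf_deriv tf).
have -> : lam *: adjoint_orbit N J h0 r b = adjoint_orbit N J h0 r (Am N p1 b).
  by rewrite -lamb /adjoint_orbit adjoint_formZ.
rewrite (adjoint_orbit_Am tf db r0 rJ) (domain_Am_trace stoch db Qb).
by apply: eq_bigr => j _; rewrite -mulmxBr addrAC subrr add0r.
Qed.

End NetworkOrbits.

(** * Bochner integrals *)

(** [L] is real-linear and real-valued; it stands for the real and imaginary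
    parts of the entries of a complex-linear map with values in a space of
    columns. *)
Section BochnerFunctional.
Context (R : realType).
Local Notation C := R[i].
Local Notation mu := (@lebesgue_measure R).

(** The integral of a nonnegative function is a supremum over simple functions
    below it, hence monotone even without measurability; the norms in the
    definition of the Bochner integral are not assumed to be measurable. *)
Lemma integral_ge0_mono (D : set R) (f g : R -> \bar R) : (forall s, D s -> 0 <= f s)%E ->
  (forall s, D s -> f s <= g s)%E -> (\int[mu]_(s in D) f s <= \int[mu]_(s in D) g s)%E.
Proof.
move=> f0 fg; rewrite !ge0_integralE//; last by move=> s Ds; exact: le_trans (f0 s Ds) (fg s Ds).
apply: ereal_sup_le => _ [h hf <-]; exists h => // x; apply: (le_trans (hf x)).
by rewrite /patch; case: ifPn => // /[!inE]; exact: fg.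
Qed.

Context (X : normedModType C) (L : X -> R) (K : R).
Context (LB : forall x y, L (x - y) = L x - L y).
Context (LZ : forall (a : R) x, L (a%:C%C *: x) = a * L x).
Context (K0 : 0 < K).
Context (LK : forall x, `|L x| <= K * rnorm x).

Lemma functional_sum k (v : 'I_k -> X) : L (\sum_(j < k) v j) = \sum_(j < k) L (v j).
Proof.
have L0 : L 0 = 0 by have := LB 0 0; rewrite !subrr.
have LD x y : L (x + y) = L x + L y.
  by rewrite -[y in LHS]opprK LB -[- y]sub0r LB L0 sub0r opprK.
by rewrite (big_morph L LD L0).
Qed.

Lemma functional_simple (D : set R) (S : simple X) : measurable D -> (mu D < +oo)%E ->
  mu.-integrable D (EFin \o (fun s => L (simple_eval S s))) /\
  L (simple_integral D S) = \int[mu]_(s in D) L (simple_eval S s).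
Proof.
move=> mD Dfin.
have LS : (fun s => L (simple_eval S s)) = fun s =>
    \sum_(j < simple_size S) L (@simple_value _ _ S j) * \1_(@simple_set _ _ S j) s.
  apply/funext => s; rewrite /simple_eval functional_sum; apply: eq_bigr => j _.
  by rewrite indicE -(rmorph_nat (real_complex R)) LZ mulrC indicE.
have iS j : mu.-integrable D (EFin \o (\1_(@simple_set _ _ S j) : R -> R)).
  have mS := @simple_measurable _ _ S j.
  apply/integrableP; split; first exact/measurable_EFinP/measurable_indic.
  rewrite (_ : (fun x => _) = (fun x => (\1_(@simple_set _ _ S j) x)%:E)); last first.
    by apply/funext => s; rewrite gee0_abs// lee_fin.
  rewrite integral_indic//; apply: le_lt_trans Dfin.
  by apply: le_measure; rewrite ?inE//; exact: measurableI.
have iSc j : mu.-integrable D (EFin \o (fun s => L (@simple_value _ _ S j) * \1_(@simple_set _ _ S j) s)).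
  exact: integrable_scaler.
rewrite LS; split.
  rewrite (_ : EFin \o _ = fun s => (\sum_(j < simple_size S) (L (@simple_value _ _ S j) * \1_(@simple_set _ _ S j) s)%:E)%E); last first.
    by apply/funext => s; rewrite sumEFin.
  by apply: integrable_sum => // j _; exact: iSc.
rewrite /simple_integral functional_sum /Rintegral.
under eq_integral do rewrite -sumEFin.
rewrite integral_sum//.
rewrite (eq_bigr (fun j => (\int[mu]_(x in D) (L (@simple_value _ _ S j) * \1_(@simple_set _ _ S j) x))%:E)).
  2: by move=> j _; rewrite EFin_Rintegral.
rewrite sumEFin /=; apply: eq_bigr => j _; rewrite LZ mulrC RintegralZl//.
by rewrite /Rintegral integral_indic//; exact: simple_measurable.
Qed.

(** Both sides are approximated by their values on simple functions, with errors
    at most [K] times the errors in norm. *)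
Lemma functional_bochner (D : set R) (F : R -> X) z : measurable D -> (mu D < +oo)%E ->
  mu.-integrable D (EFin \o (fun s => L (F s))) -> is_bochner_integral D F z ->
  L z = \int[mu]_(s in D) L (F s).
Proof.
move=> mD Dfin LFi [S [_ SF Sz]].
apply/eqP; rewrite -subr_eq0 -normr_le0; apply/ler_addgt0Pr => e e0; rewrite add0r.
have e1 : 0 < e / (2 * K) by rewrite divr_gt0// mulr_gt0.
have e1C : 0 < (e / (2 * K))%:C%C :> C by rewrite ltcR.
have : \forall k \near \oo, `|L z - \int[mu]_(s in D) L (F s)| <= e; last first.
  by move=> /(filter_ex (F := \oo))[].
have : \forall k \near \oo, `|z - simple_integral D (S k)| <= (e / (2 * K))%:C%C.
  by move/cvgrPdist_le : Sz; exact.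
have : \forall k \near \oo, (\int[mu]_(r in D) (complex.Re `|F r - simple_eval (S k) r|)%:E <= (e / (2 * K))%:E)%E.
  move/fine_cvgP : SF => [fin /cvgrPdist_le/(_ _ e1)]; move: fin.
  apply: filterS2 => k fin; rewrite sub0r normrN => /(le_trans (ler_norm _)).
  by rewrite -lee_fin fineK.
apply: filterS2 => k H1 H2.
have [iS Seq] := functional_simple (S k) mD Dfin.
have -> : L z - \int[mu]_(s in D) L (F s) = L (z - simple_integral D (S k)) -
    \int[mu]_(s in D) (L (F s) - L (simple_eval (S k) s)).
  by rewrite LB Seq RintegralB// opprB addrA subrK.
have iLS : mu.-integrable D (EFin \o (fun s => L (F s) - L (simple_eval (S k) s))).
  exact: integrable_subr.
have B1 : `|L (z - simple_integral D (S k))| <= e / 2.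
  apply: (le_trans (LK _)); rewrite rnormE lecR in H2.
  have -> : e / 2 = K * (e / (2 * K)) by field; rewrite gt_eqF.
  by rewrite ler_pM2l.
have B2 : `|\int[mu]_(s in D) (L (F s) - L (simple_eval (S k) s))| <= e / 2.
  have iN : mu.-integrable D (EFin \o (fun s => `|L (F s) - L (simple_eval (S k) s)|)).
    exact: integrable_norm.
  apply: (le_trans (le_normr_Rintegral _ _)) => //.
  have -> : e / 2 = K * (e / (2 * K)) by field; rewrite gt_eqF.
  rewrite -ler_pdivrMl// -RintegralZl// -lee_fin -EFin_Rintegral//; last exact: integrable_scaler.
  apply: le_trans H1; apply: integral_ge0_mono => s Ds; rewrite lee_fin.
    by rewrite mulr_ge0// invr_ge0 ltW.
  by rewrite ler_pdivrMl// -LB; exact: LK.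
rewrite (le_trans (ler_normB _ _))//; lra.
Qed.
End BochnerFunctional.

(** * Iterated primitives of the control *)

Section IteratedPrimitives.
Context (R : realType).
Local Notation mu := (@lebesgue_measure R).
Local Notation Rm := (measurableTypeR R).
Local Notation I01 := (`[0%R, 1%R]%classic : set R).
Implicit Types (f H : R -> R) (h : nat -> R -> R).

(** Controls extended by 0 to negative times, and their iterated primitives. *)
Definition causal f := (forall a b : R, mu.-integrable `[a, b] (EFin \o f)) /\
  forall x : R, x < 0 -> f x = 0.

(** For [x < 0] the interval is empty and the value is 0. *)
Definition primitive0 f : R -> R := fun x => \int[mu]_(y in `[0, x]) f y.

(** The starting point may be moved to the left, which gives room for the
    fundamental theorem of calculus at [x = 0]. *)
Lemma primitive0E f (A x : R) : causal f -> A <= 0 -> primitive0 f x = \int[mu]_(y in `[A, x]) f y.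
Proof.
move=> [_ f0] A0; rewrite /primitive0 Rintegral_mkcond [RHS]Rintegral_mkcond.
congr Rintegral; apply/funext => y; rewrite !patchE !mem_itvcc.
have [y0|y0] := leP 0 y; first by rewrite (le_trans A0 y0).
by rewrite /= f0// if_same.
Qed.

Lemma primitive0B f (a b : R) : causal f -> a <= b ->
  \int[mu]_(y in `[a, b]) f y = primitive0 f b - primitive0 f a.
Proof.
move=> cf ab; have [fi _] := cf.
have [A [A0 Aa]] : exists A : R, A <= 0 /\ A <= a.
  by exists (Num.min 0 a); rewrite !ge_min !lexx orbT.
rewrite !(primitive0E _ cf A0) Rintegral_itvB ?bnd_simp//.
rewrite Rintegral_itv_obnd_cbnd//; apply: integrableS (fi a b) => //.
by apply: subset_itvr; rewrite bnd_simp.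
Qed.

Lemma primitive0_continuous f : causal f -> continuous (primitive0 f).
Proof.
move=> cf x; have [fi _] := cf.
have [A [A0 Ax]] : exists A : R, A <= 0 /\ A < x.
  by exists (Num.min 0 (x - 1)); rewrite ge_min lexx gt_min ltrBlDr ltrDl ltr01 orbT.
have Ab : A < x + 1 by rewrite (lt_trans Ax)// ltrDl.
have := parameterized_integral_continuous (ltW Ab) (fi A (x + 1)).
move=> /(continuous_within_itvP _ Ab)[/(_ x) + _ _].
rewrite in_itv/= Ax ltrDl ltr01 => /(_ isT).
by rewrite (_ : (fun y => _) = primitive0 f)//; apply/funext => y; rewrite (primitive0E y cf A0).
Qed.

Lemma causal_primitive0 f : causal f -> causal (primitive0 f).
Proof.
move=> cf; split; first by move=> a b; apply: continuous_integrable_itv; exact: primitive0_continuous.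
move=> x x0; rewrite /primitive0 set_itv_ge ?bnd_simp -?ltNge//.
by rewrite Rintegral_set0.
Qed.

Lemma integrable_shift_itv f (a b c : R) : mu.-integrable `[a + c, b + c] (EFin \o f) ->
  mu.-integrable `[a, b] (EFin \o (fun x => f (x + c))) /\
  \int[mu]_(x in `[a, b]) f (x + c) = \int[mu]_(x in `[a + c, b + c]) f x.
Proof.
move=> fi; pose g : Rm -> R := f \_ `[a + c, b + c].
have gi : mu.-integrable setT (EFin \o g) by exact: integrable_patch.
have gE : (fun x : Rm => g ((x : R) + c)) = (fun x => f (x + c)) \_ `[a, b].
  by apply/funext => x; rewrite /g !patchE !mem_itvcc !lerD2r.
have gs := integrable_shift c gi; split.
  by apply/integrable_mkcond => //; rewrite restrict_EFin -gE.
rewrite Rintegral_mkcond -gE integral_shift//; last by apply/measurable_EFinP; case/integrableP : gi.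
by rewrite [RHS]Rintegral_mkcond.
Qed.

Lemma weak_derivative_primitive0 f (c : R) : causal f ->
  is_weak_derivative (fun s => primitive0 f (s + c)) (fun s => f (s + c)).
Proof.
move=> cf phi tphi; have [fi _] := cf; have C1 := test_function_C1 tphi.
have [phi0 phi1] := test_function_ends tphi.
have [fci _] := @integrable_shift_itv f 0 1 c (fi _ _).
rewrite (Rintegral_parts ler01 fci C1) phi1 mul0r sub0r opprK.
have c'phi := C1.2.
have cP : continuous (fun s => primitive0 f (s + c)).
  move=> s; apply: (@continuous_comp _ _ _ (fun s => s + c) (primitive0 f)).
    by apply: cvgD; [exact: cvg_id|exact: cvg_cst].
  exact: primitive0_continuous.
transitivity (\int[mu]_(y in I01) (derive1 phi y * primitive0 f (y + c) - primitive0 f c * derive1 phi y)); last first.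
  apply: eq_Rintegral => y; rewrite mem_itvcc => /andP[y0 y1].
  have [_ ->] := @integrable_shift_itv f 0 y c (fi _ _).
  by rewrite primitive0B// ?lerD2r// add0r; ring.
have i1 : mu.-integrable I01 (EFin \o (fun y => derive1 phi y * primitive0 f (y + c))).
  apply: continuous_integrable_itv => y; apply: cvgM; [exact: c'phi|exact: cP].
have i2 : mu.-integrable I01 (EFin \o derive1 phi) by exact: continuous_integrable_itv.
rewrite RintegralB//; last exact: integrable_scaler.
rewrite RintegralZl// (FTC2_C1 C1 ler01) phi0 phi1 subrr mulr0 subr0.
by apply: eq_Rintegral => y _; rewrite mulrC.
Qed.

Fixpoint iterated_primitive0 f (j : nat) : R -> R :=
  if j is j'.+1 then primitive0 (iterated_primitive0 f j') else f.

Lemma causal_iterated f j : causal f -> causal (iterated_primitive0 f j).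
Proof. by move=> cf; elim: j => //= j; exact: causal_primitive0. Qed.

(** [j] integrations by parts transfer the antiderivatives from the test family
    to the control. The boundary terms at [t] vanish by the support of the weights
    ([h j] at [1 + i]), those at 0 because primitives start at 0. *)
Lemma iterated_parts h h' f (t : R) j : test_family h h' -> causal f -> 0 <= t ->
  \int[mu]_(s in `[0, t]) (f s * h j (s + (1 - t))) =
  \int[mu]_(s in `[0, t]) (iterated_primitive0 f j s * h 0%N (s + (1 - t + j%:R))).
Proof.
move=> tf cf t0.
suff gen i : \int[mu]_(s in `[0, t]) (iterated_primitive0 f i s * h j (s + (1 - t + i%:R))) =
  \int[mu]_(s in `[0, t]) (iterated_primitive0 f (i + j) s * h 0%N (s + (1 - t + (i + j)%:R))).
  by have := gen 0%N; rewrite addr0.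
elim: j i => [|j IH] i; first by rewrite addn0.
rewrite addnS -addSn -IH.
have [fi _] := causal_iterated i cf.
rewrite (Rintegral_parts t0 (fi 0 t) (C1_shift (1 - t + i%:R) (tf_deriv tf j.+1))).
rewrite (tf_out tf); last by rewrite -natr1; have : 0 <= i%:R :> R by []; have : 0 <= j%:R :> R by []; lra.
rewrite mul0r sub0r -mulN1r -RintegralZl//; last first.
  apply: continuous_integrable_itv => y; apply: cvgM.
    have := (C1_shift (1 - t + i%:R) (tf_deriv tf j.+1)).2; exact.
  exact: (primitive0_continuous (causal_iterated i cf)).
apply: eq_Rintegral => y _; rewrite (tf_step tf) -natr1 /= /primitive0.
by rewrite mulN1r mulNr opprK mulrC !addrA.
Qed.

(** The change of variables that turns time in [[0, t]] into position in
    [[0, 1]]: the integrand vanishes before time 0 since [f] is causal, and where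
    [xi] does. *)
Lemma iterated_shift xi f (t : R) j : continuous xi -> compact_in01 xi -> causal f -> 0 <= t ->
  \int[mu]_(s in `[0, t]) (f s * xi (s + (1 - t + j%:R))) =
  \int[mu]_(s in I01) (f (s + (t - 1 - j%:R)) * xi s).
Proof.
move=> cxi sxi cf t0; have [fi f0] := cf; set c := t - 1 - j%:R.
have out := compact_in01_out sxi.
pose g : Rm -> R := fun s => f s * xi (s - c).
have gE : (fun s => f s * xi (s + (1 - t + j%:R))) = g.
  by apply/funext => s; rewrite /g /c; congr (f s * xi (s + _)); ring.
have gi0 : mu.-integrable `[0, t] (EFin \o g).
  apply: integrable_mulc => // s; apply: (@continuous_comp _ _ _ (fun s => s - c) xi).
    by apply: cvgB; [exact: cvg_id|exact: cvg_cst].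
  exact: cxi.
have gp : g \_ `[0, t] = g.
  apply/funext => s; rewrite patchE mem_itvcc; case: ifPn => //.
  rewrite negb_and -!ltNge => /orP[s0|ts]; first by rewrite /g f0// mul0r.
  rewrite /g out ?mulr0//; apply/orP; right; rewrite /c.
  by have : 0 <= j%:R :> R by []; lra.
have gi : mu.-integrable setT (EFin \o g) by rewrite -gp; exact: integrable_patch.
rewrite gE Rintegral_mkcond gp -(integral_shift (c := c)); last 2 first.
  by apply/measurable_EFinP; case/integrableP : gi.
  exact: integrable_shift.
rewrite [RHS]Rintegral_mkcond; congr Rintegral; apply/funext => s.
rewrite patchE mem_itvcc /g addrK; case: ifPn => //.
rewrite negb_and -!ltNge => s01; rewrite out ?mulr0//.
by case/orP: s01 => /ltW ->; rewrite ?orbT.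
Qed.

End IteratedPrimitives.

(** * Sobolev spaces *)

Section SobolevMembership.
Context (R : realType) (p : R) (p1 : 1 <= p).
Local Notation C := R[i].
Local Notation mu := (@lebesgue_measure R).
Local Notation I01 := (`[0%R, 1%R]%classic : set R).
Implicit Types (f g : R -> R) (u v w : R -> C).

Lemma Lfun_restrict f (D : set R) : measurable D -> f \in Lfun mu p%:E ->
  f \_ D \in Lfun mu p%:E.
Proof.
move=> mD fL; have [mf _] := (in_LfunP p1 _).1 fL.
apply: (Lfun_dominated p1 _ _ fL); last first.
  by move=> x; rewrite patchE; case: ifP => // _; rewrite normr0.
apply/(measurable_restrictT (f : measurableTypeR R -> R) mD).
exact: measurable_funS mf.
Qed.

(** A shifted primitive of [f] has the shift of [f] as its weak derivative. *)
Lemma sobolev_iterated f g (c : R) k : causal f -> causal g ->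
  f \in Lfun mu p%:E -> g \in Lfun mu p%:E ->
  sobolev p k (fun s => (iterated_primitive0 f k (s + c) +i* iterated_primitive0 g k (s + c))%C).
Proof.
move=> cf cg fL gL.
have shift h : causal h -> continuous (fun s => primitive0 h (s + c)).
  move=> ch s; apply: (@continuous_comp _ _ _ (fun s => s + c) (primitive0 h)).
    by apply: cvgD; [exact: cvg_id|exact: cvg_cst].
  exact: primitive0_continuous.
elim: k => [|k IH].
  by apply/andP; split; apply: Lfun_restrict => //; exact: Lfun_shift.
have cfk := causal_iterated k cf; have cgk := causal_iterated k cg.
split.
  by apply/andP; split; apply: Lfun_continuous01 => //; apply: continuous_subspaceT; exact: shift.
eexists; last exact: IH.
by split; exact: weak_derivative_primitive0.
Qed.

Lemma sobolev_in_Lp k u : sobolev p k u -> in_Lp p I01 u.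
Proof. by case: k => [//|k] []. Qed.

Lemma sobolevW k u : sobolev p k.+1 u -> sobolev p k u.
Proof.
elim: k u => [|k IH] u [uL [v uv vk]]; first exact: uL.
by split=> //; exists v => //; exact: IH.
Qed.

Lemma sobolev_le k j u : (j <= k)%N -> sobolev p k u -> sobolev p j u.
Proof.
elim: k => [|k IH]; first by rewrite leqn0 => /eqP ->.
by rewrite leq_eqVlt => /predU1P[->//|]; rewrite ltnS => jk /sobolevW; exact: IH.
Qed.

Lemma sobolev0 k : sobolev p k (fun=> 0 : C).
Proof.
elim: k => [|k IH]; first exact: in_Lp0.
split; first exact: in_Lp0.
exists (fun=> 0) => //.
by split=> phi _; (under eq_Rintegral do rewrite /= mul0r); (under [in RHS]eq_Rintegral do rewrite /= mul0r);
   rewrite /Rintegral integral0 oppr0.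
Qed.

(** Three summands, since a complex multiple mixes real and imaginary parts. *)
Lemma weak_derivativeZD (a b : R) f1 g1 f2 g2 f3 g3 :
  mu.-integrable I01 (EFin \o f1) -> mu.-integrable I01 (EFin \o f2) -> mu.-integrable I01 (EFin \o f3) ->
  mu.-integrable I01 (EFin \o g1) -> mu.-integrable I01 (EFin \o g2) -> mu.-integrable I01 (EFin \o g3) ->
  is_weak_derivative f1 g1 -> is_weak_derivative f2 g2 -> is_weak_derivative f3 g3 ->
  is_weak_derivative (fun s => a * f1 s + b * f2 s + f3 s) (fun s => a * g1 s + b * g2 s + g3 s).
Proof.
move=> if1 if2 if3 ig1 ig2 ig3 D1 D2 D3 phi tphi; have C1 := test_function_C1 tphi.
have lin (h1 h2 h3 H : R -> R) : mu.-integrable I01 (EFin \o h1) ->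
    mu.-integrable I01 (EFin \o h2) -> mu.-integrable I01 (EFin \o h3) -> continuous H ->
    \int[mu]_(s in I01) ((a * h1 s + b * h2 s + h3 s) * H s) =
    a * \int[mu]_(s in I01) (h1 s * H s) + b * \int[mu]_(s in I01) (h2 s * H s) +
    \int[mu]_(s in I01) (h3 s * H s).
  move=> i1 i2 i3 cH.
  have j1 := integrable_mulc i1 cH; have j2 := integrable_mulc i2 cH; have j3 := integrable_mulc i3 cH.
  under eq_Rintegral do rewrite 2!mulrDl -!mulrA.
  rewrite RintegralD//; last by apply: integrable_addr => //; exact: integrable_scaler.
  rewrite RintegralD//; do ?exact: integrable_scaler.
  by rewrite !RintegralZl.
rewrite !lin//; [|exact: C1_continuous C1|exact: C1.2].
by rewrite D1// D2// D3// !mulrN -!opprD.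
Qed.

Lemma in_Lp_integrable u : in_Lp p I01 u ->
  mu.-integrable I01 (EFin \o (@complex.Re R \o u)) /\ mu.-integrable I01 (EFin \o (@complex.Im R \o u)).
Proof.
move=> /andP[uR uI]; have mu1 : (mu I01 < +oo)%E by rewrite muI01 ltry.
by split; apply: (Lfun_integrable_finite p1).
Qed.

Lemma sobolevZD k (a : C) u v : sobolev p k u -> sobolev p k v ->
  sobolev p k (fun s => a * u s + v s).
Proof.
elim: k u v => [|k IH] u v; first exact: in_LpZD.
move=> [uL [u' uu' u'k]] [vL [v' vv' v'k]]; split; first exact: in_LpZD.
exists (fun s => a * u' s + v' s); last exact: IH.
have [uR uI] := in_Lp_integrable uL; have [vR vI] := in_Lp_integrable vL.
have [u'R u'I] := in_Lp_integrable (sobolev_in_Lp u'k).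
have [v'R v'I] := in_Lp_integrable (sobolev_in_Lp v'k).
have [uRd uId] := uu'; have [vRd vId] := vv'.
have reE (w1 w2 : R -> C) : @complex.Re R \o (fun s => a * w1 s + w2 s) =
    fun s => complex.Re a * complex.Re (w1 s) + (- complex.Im a) * complex.Im (w1 s) + complex.Re (w2 s).
  by apply/funext => s /=; rewrite cReD cReM mulNr.
have imE (w1 w2 : R -> C) : @complex.Im R \o (fun s => a * w1 s + w2 s) =
    fun s => complex.Re a * complex.Im (w1 s) + complex.Im a * complex.Re (w1 s) + complex.Im (w2 s).
  by apply/funext => s /=; rewrite cImD cImM.
by split; rewrite ?reE ?imE; apply: weak_derivativeZD.
Qed.

Lemma sobolev_sum k (I : Type) (r : seq I) (c : I -> C) (u : I -> R -> C) :
  (forall j, sobolev p k (u j)) -> sobolev p k (fun s => \sum_(j <- r) c j * u j s).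
Proof.
move=> uk; elim: r => [|j r IH].
  by rewrite (_ : (fun _ => _) = fun=> 0); [exact: sobolev0|apply/funext => s; rewrite big_nil].
rewrite (_ : (fun _ => _) = fun s => c j * u j s + \sum_(i <- r) c i * u i s).
  exact: sobolevZD.
by apply/funext => s; rewrite big_cons.
Qed.

End SobolevMembership.

(** * Powers of the adjacency matrices *)

Section PowerSpan.
Context (F : fieldType).

(** By the Cayley-Hamilton theorem, [M ^ j] only depends on the remainder of
    [X ^ j] modulo the characteristic polynomial. *)
Lemma expmx_span d (M : 'M[F]_d) j :
  exists a : nat -> F, M ^+ j = \sum_(k < d) a k *: M ^+ k.
Proof.
case: d M => [|d] M.
  by exists (fun=> 0); apply/matrixP => -[].
pose q := 'X^j %% char_poly M.
exists (fun k => q`_k).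
have sq : (size q <= d.+1)%N.
  rewrite -ltnS -(size_char_poly M) ltn_modp -size_poly_gt0 size_char_poly//.
have -> : M ^+ j = horner_mx M q.
  have : horner_mx M ('X^j) = horner_mx M ('X^j %/ char_poly M * char_poly M + q).
    by rewrite -divp_eq.
  by rewrite rmorphD rmorphM /= Cayley_Hamilton mulr0 add0r rmorphXn /= horner_mx_X.
rewrite {1}(_ : q = \sum_(k < d.+1) q`_k *: 'X^k).
  rewrite linear_sum; apply: eq_bigr => k _.
  by rewrite linearZ /= rmorphXn /= horner_mx_X.
apply/polyP => k; rewrite coef_sum.
have [kd|dk] := ltnP k d.+1.
  rewrite (bigD1 (Ordinal kd))//= coefZ coefXn eqxx mulr1 big1 ?addr0// => i ik.
  rewrite coefZ coefXn; case: eqP => [ki|]; rewrite ?mulr0//.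
  by move: ik; rewrite -val_eqE /= ki eqxx.
rewrite nth_default ?(leq_trans sq)// big1// => i _.
by rewrite coefZ coefXn gtn_eqF ?mulr0// (leq_trans (ltn_ord i)).
Qed.

End PowerSpan.

Section NetworkPowers.
Context (R : realType) (n m : nat) (N : network R n m).
Local Notation C := R[i].

Lemma Psi_adjA k : Psi N *m adjA N ^+ k = adjB N ^+ k *m Psi N.
Proof.
elim: k => [|k IH]; first by rewrite !expr0 mulmx1 mul1mx.
rewrite !exprS -[adjB N * _]/(adjB N *m _) -[adjA N * _]/(adjA N *m _).
rewrite -mulmxA -IH.
by rewrite /adjA /adjB !mulmxA.
Qed.

(** [A] and [B] are of size [n] and [m]; Cayley-Hamilton is applied to the
    smaller one, and [Psi A^k = B^k Psi] transfers the relation from [A] to [B]. *)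
Lemma adjB_power_span (v : 'cV[C]_n) j : exists a : nat -> C,
  adjB N ^+ j *m (Psi N *m v) = \sum_(k < minn m n) a k *: (adjB N ^+ k *m (Psi N *m v)).
Proof.
have [mn|nm] := leqP m n.
  have [a aE] := expmx_span (adjB N) j; exists a; rewrite aE mulmx_suml.
  by apply: eq_bigr => k _; rewrite scalemxAl.
have [a aE] := expmx_span (adjA N) j; exists a.
rewrite mulmxA -Psi_adjA aE mulmx_sumr mulmx_suml.
by apply: eq_bigr => k _; rewrite mulmxA -Psi_adjA -scalemxAr -scalemxAl.
Qed.

(** Powers up to the minimum are kept as they are, so that a term of order [j]
    is only ever rewritten into terms of order [k <= j]. *)
Lemma adjB_power_coefficients (v : 'cV[C]_n) : exists c : nat -> nat -> C, forall j,
  (forall k, (j < k <= minn m n)%N -> c j k = 0) /\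
  adjB N ^+ j *m (Psi N *m v) =
    \sum_(k < (minn m n).+1) c j k *: (adjB N ^+ k *m (Psi N *m v)).
Proof.
have /choice[a aE] := adjB_power_span v.
exists (fun j k => if (j <= minn m n)%N then (j == k)%:R else if (k < minn m n)%N then a j k else 0).
move=> j; have [jl|lj] := leqP j (minn m n); split.
- by move=> k /andP[jk _]; rewrite ltn_eqF.
- rewrite (bigD1 (Ordinal (jl : (j < (minn m n).+1)%N)))//= eqxx scale1r big1 ?addr0// => k kj.
  rewrite eq_sym; case: eqP => [kj'|_]; last by rewrite scale0r.
  by move: kj; rewrite -val_eqE /= kj' eqxx.
- by move=> k /andP[jk kl]; move: (leq_trans jk kl); rewrite ltnNge ltnW.
- rewrite big_ord_recr /= ltnn scale0r addr0 [LHS]aE.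
  by apply: eq_bigr => k _; rewrite ltn_ord.
Qed.

End NetworkPowers.

Section ComplexIntegral.
Context (R : realType).
Local Notation C := R[i].
Local Notation mu := (@lebesgue_measure R).
Implicit Types (a b : R -> C) (D : set R).

Definition cintegrable D a := mu.-integrable D (EFin \o (@complex.Re R \o a)) /\
  mu.-integrable D (EFin \o (@complex.Im R \o a)).

Definition cintegral D a : C :=
  ((\int[mu]_(s in D) complex.Re (a s)) +i* (\int[mu]_(s in D) complex.Im (a s)))%C.

Lemma cintegralMD D a b (w : C) : measurable D -> cintegrable D a -> cintegrable D b ->
  cintegrable D (fun s => a s * w + b s) /\
  cintegral D (fun s => a s * w + b s) = cintegral D a * w + cintegral D b.
Proof.
move=> mD [aR aI] [bR bI].
have reE : @complex.Re R \o (fun s => a s * w + b s) =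
    fun s => (complex.Re w * complex.Re (a s) - complex.Im w * complex.Im (a s)) + complex.Re (b s).
  by apply/funext => s /=; rewrite cReD cReM; ring.
have imE : @complex.Im R \o (fun s => a s * w + b s) =
    fun s => (complex.Im w * complex.Re (a s) + complex.Re w * complex.Im (a s)) + complex.Im (b s).
  by apply/funext => s /=; rewrite cImD cImM; ring.
have i1 : mu.-integrable D (EFin \o (fun s => complex.Re w * complex.Re (a s) - complex.Im w * complex.Im (a s))).
  by apply: integrable_subr => //; exact: integrable_scaler.
have i2 : mu.-integrable D (EFin \o (fun s => complex.Im w * complex.Re (a s) + complex.Re w * complex.Im (a s))).
  by apply: integrable_addr => //; exact: integrable_scaler.
split; first by split; rewrite ?reE ?imE; exact: integrable_addr.
have intR : \int[mu]_(s in D) complex.Re (a s * w + b s) =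
    complex.Re w * \int[mu]_(s in D) complex.Re (a s) -
    complex.Im w * \int[mu]_(s in D) complex.Im (a s) + \int[mu]_(s in D) complex.Re (b s).
  rewrite -[LHS]/(Rintegral mu D (@complex.Re R \o _)) reE RintegralD//.
  by rewrite RintegralB ?RintegralZl//; exact: integrable_scaler.
have intI : \int[mu]_(s in D) complex.Im (a s * w + b s) =
    complex.Im w * \int[mu]_(s in D) complex.Re (a s) +
    complex.Re w * \int[mu]_(s in D) complex.Im (a s) + \int[mu]_(s in D) complex.Im (b s).
  rewrite -[LHS]/(Rintegral mu D (@complex.Im R \o _)) imE RintegralD//.
  by rewrite RintegralD ?RintegralZl//; exact: integrable_scaler.
rewrite /cintegral intR intI.
apply/eqP; rewrite eq_complex cReD cImD cReM cImM /=; apply/andP.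
by split; apply/eqP; ring.
Qed.

Lemma cintegral_sum D J (a : nat -> R -> C) (w : nat -> C) : measurable D ->
  (forall j, cintegrable D (a j)) ->
  cintegrable D (fun s => \sum_(j < J) a j s * w j) /\
  cintegral D (fun s => \sum_(j < J) a j s * w j) = \sum_(j < J) cintegral D (a j) * w j.
Proof.
move=> mD ai; elim: J => [|J [IH1 IH2]].
  rewrite (_ : (fun _ => _) = fun=> 0); last by apply/funext => s; rewrite big_ord0.
  rewrite big_ord0; split; last by rewrite /cintegral /Rintegral !integral0.
  by split; exact: integrable0.
rewrite (_ : (fun _ => _) = fun s => a J s * w J + \sum_(j < J) a j s * w j).
  have [I1 I2] := cintegralMD (w J) mD (ai J) IH1; split=> //.
  by rewrite I2 IH2 big_ord_recr /= addrC.
by apply/funext => s; rewrite big_ord_recr /= addrC.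
Qed.

End ComplexIntegral.

Section Reachability.
Context (R : realType) (p : R) (p1 : 1 <= p) (n m : nat) (N : network R n m).
Local Notation C := R[i].
Local Notation X := (state n m p1).
Local Notation mu := (@lebesgue_measure R).
Local Notation I01 := (`[0%R, 1%R]%classic : set R).

Lemma in_Lp_vec_sum J (u : nat -> R -> C) (W : nat -> 'cV[C]_m) :
  (forall j, in_Lp p I01 (u j)) -> in_Lp_vec p (fun s => \sum_(j < J) u j s *: W j).
Proof.
move=> uL k; rewrite (_ : (fun _ => _) = fun s => \sum_(j < J) W j k 0 * u j s); last first.
  by apply/funext => s; rewrite summxE; apply: eq_bigr => j _; rewrite mxE mulrC.
elim: J => [|J IH].
  by rewrite (_ : (fun _ => _) = fun=> 0); [exact: in_Lp0|apply/funext => s; rewrite big_ord0].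
rewrite (_ : (fun _ => _) = fun s => W J k 0 * u J s + \sum_(j < J) W j k 0 * u j s).
  exact: in_LpZD.
by apply/funext => s; rewrite big_ord_recr /= addrC.
Qed.

Lemma pairing_sum J (u : nat -> R -> C) (W : nat -> 'cV[C]_m) (xi : R -> R) :
  continuous xi -> (forall j, in_Lp p I01 (u j)) ->
  pairing (fun s => \sum_(j < J) u j s *: W j) xi =
  \sum_(j < J) cintegral I01 (fun s => u j s * (xi s)%:C%C) *: W j.
Proof.
move=> cxi uL.
have uxi j : cintegrable I01 (fun s => u j s * (xi s)%:C%C).
  have [uR uI] := in_Lp_integrable p1 (uL j); split.
    rewrite (_ : @complex.Re R \o _ = fun s => complex.Re (u j s) * xi s).
      exact: integrable_mulc.
    by apply/funext => s /=; rewrite cReM /= mulr0 subr0.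
  rewrite (_ : @complex.Im R \o _ = fun s => complex.Im (u j s) * xi s).
    exact: integrable_mulc.
  by apply/funext => s /=; rewrite cImM /= mulr0 add0r.
apply/colP => k; rewrite summxE mxE.
rewrite (eq_bigr (fun j : 'I_J => cintegral I01 (fun s => u j s * (xi s)%:C%C) * W j k 0)); last first.
  by move=> j _; rewrite mxE.
rewrite -(cintegral_sum J (fun j => W j k 0) (measurable_itv _) uxi).2 /cintegral.
have E s : \sum_(j < J) u j s * (xi s)%:C%C * W j k 0 =
    (\sum_(j < J) u j s *: W j) k 0 * (xi s)%:C%C.
  by rewrite summxE mulr_suml; apply: eq_bigr => j _; rewrite mxE mulrAC.
congr (_ +i* _)%C; apply: eq_Rintegral => s _; rewrite E.
  by rewrite cReM /= mulr0 subr0.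
by rewrite cImM /= mulr0 add0r.
Qed.

Lemma resolvent_pairing_bound (lam : C) (xi xi1 : R -> R) : continuous xi -> continuous xi1 ->
  exists2 K : R, 0 < K & forall x : X,
    vnorm (lam *: pair x.1 xi + pair x.1 xi1) <= K * rnorm x.
Proof.
move=> cxi cxi1.
have [M1 M10 hM1] := continuous_bounded_itv 0 1 cxi.
have [M2 M20 hM2] := continuous_bounded_itv 0 1 cxi1.
pose K := Normc.normc lam * (4 * m%:R * M1) + 4 * m%:R * M2.
have K0 : 0 <= K.
  have l0 : 0 <= Normc.normc lam by rewrite Defs.normcE sqrtr_ge0.
  by rewrite addr_ge0// !mulr_ge0// ltW.
exists (K + 1); first by rewrite ltr_wpDl.
move=> x; apply: (@le_trans _ _ (K * rnorm x)); last first.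
  by rewrite ler_wpM2r ?rnorm_ge0// lerDl.
have x1 : Lp_vec_norm p (Lp_fun x.1) <= rnorm x by exact: (rnorm_prod1 x).
apply: (le_trans (vnormD _ _)); rewrite vnormZ mulrDl -mulrA; apply: lerD.
  rewrite ler_wpM2l ?Defs.normcE ?sqrtr_ge0//.
  apply: (le_trans (vnorm_pair_le x.1 cxi hM1)).
  by rewrite ler_wpM2l// !mulr_ge0// ltW.
apply: (le_trans (vnorm_pair_le x.1 cxi1 hM2)).
by rewrite ler_wpM2l// !mulr_ge0// ltW.
Qed.

Lemma bochner_resolvent_pairing (lam : C) (xi xi1 : R -> R) (D : set R) (F : R -> X) z
    (g : R -> 'cV[C]_m) : continuous xi -> continuous xi1 ->
  measurable D -> (mu D < +oo)%E ->
  (forall s, D s -> lam *: pair (F s).1 xi + pair (F s).1 xi1 = g s) ->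
  (forall k, cintegrable D (fun s => g s k 0)) ->
  is_bochner_integral D F z ->
  lam *: pair z.1 xi + pair z.1 xi1 = \col_k cintegral D (fun s => g s k 0).
Proof.
move=> cxi cxi1 mD Dfin Fg gi Fz.
pose Lam (x : X) := lam *: pair x.1 xi + pair x.1 xi1.
have [K K0 LK] := resolvent_pairing_bound lam cxi cxi1.
have LamB x y : Lam (x - y) = Lam x - Lam y.
  by rewrite /Lam /= !pairB// scalerBr opprD addrACA.
have LamZ (a : C) x : Lam (a *: x) = a *: Lam x.
  by rewrite /Lam /= !pairZ// scalerDr !scalerA mulrC.
have nck (w : 'cV[C]_m) k : Normc.normc (w k 0) <= vnorm w.
  by rewrite /vnorm (bigD1 k)//= lerDl sumr_ge0// => j _; rewrite Defs.normcE sqrtr_ge0.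
have eqD (G H : R -> R) : (forall s, D s -> G s = H s) -> mu.-integrable D (EFin \o H) ->
    mu.-integrable D (EFin \o G).
  by move=> GH; apply: eq_integrable => // s /set_mem Ds /=; rewrite GH.
apply/colP => k; rewrite [RHS]mxE -/(Lam z).
have LamF s : D s -> Lam (F s) k 0 = g s k 0 by move=> Ds; rewrite /Lam Fg.
have [gR gI] := gi k.
apply/eqP; rewrite eq_complex; apply/andP; split; apply/eqP.
  rewrite (@functional_bochner _ _ (fun x => complex.Re (Lam x k 0)) K _ _ K0 _ D F z mD Dfin _ Fz) /=.
  - by apply: eq_Rintegral => s /set_mem Ds; rewrite LamF.
  - by move=> x y; rewrite LamB !mxE raddfB.
  - by move=> a x; rewrite LamZ mxE cReM /= mul0r subr0.
  - move=> x; apply: (le_trans _ (LK x)); apply: (le_trans _ (nck _ k)).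
    by rewrite Defs.normcE -sqrtr_sqr ler_wsqrtr// lerDl sqr_ge0.
  - by apply: eqD gR => s Ds /=; rewrite LamF.
rewrite (@functional_bochner _ _ (fun x => complex.Im (Lam x k 0)) K _ _ K0 _ D F z mD Dfin _ Fz) /=.
- by apply: eq_Rintegral => s /set_mem Ds; rewrite LamF.
- by move=> x y; rewrite LamB !mxE raddfB.
- by move=> a x; rewrite LamZ mxE cImM /= mul0r addr0.
- move=> x; apply: (le_trans _ (LK x)); apply: (le_trans _ (nck _ k)).
  by rewrite Defs.normcE -sqrtr_sqr ler_wsqrtr// lerDr sqr_ge0.
- by apply: eqD gI => s Ds /=; rewrite LamF.
Qed.

End Reachability.

(** * The reachable space *)

Section Representation.
Context (R : realType) (p : R) (p1 : 1 <= p) (n m : nat) (N : network R n m).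
Local Notation C := R[i].
Local Notation X := (state n m p1).
Local Notation mu := (@lebesgue_measure R).
Local Notation I01 := (`[0%R, 1%R]%classic : set R).

Lemma itv_finite (a b : R) : (mu (`[a, b] : set R) < +oo)%E.
Proof. by rewrite lebesgue_measure_itv/=; case: ifP => // _; rewrite -EFinB ltry. Qed.

Lemma causal_restrict (f : R -> R) (t : R) : f \_ `[0, t] \in Lfun mu p%:E ->
  causal (f \_ `[0, t]).
Proof.
move=> fL; split.
  move=> a b; apply: (Lfun_integrable_finite p1) => //; first exact: itv_finite.
  exact: Lfun_restrict.
by move=> x x0; rewrite patchE mem_itvcc leNgt x0.
Qed.

(** Four derivatives: [orbit_kernel_pairing] differentiates the test function
    once in its statement, twice for the Taylor estimate of the orbit and once for
    the reduction of the kernel vector to [D(A)]. *)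
Lemma test_families (a b : R) (k : nat) : 0 < a -> a < b -> b < 1 ->
  exists h0 h1 h2 h3 h4, [/\ h0 0%N = cutoff 4 a b k, test_family h0 h1, test_family h1 h2,
    test_family h2 h3 & test_family h3 h4].
Proof.
move=> a0 ab b1; set xi := cutoff 4 a b k.
have C4 : Cn 4 xi := Cn_cutoff 4 a b k.
have [xi1 D1 C3] := Cn_C1 C4; have [xi2 D2 C2] := Cn_C1 C3.
have [xi3 D3 C1] := Cn_C1 C2; have [xi4 D4 _] := Cn_C1 C1.
have sxi : compact_in01 xi.
  exists a, b; split=> // s; rewrite in_itv/= => sab.
  by apply: cutoff_out; [exact: ltW|apply: contra sab => /andP[/ltW -> /ltW ->]].
have [h0 [h1 [tf h0E h1E]]] := test_family_exists D1 sxi; rewrite -h1E in D2.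
have tf1 := test_family_next tf D2; have tf2 := test_family_next tf1 D3.
have tf3 := test_family_next tf2 D4.
by exists h0, h1, (next_family xi2 h1), (next_family xi3 (next_family xi2 h1)),
  (next_family xi4 (next_family xi3 (next_family xi2 h1))).
Qed.

Context (T : R -> X -> X) (i : 'I_n) (lam : C) (t : R).
Context (genT : generates (A0 N p1) T) (stoch : column_stochastic N).
Context (rlam : resolvent_set (A0 N p1) lam) (t0 : 0 <= t).

(** The control after [j] crossings of the network, read at position [s] of an
    edge: it left the control vertex [1 - s + j] units of time before [t] and has
    been integrated [j] times. *)
Definition delayed_primitive (u : R -> C) (j : nat) (s : R) : C :=
  (iterated_primitive0 ((@complex.Re R \o u) \_ `[0, t]) j (s + (t - 1 - j%:R)) +i*
   iterated_primitive0 ((@complex.Im R \o u) \_ `[0, t]) j (s + (t - 1 - j%:R)))%C.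

Lemma delayed_primitive_pairing u h h' j : in_Lp p `[0, t] u -> test_family h h' ->
  cintegrable `[0, t] (fun s => u s * (h j (s + (1 - t)))%:C%C) /\
  cintegral `[0, t] (fun s => u s * (h j (s + (1 - t)))%:C%C) =
  cintegral I01 (fun s => delayed_primitive u j s * (h 0%N s)%:C%C).
Proof.
move=> /andP[uR uI] tf.
have cR := causal_restrict uR; have cI := causal_restrict uI.
have ch0 := C1_continuous (tf_deriv tf 0%N).
have chj := C1_continuous (C1_shift (1 - t) (tf_deriv tf j)).
have reE (a : R -> C) (b : R -> R) : (fun s => complex.Re (a s * (b s)%:C%C)) = fun s => complex.Re (a s) * b s.
  by apply/funext => s; rewrite cReM /= mulr0 subr0.
have imE (a : R -> C) (b : R -> R) : (fun s => complex.Im (a s * (b s)%:C%C)) = fun s => complex.Im (a s) * b s.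
  by apply/funext => s; rewrite cImM /= mulr0 add0r.
have key (f : R -> R) : causal (f \_ `[0, t]) ->
    \int[mu]_(s in `[0, t]) (f s * h j (s + (1 - t))) =
    \int[mu]_(s in I01) (iterated_primitive0 (f \_ `[0, t]) j (s + (t - 1 - j%:R)) * h 0%N s).
  move=> cf; rewrite -(iterated_shift _ ch0 (tf_supp tf))//; last exact: causal_iterated.
  rewrite -(iterated_parts _ tf cf t0); apply: eq_Rintegral => s ts.
  by rewrite patchE ts.
split.
  split.
    rewrite -[EFin \o _]/(EFin \o (fun s => complex.Re (u s * (h j (s + (1 - t)))%:C%C))) reE.
    by apply: integrable_mulc => //; apply: (Lfun_integrable_finite p1) => //; exact: itv_finite.
  rewrite -[EFin \o _]/(EFin \o (fun s => complex.Im (u s * (h j (s + (1 - t)))%:C%C))) imE.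
  by apply: integrable_mulc => //; apply: (Lfun_integrable_finite p1) => //; exact: itv_finite.
by rewrite /cintegral !reE !imE /= -key// -key.
Qed.

(** Paired with a cutoff [xi], both sides are the sum over [j] of the integral of
    [u] against [h j (. + 1 - t)], times [B^j Psi v]. For
    [j >= t + 1] the delayed primitives are 0 on [[0, 1]]. *)
Lemma reachable_representation u y : in_Lp p `[0, t] u ->
  controllability_map N i T lam t u y ->
  (forall j, sobolev p j (delayed_primitive u j)) /\
  exists J, represents (fun s => \sum_(j < J) delayed_primitive u j s *:
    (adjB N ^+ j *m (Psi N *m vertex R i))) y.1.
Proof.
move=> uL [z [bz dz ->]]; set W := fun j => adjB N ^+ j *m (Psi N *m vertex R i).
have usob j : sobolev p j (delayed_primitive u j).
  have /andP[uR uI] := uL.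
  by apply: sobolev_iterated => //; exact: causal_restrict.
split=> //.
have [J tJ] : exists J : nat, t + 1 <= J%:R.
  by exists (Num.bound (t + 1)); apply/ltW/archi_boundP; rewrite addr_ge0.
exists J.
have uLj j : in_Lp p I01 (delayed_primitive u j) := sobolev_in_Lp (usob j).
have FL := in_Lp_vec_sum p1 J W uLj.
apply: (@represents_of_tests _ _ _ _ 4 _ _ FL) => a b k a0 ab b1.
have [h0 [h1 [h2 [h3 [h4 [<- tf tf1 tf2 tf3]]]]]] := test_families k a0 ab b1.
have c0 := C1_continuous (tf_deriv tf 0%N); have c1 := C1_continuous (tf_deriv tf1 0%N).
rewrite (pairing_sum p1 J W c0 uLj) (pair_resolvent lam dz tf c1).
pose g s := \sum_(j < J) (u s * (h0 j (s + (1 - t)))%:C%C) *: W j.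
have dp j := delayed_primitive_pairing j uL tf.
have gE k' : (fun s => g s k' 0) =
    fun s => \sum_(j < J) (u s * (h0 j (s + (1 - t)))%:C%C) * W j k' 0.
  by apply/funext => s; rewrite summxE; apply: eq_bigr => j _; rewrite mxE.
have gsum k' := cintegral_sum J (fun j => W j k' 0) (measurable_itv _) (fun j => (dp j).1).
rewrite (bochner_resolvent_pairing (g := g) c0 c1 _ (itv_finite 0 t) _ _ bz)//; last 2 first.
- move=> s; rewrite /= in_itv /= => /andP[s0 st].
  rewrite /B_lam (orbit_kernel_pairing genT stoch (J := J) _ rlam tf tf1 tf2 tf3); [|lra|lra].
  apply: eq_bigr => j _; rewrite /B_ctrl -!scalemxAr scalerA mulrC.
  by congr ((_ * (h0 j _)%:C%C) *: _); lra.
- by move=> k'; rewrite gE; exact: (gsum k').1.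
apply/colP => k'; rewrite mxE summxE.
rewrite gE (gsum k').2; apply: eq_bigr => j _.
by rewrite (dp j).2 [RHS]mxE.
Qed.

End Representation.

Theorem corollary5p15 (R : realType) (p : R) (p1 : 1 <= p) (n m : nat)
    (N : network R n m) (Nstoch : column_stochastic N) (i : 'I_n)
    (T : R -> state n m p1 -> state n m p1) (genT : generates (A0 N p1) T)
    (lam : R[i]) (lamA : resolvent_set (A0 N p1) lam)
    (t : R) (ht : (minn m n)%:R <= t) :
  let l := minn m n in
  let v := vertex R i in
  let S1 := [set f : Lp p1 m | exists2 u : nat -> R -> R[i],
      (forall k, (k <= l)%N -> sobolev p k (u k)) &
      represents (fun s => Psi N *m
        \sum_(k < l.+1) (u k s *: (adjA N ^+ k *m v))) f] in
  let S2 := [set f : Lp p1 m | exists2 u : nat -> R -> R[i],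
      (forall k, (k <= l)%N -> sobolev p k (u k)) &
      represents (fun s =>
        \sum_(k < l.+1) (u k s *: (adjB N ^+ k *m (Psi N *m v)))) f] in
  fst @` exact_reachability N i T lam t `<=` S1 /\ S1 = S2.
Proof.
move=> l v S1 S2.
have t0 : 0 <= t by exact: le_trans ht.
have PsiE (u : nat -> R -> R[i]) :
    (fun s => Psi N *m \sum_(k < l.+1) (u k s *: (adjA N ^+ k *m v))) =
    (fun s => \sum_(k < l.+1) (u k s *: (adjB N ^+ k *m (Psi N *m v)))).
  apply/funext => s; rewrite mulmx_sumr; apply: eq_bigr => k _.
  by rewrite -scalemxAr !mulmxA Psi_adjA.
have S12 : S1 = S2.
  by apply/seteqP; split=> f [u uk]; [rewrite PsiE|rewrite -PsiE] => fu; exists u.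
split=> //; rewrite S12 => _ [y [u uL uy] <-].
have [usob [J yJ]] := reachable_representation genT Nstoch lamA t0 uL uy.
(* Only the primitives of order [j >= k] contribute to the coefficient of order
   [k], which is why it lies in [W^{k,p}]. *)
have [c cP] := adjB_power_coefficients N v.
pose w k j : R -> R[i] := if (k <= j)%N then delayed_primitive t u j else fun=> 0.
exists (fun k s => \sum_(j < J) c j k * w k j s).
  move=> k kl; apply: (sobolev_sum p1 (index_enum 'I_J) (fun j : 'I_J => c j k) (u := fun j : 'I_J => w k j)) => j.
  by rewrite /w; case: ifP => kj; [exact: sobolev_le kj (usob j)|exact: sobolev0].
apply: filterS yJ => s + Ds => /(_ Ds) ->.
rewrite [RHS](eq_bigr (fun k : 'I_l.+1 => \sum_(j < J) (c j k * w k j s) *: (adjB N ^+ k *m (Psi N *m v)))); last first.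
  by move=> k _; rewrite scaler_suml.
rewrite exchange_big /=; apply: eq_bigr => j _.
rewrite (cP j).2 scaler_sumr; apply: eq_bigr => k _; rewrite scalerA mulrC /w.
case: leqP => // jk; rewrite (cP j).1 ?mul0r ?scale0r ?jk//=.
by rewrite -ltnS.
Qed.
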